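(* Let $\mathcal{H},\mathcal{G}$ be Hilbert spaces and let $\mathcal{A}:\mathcal{D}(\mathcal{A})\subset\mathcal{H}\to\mathcal{H}$ and $\mathcal{B}:\mathcal{D}(\mathcal{B})\subset\mathcal{H}\to\mathcal{G}$ be linear operators satisfying conditions (A) and (B) stated in the context, with $T_0\ge 0$ the constant from (B). Let $T>T_0$, $M\in H^2(0,T)$, and $\sigma\in C^1[0,T]$ with $\sigma(0)\ne0$. Then there exists $C>0$ such that for every $f\in\mathcal{H}$, the solution $u:[0,T]\to\mathcal{H}$ of $$u''(t)+\mathcal{A}u(t)=\int_0^t M(t-s)\,\mathcal{A}u(s)\,ds+\sigma(t)f,\quad t\in[0,T],\qquad u(0)=0,\quad u'(0)=0,$$ satisfies $$C^{-1}\|f\|_{\mathcal{H}}\le\|\mathcal{B}u\|_{H^1([0,T];\mathcal{G})}\le C\|f\|_{\mathcal{H}}.$$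
   Context: Condition (A): $\mathcal{A}:\mathcal{D}(\mathcal{A})\subset\mathcal{H}\to\mathcal{H}$ is self-adjoint, closed with dense range, has compact resolvent, and is semibounded: there is $c>0$ with $\langle\mathcal{A}u,u\rangle\ge -c\|u\|^2$ for all $u\in\mathcal{D}(\mathcal{A})$. $\mathcal{H}^1$ denotes the completion of $\mathcal{D}(\mathcal{A})$ in the norm $\|x\|_1^2:=\|x\|^2+\||\mathcal{A}|^{1/2}x\|^2$. Condition (B): $\mathcal{B}:\mathcal{D}(\mathcal{B})\subset\mathcal{H}\to\mathcal{G}$ is closed with dense range, and there exists $T_0\ge0$ such that for any $T>T_0$ there exists $C>0$ such that for all $(w_0,w_1)\in\mathcal{H}^1\times\mathcal{H}$ the solution $w$ of $w''(t)+\mathcal{A}w(t)=0$ on $[0,T]$, $w(0)=w_0$, $w'(0)=w_1$, satisfies $$C^{-1}\|(w_0,w_1)\|_{\mathcal{H}^1\times\mathcal{H}}\le\|\mathcal{B}w\|_{L^2([0,T];\mathcal{G})}\le C\|(w_0,w_1)\|_{\mathcal{H}^1\times\mathcal{H}}.$$ Here $\mathcal{B}w$ is the function $t\mapsto\mathcal{B}w(t)$. By (A), $\mathcal{H}$ has an orthonormal basis $\{\phi_n\}_{n\ge1}$ of eigenfunctions, $\mathcal{A}\phi_n=\mu_n\phi_n$; the $\phi_n$ lie in $\mathcal{D}(\mathcal{B})$ (implicit in (B)). Solutions are understood by expansion in this basis (separation of variables): $u=\sum_n y_n\phi_n$ where the scalar function $y_n=\langle u,\phi_n\rangle$ solves $y_n''+\mu_n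 y_n=\mu_n\int_0^t M(t-s)y_n(s)\,ds+\sigma(t)\langle f,\phi_n\rangle$ with $y_n(0)=y_n'(0)=0$ (and analogously, with $M=0$, $\sigma=0$ and initial data $\langle w_0,\phi_n\rangle,\langle w_1,\phi_n\rangle$, for $w$ in (B)). *)

(* Defs.v *)
From HB Require Import structures.
From mathcomp Require Import all_boot all_order all_algebra.
From mathcomp Require Import sesquilinear.
From mathcomp Require Import all_classical all_reals all_analysis.

Set Implicit Arguments.
Unset Strict Implicit.
Unset Printing Implicit Defensive.

Import Order.TTheory GRing.Theory Num.Theory.
Import numFieldNormedType.Exports.
Local Open Scope classical_set_scope.
Local Open Scope ring_scope.

(* Scalars are real.  A complex Hilbert space is covered through restriction of
   scalars, with Re <x, y> as inner product: self-adjointness, compactness of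
   the resolvent, eigenspaces and all the norms below are unchanged. *)
HB.mixin Record CompleteNormedModule_isHilbert (R : realType) (H : Type)
    of CompleteNormedModule R H := {
  dot : {dot H for (@idfun R)};
  dot_norm : forall x : H, dot x x = `|x| ^+ 2 }.

#[short(type="hilbertType")]
HB.structure Definition Hilbert (R : realType) :=
  {H of CompleteNormedModule_isHilbert R H & CompleteNormedModule R H}.

Notation "'[ x , y ]" := (dot x y) : ring_scope.

(* The values of opfun outside opdom are irrelevant: every definition below
   uses it on opdom only. *)
Record operator (R : realType) (V W : lmodType R) := Operator {
  opdom : set V;
  opfun :> V -> W;
  opdom0 : opdom 0;
  opdom_lin : forall (a : R) x y, opdom x -> opdom y -> opdom (a *: x + y);
  opfun_lin : forall (a : R) x y, opdom x -> opdom y ->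
    opfun (a *: x + y) = a *: opfun x + opfun y }.

Section Operators.
Context {R : realType}.

Definition graph (V W : lmodType R) (A : operator V W) : set (V * W) :=
  [set p | opdom A p.1 /\ p.2 = A p.1].

Definition closed_op (V W : hilbertType R) (A : operator V W) :=
  closed (graph A).

Definition dense_range (V W : hilbertType R) (A : operator V W) :=
  dense (A @` opdom A).

Section Endo.
Variable H : hilbertType R.
Implicit Types A P S : operator H H.

(* The graph of the adjoint A^*. *)
Definition adjoint_graph A : set (H * H) :=
  [set p | forall u, opdom A u -> '[A u, p.1] = '[u, p.2]].

Definition self_adjoint A := dense (opdom A) /\ graph A = adjoint_graph A.

Definition is_resolvent A (l : R) (Q : H -> H) :=
  (forall x, opdom A (Q x) /\ A (Q x) - l *: Q x = x) /\
  (forall u, opdom A u -> Q (A u - l *: u) = u).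

Definition compact_op (Q : H -> H) :=
  precompact (Q @` [set x | `|x| <= 1]).

Definition compact_resolvent A :=
  exists l Q, is_resolvent A l Q /\ compact_op Q.

Definition semibounded A :=
  exists2 c : R, 0 < c &
    forall u, opdom A u -> - c * `|u| ^+ 2 <= '[A u, u].

Definition condition_A A :=
  [/\ self_adjoint A, closed_op A, dense_range A, compact_resolvent A
    & semibounded A].

Definition nonneg_op A := forall u, opdom A u -> 0 <= '[A u, u].

(* The graph of A \o A on its natural domain. *)
Definition square_graph A : set (H * H) :=
  [set p | [/\ opdom A p.1, opdom A (A p.1) & p.2 = A (A p.1)]].

(* |A| = (A^2)^(1/2) and, below, |A|^(1/2), through the uniqueness of the
   nonnegative self-adjoint square root. *)
Definition is_abs A P :=
  [/\ self_adjoint P, nonneg_op P & square_graph P = square_graph A].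

Definition is_abs_sqrt A S :=
  exists2 P, is_abs A P &
    [/\ self_adjoint S, nonneg_op S & square_graph S = graph P].

(* With S = |A|^(1/2), which is closed, the completion of opdom A for norm1 is
   realized inside H: it is the closure of opdom A in opdom S for the graph
   norm of S. *)
Definition H1 A S : set H :=
  [set x | opdom S x /\ closure [set (z, S z) | z in opdom A] (x, S x)].

Definition norm1 S (x : H) : R := Num.sqrt (`|x| ^+ 2 + `|S x| ^+ 2).

End Endo.
End Operators.

Section FunctionSpaces.
Context {R : realType}.
Implicit Types T : R.
Local Notation mu := (@lebesgue_measure R).

Definition simple_vfun (V : normedModType R) (s : R -> V) :=
  exists (n : nat) (E : 'I_n -> set R) (c : 'I_n -> V),
    (forall i, measurable (E i)) /\
    s = fun t => \sum_(i < n) (\1_(E i) t : R) *: c i.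

Definition strongly_measurable (V : normedModType R) (D : set R) (g : R -> V) :=
  exists s : nat -> R -> V,
    (forall k, simple_vfun (s k)) /\
    (forall t, D t -> s k t @[k --> \oo] --> g t).

(* g represents an element of L^2([0,T]; V). *)
Definition L2 (V : normedModType R) T (g : R -> V) :=
  strongly_measurable `[0, T] g /\
  (\int[mu]_(t in `[0%R, T]) (`|g t| ^+ 2)%:E < +oo)%E.

Definition normL2 (V : normedModType R) T (g : R -> V) : R :=
  Num.sqrt (\int[mu]_(t in `[0, T]) (`|g t| ^+ 2)).

(* C^1_c(0,T), the usual test functions for Sobolev spaces on an interval. *)
Definition test_function T (phi : R -> R) :=
  [/\ forall t, derivable phi t 1, continuous (derive1 phi) &
      exists a b, [/\ 0 < a, b < T & forall t, t \notin `[a, b] -> phi t = 0]].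

Definition weak_derivative T (f f' : R -> R) :=
  forall phi, test_function T phi ->
    \int[mu]_(t in `[0, T]) (f t * derive1 phi t)
    = - \int[mu]_(t in `[0, T]) (f' t * phi t).

(* A Bochner integral is determined by its inner products, so the vector-valued
   identity is tested against every h. *)
Definition weak_vderivative (G : hilbertType R) T (g g' : R -> G) :=
  forall h : G, weak_derivative T (fun t => '[g t, h]) (fun t => '[g' t, h]).

(* Norm in H^1([0,T]; G) of g with weak derivative g'. *)
Definition normH1 (G : hilbertType R) T (g g' : R -> G) : R :=
  Num.sqrt (normL2 T g ^+ 2 + normL2 T g' ^+ 2).

Definition in_H2 T (M : R -> R) :=
  exists M1 M2 : R -> R,
    [/\ L2 T M, L2 T M1, L2 T M2, weak_derivative T M M1
      & weak_derivative T M1 M2].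

(* l is the derivative of f at t within [0,T] (one-sided at 0 and T). *)
Definition has_deriv T (f : R -> R) (t l : R) :=
  (f s - f t) / (s - t) @[s --> within `[0, T] t^'] --> l.

Definition in_C1 T (f : R -> R) :=
  exists2 f' : R -> R, {within `[0, T], continuous f'} &
    forall t, t \in `[0, T] -> has_deriv T f t (f' t).

End FunctionSpaces.

Section Equations.
Context {R : realType}.
Variable H : hilbertType R.
Implicit Types (A : operator H H) (T : R).
Local Notation mu := (@lebesgue_measure R).

(* y'' = F on [0,T], y(0) = y0, y'(0) = y1. *)
Definition second_order_ivp T (y F : R -> R) (y0 y1 : R) :=
  exists z : R -> R,
    [/\ forall t, t \in `[0, T] -> has_deriv T y t (z t),
        forall t, t \in `[0, T] -> has_deriv T z t (F t),
        y 0 = y0 & z 0 = y1].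

(* Separation of variables.  Under condition_A the eigenvectors of A contain an
   orthonormal basis (phi_n), and u = \sum_n <u, phi_n> phi_n; prescribing the
   coefficient of u along each eigenvector is prescribing all the <u, phi_n>. *)
Definition wave_solution A T (w0 w1 : H) (w : R -> H) :=
  forall (phi : H) (m : R), opdom A phi -> A phi = m *: phi ->
    second_order_ivp T (fun t => '[w t, phi]) (fun t => - m * '[w t, phi])
      '[w0, phi] '[w1, phi].

Definition memory_solution A T (M sigma : R -> R) (f : H) (u : R -> H) :=
  forall (phi : H) (m : R), opdom A phi -> A phi = m *: phi ->
    second_order_ivp T (fun t => '[u t, phi])
      (fun t => - m * '[u t, phi]
        + m * (\int[mu]_(s in `[0, t]) (M (t - s) * '[u s, phi]))
        + sigma t * '[f, phi])
      0 0.

(* g represents the function t |-> B (w t) on [0,T], which for a closed B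
   makes sense as soon as w t is in opdom B for almost every t. *)
Definition observes (G : hilbertType R) (B : operator H G) T
    (w : R -> H) (g : R -> G) :=
  \forall t \ae mu, t \in `[0, T] -> opdom B (w t) /\ g t = B (w t).

Definition condition_B (G : hilbertType R) A (B : operator H G) (T0 : R) :=
  [/\ closed_op B, dense_range B &
    exists2 S, is_abs_sqrt A S &
    forall T, T0 < T -> exists2 C : R, 0 < C &
      forall (w0 w1 : H) (w : R -> H), H1 A S w0 -> wave_solution A T w0 w1 w ->
      exists g : R -> G,
        [/\ observes B T w g, L2 T g,
            C^-1 * Num.sqrt (norm1 S w0 ^+ 2 + `|w1| ^+ 2) <= normL2 T g &
            normL2 T g <= C * Num.sqrt (norm1 S w0 ^+ 2 + `|w1| ^+ 2)]].

End Equations.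

(* Main.v *)
Require Import Defs.
From HB Require Import structures.
From mathcomp Require Import all_boot all_order all_algebra.
From mathcomp Require Import ring lra.
From mathcomp Require sesquilinear.
From mathcomp Require Import all_classical all_reals all_analysis measurable_realfun.
Set Implicit Arguments.
Unset Strict Implicit.
Unset Printing Implicit Defensive.
Import Order.TTheory GRing.Theory Num.Theory.
Import numFieldNormedType.Exports.
Local Open Scope classical_set_scope.
Local Open Scope ring_scope.

(* Work in the commutative ring of distributions a delta + f on [0, T] under
   convolution, with I = 1 the integration operator.  Write M = I M_d,
   sigma = I sigma_d, and let D be such that (1 - M) (1 + I D)^2 = 1.  If s solves
   s'' + m s = 0, s(0) = 0, s'(0) = 1, and s_k = ((-t)^k / k!) s, then
   y' = sum_k D^k (1 + I D)^2 sigma_d s_k is the derivative of the solution of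
   y'' + m y = m M y + sigma with zero data.  Since m enters this series only
   through s, y'(t) = ka(t) s(t) + \int_0^t K(t, r) s(r) dr with
   ka(t) = sigma(0) exp (- a t), a the coefficient of delta in D, and with ka and K
   independent of m.  Hence a single Volterra operator maps the wave w with
   data (0, f) to u' and, B being closed, B w to (B u)'.  It is bounded on L^2
   and, as ka does not vanish, boundedly invertible by Gronwall; so the norm of
   B u in H^1 is equivalent to the L^2 norm of B w, which condition (B) compares
   with the norm of f. *)

(** * Hilbert spaces *)

(** On the Laplace side, with [z] dual to [t], the memory equation reads
    [(z^2 + m (1 - M)) y = sigma]. As [(1 - M) (1 + I D)^2 = 1] and [z (1 + I D) = z + D], this is
    [y = (1 + I D)^2 sigma / ((z + D)^2 + m)], that is, the transform [1 / (z^2 + m)] of [s]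
    evaluated at [z + D]. Taylor expansion in [D] produces the series, because the [k]-th derivative
    in [z] divided by [k!] is multiplication by [(-t)^k / k!]; these factorials also make it
    converge without any smallness. The coefficient [a] is [M(0) / 2]. The obstacle is that the
    eigenvalues are unbounded and that [B] has no relation to the eigenbasis, so estimates mode by
    mode cannot be added up; an operator acting on the time variable alone passes through [B].
    Vector integrals and membership in the domain of [B] are both reduced to scalar identities by
    testing against fixed vectors, the latter through the double orthogonal of the graph of [B]. *)

Section Dot.
Context {R : realType} {H : hilbertType R}.
Implicit Types (x y z : H) (a : R).

Lemma dotC x y : '[x, y] = '[y, x].
Proof. by rewrite sesquilinear.hermC /= expr0 mul1r. Qed.

Lemma dotDl x y z : '[x + y, z] = '[x, z] + '[y, z].
Proof. exact: sesquilinear.linearDl. Qed.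

Lemma dotDr x y z : '[z, x + y] = '[z, x] + '[z, y].
Proof. exact: sesquilinear.linearDr. Qed.

Lemma dotZl a x y : '[a *: x, y] = a * '[x, y].
Proof. exact: sesquilinear.linearZl_LR. Qed.

Lemma dotZr a x y : '[x, a *: y] = a * '[x, y].
Proof. by rewrite dotC dotZl dotC. Qed.

Lemma dotNl x y : '[- x, y] = - '[x, y].
Proof. exact: sesquilinear.linearNl. Qed.

Lemma dotNr x y : '[x, - y] = - '[x, y].
Proof. exact: sesquilinear.linearNr. Qed.

Lemma dot0l x : '[0, x] = 0 :> R.
Proof. exact: sesquilinear.linear0l. Qed.

Lemma dot0r x : '[x, 0] = 0 :> R.
Proof. exact: sesquilinear.linear0r. Qed.

Lemma dotBl x y z : '[x - y, z] = '[x, z] - '[y, z].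
Proof. by rewrite dotDl dotNl. Qed.

Lemma dotBr x y z : '[z, x - y] = '[z, x] - '[z, y].
Proof. by rewrite dotDr dotNr. Qed.

Lemma dot_suml n (c : 'I_n -> H) y : '[\sum_i c i, y] = \sum_i '[c i, y].
Proof.
elim/big_rec2: _ => [|i u v _ <-]; by rewrite ?dot0l ?dotDl.
Qed.

Lemma dotxx x : '[x, x] = `|x| ^+ 2 :> R.
Proof. exact: dot_norm. Qed.

Lemma dotxx_ge0 x : 0 <= '[x, x] :> R.
Proof. by rewrite dotxx sqr_ge0. Qed.

Lemma sqr_normD x y : `|x + y| ^+ 2 = `|x| ^+ 2 + 2 * '[x, y] + `|y| ^+ 2.
Proof. rewrite -!dotxx dotDl !dotDr (dotC y x); ring. Qed.

Lemma sqr_normB x y : `|x - y| ^+ 2 = `|x| ^+ 2 - 2 * '[x, y] + `|y| ^+ 2.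
Proof. by rewrite sqr_normD dotNr normrN; ring. Qed.

Lemma dot_le x y : `| '[x, y] | <= `|x| * `|y|.
Proof.
have [->|y0] := eqVneq y 0; first by rewrite dot0r !normr0 mulr0.
rewrite -(@ler_pXn2r _ 2) ?nnegrE ?mulr_ge0// exprMn real_normK ?num_real//.
have y2 : 0 < `|y| ^+ 2 by rewrite exprn_gt0// normr_gt0.
pose z := `|y| ^+ 2 *: x - '[x, y] *: y; have := sqr_ge0 `|z|; rewrite /z.
rewrite sqr_normB dotZl dotZr !normrZ !exprMn !real_normK ?num_real//.
move=> h; rewrite -(ler_pM2l y2) -subr_ge0.
apply: le_trans h _; lra.
Qed.

Lemma cvg_dotl (T : Type) (F : set_system T) {FF : Filter F} (f : T -> H) l y :
  f @ F --> l -> '[f t, y] @[t --> F] --> '[l, y].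
Proof.
move=> fl; apply/cvgrPdist_lt => e e0.
have d0 : 0 < e / (`|y| + 1) by rewrite divr_gt0// ltr_wpDl.
move/cvgrPdist_lt/(_ _ d0): fl; apply: filterS => t.
rewrite -dotBl ltr_pdivlMr ?ltr_wpDl// => h.
apply: le_lt_trans (dot_le _ _) (le_lt_trans _ h).
by rewrite ler_wpM2l// lerDl.
Qed.

End Dot.

Lemma cauchy_rate (R : realType) (V : completeNormedModType R) (v : nat -> V)
    (b : nat -> R) : b @ \oo --> 0 ->
  (forall n m, `|v n - v m| <= b n + b m) -> exists l : V, v @ \oo --> l.
Proof.
move=> b0 vb; apply/(@cvg_ex V); apply: cauchy_cvg; apply/cauchy_ballP => e e0.
have e2 : 0 < e / 2 by lra.
move/cvgrPdist_lt/(_ _ e2): b0 => be.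
pose P := [set n | `|0 - b n| < e / 2].
exists (v @` P, v @` P) => /=.
  split; (apply: filterS be => n hn; by exists n).
move=> [x y] /= [[n hn <-] [m hm <-]]; rewrite -ball_normE /=.
apply: le_lt_trans (vb n m) _; move: hn hm; rewrite /P /= !sub0r !normrN => hn hm.
apply: le_lt_trans (ler_norm _) (le_lt_trans (ler_normD _ _) _); lra.
Qed.

Lemma cvg_inv_succ (R : realType) (c : R) : c / n.+1%:R @[n --> \oo] --> 0.
Proof.
rewrite -[X in _ --> X](mulr0 c).
by apply: cvgMr; exact: cvg_harmonic.
Qed.

(* Minimizing [q v v - 2 * l v] over [D]: the parallelogram law makes minimizing
   sequences [q]-Cauchy. *)
Lemma minimizing_sequence (R : realType) (X : lmodType R) (D : set X)
    (q : X -> X -> R) (l : X -> R) (C : R) :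
  0 <= C -> D 0 -> (forall a x y, D x -> D y -> D (a *: x + y)) ->
  (forall a x y z, q (a *: x + y) z = a * q x z + q y z) ->
  (forall x y, q x y = q y x) -> (forall x, 0 <= q x x) ->
  (forall a x y, D x -> D y -> l (a *: x + y) = a * l x + l y) ->
  (forall x, D x -> l x ^+ 2 <= C * q x x) ->
  exists v : nat -> X, [/\ forall n, D (v n),
    forall n m, q (v n - v m) (v n - v m) <= 2 / n.+1%:R + 2 / m.+1%:R &
    forall w n, D w -> (q (v n) w - l w) ^+ 2 <= (q w w + 1) / n.+1%:R].
Proof.
move=> C0 D0 Dlin qlin qC q0 llin lC.
have qlinr a x y z : q z (a *: x + y) = a * q z x + q z y.
  by rewrite qC qlin !(qC z).
have l0 : l 0 = 0.
  have := llin 1 0 0 D0 D0; rewrite scaler0 addr0 mul1r; lra.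
have q00 z : q 0 z = 0.
  have := qlin 1 0 0 z; rewrite scaler0 addr0 mul1r; lra.
have qZ a x z : q (a *: x) z = a * q x z by rewrite -[a *: x]addr0 qlin q00 addr0.
have DZ a x : D x -> D (a *: x) by move=> Dx; rewrite -[a *: x]addr0; exact: Dlin.
have lZ a x : D x -> l (a *: x) = a * l x.
  by move=> Dx; rewrite -[a *: x]addr0 llin// l0 addr0.
pose J x := q x x - 2 * l x.
(* Otherwise [(Q + C)^2 < 4 L^2 <= 4 C Q], against [(Q - C)^2 >= 0]. *)
have Jge x : D x -> - C <= J x.
  move=> Dx; rewrite /J.
  have := lC x Dx; have := q0 x; set Q := q x x; set L := l x => Q0 h.
  have [//|hlt] := leP (- C) (Q - 2 * L).
  have h2 : (Q + C) ^+ 2 < (2 * L) ^+ 2.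
    by rewrite ltr_pXn2r ?nnegrE ?addr_ge0//; lra.
  have := sqr_ge0 (Q - C); lra.
pose S := [set J x | x in D].
have hS : has_inf S.
  split; first by exists (J 0); exists 0.
  by exists (- C) => _ [x Dx <-]; exact: Jge.
have Sge x : D x -> inf S <= J x.
  by move=> Dx; apply: ge_inf; [case: hS | exists x].
have /choice[v vP] : forall n, exists x, D x /\ J x < inf S + n.+1%:R^-1.
  move=> n; have e0 : 0 < n.+1%:R^-1 :> R by rewrite invr_gt0.
  by have [_ [x Dx <-] h] := inf_adherent e0 hS; exists x.
exists v; split=> [n|n m|w n Dw]; first by case: (vP n).
- have [Dn Jn] := vP n; have [Dm Jm] := vP m.
  have Dh : D (2^-1 *: (v n) + 2^-1 *: v m) by apply: Dlin => //; exact: DZ.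
  have := Sge _ Dh; move: Jn Jm; rewrite /J llin ?lZ//; last exact: DZ.
  have -> : v n - v m = (-1) *: v m + v n by rewrite scaleN1r addrC.
  rewrite !(qlin, qlinr) !qZ ![q _ (_ *: _)]qC !qZ !(qC (v m) (v n)).
  set i := n.+1%:R^-1; set j := m.+1%:R^-1; lra.
have [Dn Jn] := vP n.
set e := q (v n) w - l w; set Q := q w w; have Q0 : 0 <= Q by exact: q0.
have h t : - n.+1%:R^-1 <= 2 * t * e + t ^+ 2 * Q.
  have := Sge _ (Dlin t _ _ Dw Dn); move: Jn.
  rewrite /J llin// qlin !qlinr /e /Q (qC w (v n)); set i := n.+1%:R^-1; lra.
(* The optimal [t] would be [- e / Q]; the [+ 1] avoids a zero denominator, and [s Q <= 1] keeps the
   factor [2 - s Q] at least 1. *)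
have := h (- e / (Q + 1)); set s := (Q + 1)^-1 => hs.
have s0 : 0 < s by rewrite invr_gt0; lra.
have sQ : s * Q <= 1 by rewrite mulrC ler_pdivrMr; lra.
have {}hs : e ^+ 2 * s * (2 - s * Q) <= n.+1%:R^-1.
  by move: hs; set i := n.+1%:R^-1; lra.
have : e ^+ 2 * s <= n.+1%:R^-1.
  apply: le_trans hs; rewrite -[leLHS]mulr1 ler_wpM2l//; last lra.
  by rewrite mulr_ge0 ?sqr_ge0// ltW.
by rewrite /s ler_pdivrMr; [rewrite mulrC | lra].
Qed.

Lemma cvg_sqr_bound (R : realType) (a : nat -> R) l c :
  (forall n, (a n - l) ^+ 2 <= c / n.+1%:R) -> a @ \oo --> l.
Proof.
move=> h; apply/cvgrPdist_lt => e e0.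
have e2 : 0 < e ^+ 2 by rewrite exprn_gt0.
have /cvgrPdist_lt/(_ _ e2) := cvg_inv_succ c; apply: filterS => n.
rewrite sub0r normrN => hn.
rewrite -(@ltr_pXn2r _ 2) ?nnegrE// ?ltW// real_normK ?num_real//.
rewrite -sqrrN opprB; apply: le_lt_trans (h n) (le_lt_trans (ler_norm _) hn).
Qed.

Lemma cauchy_rate_sqr (R : realType) (H : hilbertType R) (v : nat -> H) :
  (forall n m, `|v n - v m| ^+ 2 <= 2 / n.+1%:R + 2 / m.+1%:R) ->
  exists l : H, v @ \oo --> l.
Proof.
move=> vc; pose b n := Num.sqrt (2 / n.+1%:R) : R.
apply: (@cauchy_rate _ _ _ b).
  rewrite /b -sqrtr0; apply: continuous_cvg; first exact: sqrt_continuous.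
  exact: cvg_inv_succ.
move=> n m; have bn k : 0 <= 2 / k.+1%:R :> R by rewrite divr_ge0.
rewrite -(@ler_pXn2r _ 2) ?nnegrE ?addr_ge0 ?sqrtr_ge0//.
apply: le_trans (vc n m) _.
rewrite sqrrD /b !sqr_sqrtr// addrAC lerDl mulrn_wge0// mulr_ge0 ?sqrtr_ge0//.
Qed.

(** The approximate Euler equation of a minimizing sequence passes to the limit as [<h, x> = l x];
    testing it on [x = h] bounds the norm of [h]. *)
Lemma riesz (R : realType) (H : hilbertType R) (l : H -> R) (C : R) :
  0 <= C -> (forall a x y, l (a *: x + y) = a * l x + l y) ->
  (forall x, `|l x| <= C * `|x|) -> exists2 h : H, `|h| <= C & forall x, '[h, x] = l x.
Proof.
move=> C0 llin lC.
have [//|//|//|a x y z|x y|x|a x y _ _|x _|v [_ vc vl]] :=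
  @minimizing_sequence R H setT (fun x y => '[x, y]) l (C ^+ 2).
- exact: sqr_ge0.
- by rewrite dotDl dotZl.
- exact: dotC.
- exact: dotxx_ge0.
- exact: llin.
- by rewrite dotxx -exprMn -[l x ^+ 2]real_normK ?num_real// ler_pXn2r ?nnegrE ?mulr_ge0.
have [n m|h vh] := @cauchy_rate_sqr R H v; first by rewrite -dotxx.
have hE x : '[h, x] = l x.
  apply: (cvg_unique _ (@cvg_dotl R H _ _ _ v h x vh)) => //.
  by apply: cvg_sqr_bound => n; exact: vl.
exists h => //; have := lC h; rewrite -hE dotxx normrX normr_id expr2.
have [->|h0] := eqVneq h 0; first by rewrite normr0.
by rewrite ler_pM2r// normr_gt0.
Qed.

(** A closed subspace is its own double orthogonal. Minimization over the graph projects [(x, y)] to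
    a point [(x0, y0)] of it; the residual is orthogonal to the graph, so the hypothesis applies to
    the residual itself and forces its norm to vanish. This is how closedness of [B] is used on
    functions known only through inner products. *)
Lemma closed_graph_weak (R : realType) (H G : hilbertType R)
    (B : operator H G) (x : H) (y : G) : closed_op B ->
  (forall a b, (forall v, opdom B v -> '[v, a] + '[B v, b] = 0) ->
     '[x, a] + '[y, b] = 0) ->
  opdom B x /\ y = B x.
Proof.
move=> clB hxy.
pose q (p r : H * G) : R := '[p.1, r.1] + '[p.2, r.2].
have B0 : B 0 = 0.
  have := opfun_lin 1 (opdom0 B) (opdom0 B).
  by rewrite !scale1r addr0 => /eqP; rewrite -subr_eq0 opprD addrA subrr sub0r oppr_eq0 => /eqP.
have qlin a p r z : q (a *: p + r) z = a * q p z + q r z.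
  by rewrite /q /= !dotDl !dotZl mulrDr addrACA.
have qC p r : q p r = q r p by rewrite /q !(dotC r.1) !(dotC r.2).
have q0 p : 0 <= q p p by rewrite /q addr_ge0 ?dotxx_ge0.
have [||a p r [p1 p2] [r1 r2]|//|//|//|a p r _ _|p _|v [Dv vc vl]] :=
  @minimizing_sequence R (H * G)%type (graph B) q (q (x, y)) (q (x, y) (x, y)).
- exact: q0.
- by split; [exact: opdom0 | rewrite /= B0].
- by split; [exact: opdom_lin | rewrite /= p2 r2 opfun_lin].
- by rewrite qC qlin !(qC (x, y)).
- rewrite /q /= !dotxx; have := dot_le x p.1; have := dot_le y p.2.
  set c := '[x, _]; set d := '[y, _] => hd hc.
  have h : `|c + d| <= `|x| * `|p.1| + `|y| * `|p.2|.
    by apply: le_trans (ler_normD _ _) _; exact: lerD.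
  have : `|c + d| ^+ 2 <= (`|x| * `|p.1| + `|y| * `|p.2|) ^+ 2.
    by rewrite ler_pXn2r ?nnegrE ?addr_ge0 ?mulr_ge0.
  rewrite real_normK ?num_real//; have := sqr_ge0 (`|x| * `|p.2| - `|y| * `|p.1|).
  lra.
have [n m|x0 vx] := @cauchy_rate_sqr R H (fst \o v).
  apply: le_trans (vc n m); rewrite /q /= -dotxx lerDl; exact: dotxx_ge0.
have [n m|y0 vy] := @cauchy_rate_sqr R G (snd \o v).
  apply: le_trans (vc n m); rewrite /q /= -dotxx lerDr; exact: dotxx_ge0.
have gB : graph B (x0, y0).
  refine (@closed_cvg nat (H * G)%type \oo _ v (graph B) clB _ (x0, y0) _).
    by exists 0%N.
  have -> : v = (fun n => ((fst \o v) n, (snd \o v) n)).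
    by apply/funext => n /=; case: (v n).
  exact: cvg_pair.
have h0 w : graph B w -> q (x, y) w = q (x0, y0) w.
  move=> gw; apply: (@cvg_unique R (@Rhausdorff R) ((q (v n) w) @[n --> \oo])).
    by apply: cvg_sqr_bound => n; exact: vl.
  by apply: cvgD; exact: cvg_dotl.
have ab v' : opdom B v' -> '[v', x - x0] + '[B v', y - y0] = 0.
  move=> dv; have := h0 (v', B v') (conj dv erefl).
  by rewrite /q /= !dotBr !(dotC v') !(dotC (B v')); lra.
have e1 := hxy _ _ ab.
have e2 := ab x0 gB.1; have yB : y0 = B x0 by case: gB.
rewrite -yB in e2.
have : '[x - x0, x - x0] + '[y - y0, y - y0] = 0.
  by move: e1 e2; rewrite ![in X in X -> _]dotBr !dotBl !dotBr; lra.
rewrite !dotxx => /eqP; rewrite paddr_eq0 ?sqr_ge0// !sqrf_eq0 !normr_eq0 !subr_eq0.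
by move=> /andP[/eqP -> /eqP ->]; case: gB.
Qed.

(** * Compact symmetric operators *)

Section CompactSymmetric.
Context {R : realType} {H : hilbertType R}.
Variable Q : H -> H.
Hypothesis Qlin : forall (a : R) x y, Q (a *: x + y) = a *: Q x + Q y.
Hypothesis Qsym : forall x y, '[Q x, y] = '[x, Q y].
Hypothesis Qc : compact_op Q.

Lemma symm_opD x y : Q (x + y) = Q x + Q y.
Proof. by have := Qlin 1 x y; rewrite !scale1r. Qed.

Lemma symm_op0 : Q 0 = 0.
Proof.
by have := symm_opD 0 0; rewrite addr0 -[LHS]addr0 => /addrI.
Qed.

Lemma symm_opZ a x : Q (a *: x) = a *: Q x.
Proof. by have := Qlin a x 0; rewrite !addr0 symm_op0 addr0. Qed.

Lemma symm_opB x y : Q (x - y) = Q x - Q y.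
Proof. by rewrite symm_opD -scaleN1r symm_opZ scaleN1r. Qed.

Lemma compact_op_bounded : exists2 K : R, 0 < K & forall x, `|Q x| <= K * `|x|.
Proof.
have := Qc; rewrite /compact_op precompactE => /compact_bounded [M [_ hM]].
have := hM (`|M| + 1) (le_lt_trans (ler_norm M) _).
rewrite ltrDl => /(_ ltr01) h.
exists (`|M| + 1); first by rewrite ltr_wpDl.
move=> x; have [->|x0] := eqVneq x 0.
  by rewrite symm_op0 !normr0 mulr0.
have nx : 0 < `|x| by rewrite normr_gt0.
have : `|Q (`|x|^-1 *: x)| <= `|M| + 1.
  apply: h; apply: subset_closure; exists (`|x|^-1 *: x) => //=.
  by rewrite normrZ normfV normr_id mulVf// gt_eqF.
by rewrite symm_opZ normrZ normfV normr_id mulrC ler_pdivrMr.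
Qed.

Lemma compact_op_cluster (x : nat -> H) : (forall n, `|x n| <= 1) ->
  exists p, forall e, 0 < e -> forall N, exists2 n, (N <= n)%N & `|Q (x n) - p| < e.
Proof.
move=> x1; have := Qc; rewrite /compact_op precompactE => cQ.
have [|p [_ hp]] := cQ ((Q \o x) @ \oo) _.
  exists 0%N => // n _ /=; apply: subset_closure; exists (x n) => //; exact: x1.
exists p => e e0 N.
have [||y /= [[n nN <-]]] := hp [set Q (x n) | n in [set n | (N <= n)%N]] (ball p e).
- by exists N => // n /= Nn; exists n.
- exact: nbhsx_ballx.
by rewrite -ball_normE /= distrC; exists n.
Qed.

(* A maximizer x of |Q x| over the unit ball of X satisfies Q (Q x) = q^2 x, so
   Q x + q x is an eigenvector unless it vanishes, and then x is one. *)
Lemma eigenvector_in (X : set H) : X 0 ->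
  (forall a x y, X x -> X y -> X (a *: x + y)) ->
  (forall x, X x -> X (Q x)) ->
  (forall x, (forall e, 0 < e -> exists2 y, X y & `|x - y| < e) -> X x) ->
  (exists2 x, X x & x != 0) ->
  exists e l, [/\ X e, `|e| = 1, Q e = l *: e &
                  forall x, X x -> `|Q x| <= `|l| * `|x|].
Proof.
move=> X0 Xlin XQ Xcl [u Xu u0].
have XZ a x : X x -> X (a *: x) by move=> Xx; rewrite -[_ *: _]addr0; exact: Xlin.
have [K K0 QK] := compact_op_bounded.
pose S := [set `|Q x| | x in [set x | X x /\ `|x| <= 1]].
have hS : has_sup S.
  split; first by exists `|Q 0|, 0 => //; split=> //; rewrite normr0.
  exists K => _ [x [Xx x1] <-]; apply: le_trans (QK x) _.
  by rewrite -[leRHS]mulr1 ler_wpM2l// ltW.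
pose q := sup S.
have Qq1 x : X x -> `|x| <= 1 -> `|Q x| <= q.
  by move=> Xx x1; apply: sup_upper_bound => //; exists x.
have Qq x : X x -> `|Q x| <= q * `|x|.
  move=> Xx; have [->|x0] := eqVneq x 0.
    by rewrite symm_op0 !normr0 mulr0.
  have nx : 0 < `|x| by rewrite normr_gt0.
  have := Qq1 (`|x|^-1 *: x) (XZ _ _ Xx).
  rewrite symm_opZ !normrZ normfV normr_id mulVf ?gt_eqF// => /(_ (lexx _)).
  by rewrite mulrC ler_pdivrMr.
have q0 : 0 <= q by have := Qq1 0 X0; rewrite symm_op0 normr0; apply; rewrite ler01.
(* If [q = 0], then [Q] vanishes on [X] and any unit vector of [X] has eigenvalue 0. *)
have [q00|qn0] := eqVneq q 0.
  have nu : 0 < `|u| by rewrite normr_gt0.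
  have Q0 x : X x -> Q x = 0.
    move=> /Qq; rewrite q00 mul0r => h; apply/eqP.
    by rewrite -normr_eq0 eq_le h normr_ge0.
  exists (`|u|^-1 *: u), 0; split; first exact: XZ.
  - by rewrite normrZ normfV normr_id mulVf// gt_eqF.
  - by rewrite scale0r Q0//; exact: XZ.
  - by move=> x /Q0 ->; rewrite !normr0 mul0r.
have qp : 0 < q by rewrite lt_neqAle eq_sym qn0.
have /choice[x xP] : forall n, exists x, [/\ X x, `|x| <= 1 & q - n.+1%:R^-1 < `|Q x|].
  move=> n; have e0 : 0 < n.+1%:R^-1 :> R by rewrite invr_gt0.
  by have [_ [x [Xx x1] <-] h] := sup_adherent e0 hS; exists x.
have x1 n : `|x n| <= 1 by case: (xP n).
have [p pP] := compact_op_cluster x1.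
(* Expanding the square and using [|Q (Q x)| <= q |Q x|] and [|x| <= 1] leaves
   [q^2 (q^2 - |Q x|^2)], which is small for a maximizing sequence. *)
have dist n : `|q ^+ 2 *: x n - Q (Q (x n))| ^+ 2 <= (2 * q ^+ 3) / n.+1%:R.
  have [Xx xn1 xq] := xP n; have XQx := XQ _ Xx.
  rewrite sqr_normB normrZ dotZl dotC Qsym dotxx ger0_norm ?sqr_ge0//.
  have h1 : `|Q (Q (x n))| ^+ 2 <= (q * `|Q (x n)|) ^+ 2.
    by rewrite ler_pXn2r ?nnegrE ?mulr_ge0//; exact: Qq.
  have h2 : (q ^+ 2 * `|x n|) ^+ 2 <= (q ^+ 2) ^+ 2.
    by rewrite ler_pXn2r ?nnegrE ?mulr_ge0 ?sqr_ge0// -[leRHS]mulr1 ler_wpM2l ?sqr_ge0.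
  have h3 := Qq1 _ Xx xn1; set i := n.+1%:R^-1; rewrite -/i in xq.
  have i0 : 0 < i by rewrite invr_gt0.
  set a := `|Q (x n)| in h1 h2 h3 xq *.
  have a0 : 0 <= a by exact: normr_ge0.
  have h4 : q ^+ 2 - a ^+ 2 <= 2 * q * i.
    have : (q - a) * (q + a) <= i * (2 * q) by apply: ler_pM; lra.
    lra.
  have h5 : q ^+ 2 * (q ^+ 2 - a ^+ 2) <= q ^+ 2 * (2 * q * i).
    by rewrite ler_wpM2l ?sqr_ge0.
  move: h1 h2 h5; rewrite !exprMn => h1 h2 h5; lra.
have dist0 : q ^+ 2 *: x n - Q (Q (x n)) @[n --> \oo] --> (0 : H).
  apply/cvgr0Pnorm_lt => e e0; have e2 : 0 < e ^+ 2 by rewrite exprn_gt0.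
  have /cvgrPdist_lt/(_ _ e2) := cvg_inv_succ (2 * q ^+ 3); apply: filterS => n.
  rewrite sub0r normrN => hn.
  rewrite -(@ltr_pXn2r _ 2) ?nnegrE// ?ltW//.
  exact: le_lt_trans (dist n) (le_lt_trans (ler_norm _) hn).
have q2 : 0 < q ^+ 2 by rewrite exprn_gt0.
(* Where [Q (x n)] is near [p], the estimate [dist0] puts [x n] near [q^-2 Q p], so strong
   convergence of [x n] itself comes from compactness. *)
pose y := (q ^+ 2)^-1 *: Q p.
have approx e : 0 < e ->
    exists n, [/\ `|Q (x n) - p| < e, `|y - x n| < e & n.+1%:R^-1 < e].
  move=> e0.
  pose d := Num.min e (e * q ^+ 2 / (K + 1)).
  have d0 : 0 < d by rewrite lt_min e0 divr_gt0 ?mulr_gt0//; lra.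
  have /cvgr0Pnorm_lt/(_ _ d0)[N1 _ h1] := dist0.
  have /cvgr0Pnorm_lt/(_ _ e0)[N2 _ h2] := @cvg_inv_succ R 1.
  have [n /= nN pn] := pP d d0 (maxn N1 N2); exists n.
  move: nN; rewrite geq_max => /andP[nN1 nN2]; split.
  - by apply: lt_le_trans pn _; rewrite ge_min lexx.
  - rewrite -(ltr_pM2l q2) -[q ^+ 2 in X in X < _]ger0_norm ?sqr_ge0// -normrZ.
    rewrite scalerBr scalerA divff ?gt_eqF// scale1r.
    have -> : Q p - q ^+ 2 *: x n = - (Q (Q (x n) - p)) - (q ^+ 2 *: x n - Q (Q (x n))).
      by rewrite symm_opB opprB opprB addrA subrK.
    apply: le_lt_trans (ler_normB _ _) _; rewrite normrN.
    have a1 := QK (Q (x n) - p).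
    have a2 : `|q ^+ 2 *: x n - Q (Q (x n))| < d by exact: h1.
    have a3 : d <= e * q ^+ 2 / (K + 1) by rewrite ge_min lexx orbT.
    have a4 : K * `|Q (x n) - p| <= K * d by rewrite ler_wpM2l// ltW.
    move: a3; rewrite ler_pdivlMr; lra.
  - have := h2 n nN2; rewrite mul1r ger0_norm ?invr_ge0//.
have Xy : X y.
  by apply: Xcl => e e0; have [n [_ h _]] := approx e e0; exists (x n) => //; case: (xP n).
have y1 : `|y| <= 1.
  apply/ler_addgt0Pr => e e0; have [n [_ h _]] := approx e e0.
  rewrite -(subrK (x n) y); apply: le_trans (ler_normD _ _) _.
  by have := x1 n; lra.
have Qyp : Q y = p.
  apply/eqP; rewrite -subr_eq0 -normr_eq0 eq_le normr_ge0 andbT.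
  apply/ler_addgt0Pr => e e0; rewrite add0r.
  have d0 : 0 < e / (K + 1) by rewrite divr_gt0//; lra.
  have [n [h1 h2 _]] := approx _ d0.
  have -> : Q y - p = Q (y - x n) + (Q (x n) - p) by rewrite symm_opB addrA subrK.
  apply: le_trans (ler_normD _ _) _; have h3 := QK (y - x n).
  have h4 : K * `|y - x n| <= K * (e / (K + 1)) by rewrite ler_wpM2l// ltW.
  have : e / (K + 1) * (K + 1) = e by rewrite divfK// gt_eqF; lra.
  lra.
have nQy : q <= `|Q y|.
  apply/ler_addgt0Pr => e e0; have e2 : 0 < e / 2 by lra.
  have [n [h1 _ h3]] := approx _ e2; have [_ _ xq] := xP n.
  have : `|Q (x n)| <= `|Q (x n) - p| + `|p|.
    by rewrite -{1}(subrK p (Q (x n))); exact: ler_normD.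
  rewrite Qyp; set i := n.+1%:R^-1 in h3 xq; lra.
have y0 : y != 0.
  by apply: contraTneq nQy => ->; rewrite symm_op0 normr0 -ltNge.
have QQy : Q (Q y) = q ^+ 2 *: y.
  by rewrite Qyp /y scalerA divff ?gt_eqF// scale1r.
have fin z l : X z -> z != 0 -> Q z = l *: z -> `|l| = q -> exists e l,
    [/\ X e, `|e| = 1, Q e = l *: e & forall x, X x -> `|Q x| <= `|l| * `|x|].
  move=> Xz z0 Qz lq; have nz : 0 < `|z| by rewrite normr_gt0.
  exists (`|z|^-1 *: z), l; split; first exact: XZ.
  - by rewrite normrZ normfV normr_id mulVf// gt_eqF.
  - by rewrite symm_opZ Qz !scalerA mulrC.
  - by rewrite lq.
have [z0|z0] := eqVneq (q *: y + Q y) 0.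
  apply: (fin y (- q)) => //; last by rewrite normrN ger0_norm.
  by apply/eqP; rewrite scaleNr -addr_eq0 addrC z0.
apply: (fin _ q _ z0); last by rewrite ger0_norm.
  by apply: Xlin => //; exact: XQ.
have e : q ^+ 2 *: y = q *: (q *: y) by rewrite scalerA.
by rewrite Qlin QQy e scalerDr addrC.
Qed.

Definition orth_to (l : seq H) : set H := [set x | forall e, e \in l -> '[x, e] = 0].

Definition eigenvec (e : H) := exists l : R, Q e = l *: e.

(** The orthogonal of a set of eigenvectors is closed, and invariant since [Q] is symmetric, so
    [eigenvector_in] applies inside it. When it is reduced to zero, the pair [(0, 0)] is returned,
    so that the iteration never has to stop. *)
Lemma eigenvector_orth (l : seq H) : (forall e, e \in l -> eigenvec e) ->
  exists p : H * R, [/\ orth_to l p.1, Q p.1 = p.2 *: p.1,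
    forall x, orth_to l x -> `|Q x| <= `|p.2| * `|x| &
    `|p.1| = 1 \/ p.1 = 0 /\ forall x, orth_to l x -> x = 0].
Proof.
move=> el.
have X0 : orth_to l 0 by move=> e _; rewrite dot0l.
have [[x Xx x0]|nex] := pselect (exists2 x, orth_to l x & x != 0); last first.
  have all0 x : orth_to l x -> x = 0.
    by move=> Xx; apply: contra_notP nex => /eqP; exists x.
  exists (0, 0); split=> //=; first by rewrite symm_op0 scaler0.
  - by move=> x /all0 ->; rewrite symm_op0 !normr0 mul0r.
  - by right.
have [|||||e [lam [Xe e1 Qe hmax]]] := @eigenvector_in (orth_to l).
- by [].
- by move=> a y z Xy Xz e ein; rewrite dotDl dotZl Xy// Xz// mulr0 addr0.
- move=> y Xy e ein; have [lam Qe] := el e ein.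
  by rewrite Qsym Qe dotZr Xy// mulr0.
- move=> y hy e ein; apply/eqP; rewrite -normr_eq0 eq_le normr_ge0 andbT.
  apply/ler_addgt0Pr => d d0; rewrite add0r.
  have e0 : 0 < d / (`|e| + 1) by rewrite divr_gt0// ltr_wpDl.
  have [z Xz yz] := hy _ e0.
  have -> : '[y, e] = '[y - z, e] by rewrite dotBl Xz// subr0.
  apply: le_trans (dot_le _ _) _; move: yz; rewrite ltr_pdivlMr ?ltr_wpDl//.
  by have := normr_ge0 (y - z); lra.
- by exists x.
by exists (e, lam); split=> //; left.
Qed.

(** Each [e n] realizes the norm of [Q] on the orthogonal of the preceding ones. If all eigenvalues
    stayed above some [eps], the vectors [Q (e n)] would be uniformly separated, against
    compactness; hence some [|l n| <= eps], which bounds [Q x] for every [x] orthogonal to the whole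
    sequence. *)
Lemma spectral_sequence : exists (e : nat -> H) (l : nat -> R),
  [/\ forall n, Q (e n) = l n *: e n,
      forall i j, i != j -> '[e i, e j] = 0,
      forall n, `|e n| = 1 \/ e n = 0 &
      forall x, (forall n, '[x, e n] = 0) -> Q x = 0].
Proof.
have /choice[f fP] : forall l : seq H, exists p : H * R,
    (forall e, e \in l -> eigenvec e) ->
    [/\ orth_to l p.1, Q p.1 = p.2 *: p.1,
    forall x, orth_to l x -> `|Q x| <= `|p.2| * `|x| &
    `|p.1| = 1 \/ p.1 = 0 /\ forall x, orth_to l x -> x = 0].
  move=> l; have [/eigenvector_orth[p hp]|n] := pselect (forall e, e \in l -> eigenvec e).
    by exists p.
  by exists (0, 0).
pose L n := iter n (fun l => (f l).1 :: l) [::].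
pose e n := (f (L n)).1; pose lam n := (f (L n)).2.
have Leig n : forall u, u \in L n -> eigenvec u.
  elim: n => [//|n IH] u; rewrite /L iterS -/(L n) inE => /orP[/eqP ->|]; last exact: IH.
  by have [_ h _ _] := fP _ IH; exists (f (L n)).2.
have eP n := fP _ (Leig n).
have eL i n : (i < n)%N -> e i \in L n.
  elim: n => [//|n IH]; rewrite ltnS leq_eqVlt /L iterS -/(L n) inE => /orP[/eqP ->|].
    by rewrite eqxx.
  by move=> /IH ->; rewrite orbT.
have Lsub n u : u \in L n -> exists i, u = e i.
  elim: n => [//|n IH]; rewrite /L iterS -/(L n) inE => /orP[/eqP ->|]; last exact: IH.
  by exists n.
have orth i j : (i < j)%N -> '[e j, e i] = 0.
  by move=> ij; have [h _ _ _] := eP j; apply: h; exact: eL.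
exists e, lam; split.
- by move=> n; have [_ h _ _] := eP n.
- move=> i j; rewrite neq_ltn => /orP[|] ij; last exact: orth.
  by rewrite dotC orth.
- by move=> n; have [_ _ _ [h|[h _]]] := eP n; [left|right].
move=> x xe.
have xL n : orth_to (L n) x by move=> u /Lsub [i ->].
have [[n en0]|ne] := pselect (exists n, e n = 0).
  have [_ _ _ [h|[_ h]]] := eP n.
    by move: h; rewrite -/(e n) en0 normr0 => /eqP; rewrite eq_sym oner_eq0.
  by rewrite (h x (xL n)) symm_op0.
have e1 n : `|e n| = 1.
  by have [_ _ _ [h|[h _]]] := eP n => //; exfalso; apply: ne; exists n.
apply/eqP; rewrite -normr_eq0 eq_le normr_ge0 andbT.
apply/ler_addgt0Pr => d d0; rewrite add0r.
have eps0 : 0 < d / (`|x| + 1) by rewrite divr_gt0// ltr_wpDl.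
set eps := d / (`|x| + 1) in eps0 *.
have [[n hn]|hn] := pselect (exists n, `|lam n| <= eps).
  have [_ _ h _] := eP n; apply: le_trans (h x (xL n)) _.
  apply: (@le_trans _ _ (eps * `|x|)); first by rewrite ler_wpM2r.
  have : eps * (`|x| + 1) = d by rewrite /eps divfK// gt_eqF// ltr_wpDl.
  lra.
have {}hn n : eps < `|lam n| by rewrite ltNge; apply/negP => h; apply: hn; exists n.
have e1le n : `|e n| <= 1 by rewrite e1.
have [p pP] := compact_op_cluster e1le.
have eps2 : 0 < eps / 2 by lra.
(* Two distinct indices with images within [eps / 2] of the cluster point, whereas orthogonality
   gives [|Q e_j - Q e_i|^2 = l_j^2 + l_i^2 > eps^2]. *)
have [i _ hi] := pP _ eps2 0%N; have [j ij hj] := pP _ eps2 i.+1.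
have : `|Q (e j) - Q (e i)| < eps.
  have -> : Q (e j) - Q (e i) = (Q (e j) - p) - (Q (e i) - p) by rewrite opprB addrA subrK.
  by apply: le_lt_trans (ler_normB _ _) _; lra.
have Qe n : Q (e n) = lam n *: e n by have [_ h _ _] := eP n.
rewrite !Qe -(@ltr_pXn2r _ 2) ?nnegrE//; last exact: ltW.
rewrite sqr_normB dotZl dotZr orth// !normrZ !e1 !mulr0 subr0 !mulr1.
have : eps ^+ 2 < `|lam j| ^+ 2 by rewrite ltr_pXn2r ?nnegrE//; exact: ltW.
by have := sqr_ge0 `|lam i|; lra.
Qed.
End CompactSymmetric.

(** * Calculus on a segment and Volterra kernels *)

Section Calculus.
Context {R : realType}.
Implicit Types (f g y z : R -> R) (T t : R).
Local Notation mu := (@lebesgue_measure R).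

Lemma continuous_itv_integrable f a b : continuous f ->
  mu.-integrable `[a, b] (EFin \o f).
Proof.
move=> cf; apply: continuous_compact_integrable; first exact: segment_compact.
exact: continuous_subspaceT.
Qed.

Lemma integrable_scale (D : set R) c g : measurable D ->
  mu.-integrable D (EFin \o g) -> mu.-integrable D (EFin \o (fun s => c * g s)).
Proof.
move=> mD gi; rewrite (_ : EFin \o _ = (fun s => c%:E * (EFin \o g) s)%E)//.
exact: integrableZl.
Qed.

Lemma integrable_add (D : set R) f g : measurable D ->
  mu.-integrable D (EFin \o f) -> mu.-integrable D (EFin \o g) ->
  mu.-integrable D (EFin \o (fun s => f s + g s)).
Proof.
move=> mD fi gi; rewrite (_ : EFin \o _ = ((EFin \o f) \+ (EFin \o g))%E)//.
exact: integrableD.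
Qed.

Lemma integrable_sub (D : set R) f g : measurable D ->
  mu.-integrable D (EFin \o f) -> mu.-integrable D (EFin \o g) ->
  mu.-integrable D (EFin \o (fun s => f s - g s)).
Proof.
move=> mD fi gi.
rewrite (_ : EFin \o _ = ((EFin \o f) \- (EFin \o g))%E)//.
exact: integrableB.
Qed.

Lemma integrable_measurable (D : set R) g :
  mu.-integrable D (EFin \o g) -> measurable_fun D g.
Proof. by move=> gi; apply/measurable_EFinP; exact: measurable_int gi. Qed.

Lemma continuous_measurable (D : set R) f : continuous f -> measurable_fun D f.
Proof. by move=> cf; apply: measurable_funTS; exact: continuous_measurable_fun. Qed.

Lemma sub_itv0 t T : t <= T -> `[0, t]%classic `<=` (`[0, T]%classic : set R).
Proof. by move=> tT s /=; rewrite !in_itv /= => /andP[-> st]; exact: le_trans st tT. Qed.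

Lemma integrable_mul_bounded (D : set R) (C : R) (h g : R -> R) : measurable D ->
  measurable_fun D h -> (forall s, D s -> `|h s| <= C) ->
  mu.-integrable D (EFin \o g) -> mu.-integrable D (EFin \o (fun s => h s * g s)).
Proof.
move=> mD mh hC gi.
apply: (@le_integrable _ _ _ mu _ _ _ (EFin \o (fun s => `|C| * g s))) => //;
  last exact: integrable_scale.
  by apply/measurable_EFinP; apply: measurable_funM => //; exact: integrable_measurable.
move=> s Ds /=; rewrite lee_fin !normrM normr_id ler_wpM2r//.
exact: le_trans (hC s Ds) (ler_norm _).
Qed.

Lemma has_derivP T f t l : has_deriv T f t l <->
  forall e, 0 < e -> exists2 d, 0 < d & forall s, 0 <= s <= T -> s != t ->
    `|t - s| < d -> `|l - (f s - f t) / (s - t)| < e.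
Proof.
split=> [/cvgrPdist_lt h e e0|h].
  have [d /= d0 hd] := h e e0; exists d => // s sT st ts.
  by apply: hd => //=; rewrite ?in_itv.
apply/cvgrPdist_lt => e e0; have [d d0 hd] := h e e0.
exists d => //= s ts st sT; exact: hd.
Qed.

Lemma is_deriveP f t l : is_derive t 1 f l <->
  forall e, 0 < e -> exists2 d, 0 < d & forall s, s != t ->
    `|t - s| < d -> `|l - (f s - f t) / (s - t)| < e.
Proof.
split=> [[df dl] e e0|h].
  have : h^-1 *: ((f \o shift t) (h *: 1) - f t) @[h --> (0 : R)^'] --> l.
    by rewrite -dl; exact: df.
  move=> /cvgrPdist_lt/(_ _ e0)[d /= d0 hd]; exists d => // s st ts.
  have := hd (s - t); rewrite /= sub0r normrN distrC => /(_ ts).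
  rewrite subr_eq0 => /(_ st); rewrite /GRing.scale /= mulr1 subrK.
  by rewrite [X in `|_ - X|]mulrC.
have c : h^-1 *: ((f \o shift t) (h *: 1) - f t) @[h --> (0 : R)^'] --> l.
  apply/cvgrPdist_lt => e e0; have [d d0 hd] := h e e0.
  exists d => // s /=; rewrite sub0r normrN => sd s0.
  have := hd (s + t); rewrite -subr_eq0 addrK opprD addrCA subrr addr0 normrN.
  by move=> /(_ s0 sd); rewrite /GRing.scale /= mulr1 mulrC.
apply: DeriveDef; first by apply/cvg_ex; exists l.
exact/cvg_lim.
Qed.

Lemma is_derive_has_deriv T f t l : is_derive t 1 f l -> has_deriv T f t l.
Proof.
move=> /is_deriveP h; apply/has_derivP => e /h[d d0 hd]; exists d => // s _.
exact: hd.
Qed.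

Lemma has_deriv_is_derive T f t l : 0 < t < T -> has_deriv T f t l ->
  is_derive t 1 f l.
Proof.
move=> /andP[t0 tT] /has_derivP h; apply/is_deriveP => e /h[d d0 hd].
exists (Num.min d (Num.min t (T - t))).
  by rewrite !lt_min d0 t0 subr_gt0.
move=> s st; rewrite !lt_min => /andP[sd /andP[s1 s2]]; apply: hd => //.
move: s1 s2; rewrite !ltr_norml; lra.
Qed.

Lemma eq_has_deriv T f g t l : 0 <= t <= T ->
  (forall s, 0 <= s <= T -> f s = g s) -> has_deriv T f t l -> has_deriv T g t l.
Proof.
move=> tT fg /has_derivP h; apply/has_derivP => e /h[d d0 hd]; exists d => // s sT st sd.
by rewrite -!fg//; exact: hd.
Qed.

Lemma has_deriv_cvg T f t l : has_deriv T f t l ->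
  f @ within `[0, T] (nbhs t) --> f t.
Proof.
move=> /has_derivP h; have [d d0 hd] := h 1 ltr01.
apply/cvgrPdist_lt => e e0.
have k0 : 0 < e / (`|l| + 1) by rewrite divr_gt0// ltr_wpDl.
exists (Num.min d (e / (`|l| + 1))) => /=; first by rewrite lt_min d0.
move=> s; rewrite /= lt_min => /andP[sd se]; rewrite in_itv /= => sT.
have [->|st] := eqVneq s t; first by rewrite subrr normr0.
have := hd s sT st sd; set r := (f s - f t) / (s - t) => hr.
have -> : f t - f s = r * (t - s).
  by rewrite /r -(opprB s t) mulrN divfK ?subr_eq0// opprB.
rewrite normrM; have : `|r| <= `|l| + 1.
  have -> : r = l - (l - r) by rewrite opprB addrC subrK.
  by apply: le_trans (ler_normB _ _) _; rewrite lerD2l ltW.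
move: se; rewrite ltr_pdivlMr ?ltr_wpDl// => se hrl.
apply: le_lt_trans se; rewrite mulrC ler_wpM2l//.
Qed.

Lemma has_deriv_continuous T f z : (forall t, 0 <= t <= T -> has_deriv T f t (z t)) ->
  {within `[0, T], continuous f}.
Proof.
move=> h; apply/subspace_continuousP => t /=; rewrite in_itv /= => tT.
exact: has_deriv_cvg (h t tT).
Qed.

Lemma has_deriv_eq_cst T f : (forall t, 0 <= t <= T -> has_deriv T f t 0) ->
  forall t, 0 <= t <= T -> f t = f 0.
Proof.
move=> h t /andP[t0 tT]; have cf := has_deriv_continuous h.
have [||c _] := @MVT_segment R f (fun=> 0) 0 t t0.
- move=> x; rewrite in_itv /= => /andP[x0 xt]; apply: (@has_deriv_is_derive T).
    by rewrite x0 (lt_le_trans xt).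
  by apply: h; rewrite (ltW x0)/=; exact: le_trans (ltW xt) tT.
- apply: continuous_subspaceW cf => s /=; rewrite !in_itv /= => /andP[-> st].
  exact: le_trans st tT.
by rewrite mul0r => /eqP; rewrite subr_eq0 => /eqP.
Qed.

Lemma has_derivD T f g t k l : has_deriv T f t k -> has_deriv T g t l ->
  has_deriv T (fun s => f s + g s) t (k + l).
Proof.
move=> hf hg; apply: cvg_trans (cvgD hf hg).
by apply: near_eq_cvg; near=> s => /=; rewrite /= -mulrDl opprD addrACA.
Unshelve. all: by end_near. Qed.

Lemma has_derivZ T f t k l : has_deriv T f t l -> has_deriv T (fun s => k * f s) t (k * l).
Proof.
move=> hf; apply: cvg_trans (cvgM (cvg_cst k) hf).
by apply: near_eq_cvg; near=> s => /=; rewrite -mulrBr mulrA.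
Unshelve. all: by end_near. Qed.

Lemma has_derivB T f g t k l : has_deriv T f t k -> has_deriv T g t l ->
  has_deriv T (fun s => f s - g s) t (k - l).
Proof.
move=> hf /(has_derivZ (k := -1)) hg; rewrite -[- l]mulN1r.
have -> : (fun s => f s - g s) = (fun s => f s + -1 * g s).
  by apply/funext => s; rewrite mulN1r.
exact: has_derivD.
Qed.

Lemma Rintegral_split f a x b : mu.-integrable `[a, b] (EFin \o f) -> a <= x -> x <= b ->
  \int[mu]_(s in `[a, b]) f s =
  \int[mu]_(s in `[a, x]) f s + \int[mu]_(s in `[x, b]) f s.
Proof.
move=> fi ax xb.
have h := Rintegral_itvB fi; have := h x; rewrite !bnd_simp => /(_ ax xb).
rewrite Rintegral_itv_obnd_cbnd; first by move=> <-; rewrite addrC subrK.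
apply: integrableS fi => //; apply: subset_itvr; rewrite bnd_simp//.
Qed.

Lemma Rintegral_le_itv0 f t T : mu.-integrable `[0, T] (EFin \o f) -> 0 <= t <= T ->
  (forall s, 0 <= s <= T -> 0 <= f s) ->
  \int[mu]_(s in `[0, t]) f s <= \int[mu]_(s in `[0, T]) f s.
Proof.
move=> fi /andP[t0 tT] f0; rewrite (Rintegral_split fi t0 tT) lerDl.
apply: Rintegral_ge0 => s; rewrite /= in_itv /= => /andP[ts sT].
by apply: f0; rewrite sT (le_trans t0 ts).
Qed.

Lemma derive1_is_derive f t l : derivable f t 1 -> derive1 f t = l -> is_derive t 1 f l.
Proof. by move=> df <-; apply: DeriveDef => //; rewrite derive1E. Qed.

Lemma primitive_has_deriv T f k t : continuous f -> 0 <= t <= T ->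
  has_deriv T (fun x => k + \int[mu]_(s in `[0, x]) f s) t (f t).
Proof.
move=> cf tT.
have t1 : -1 < t by case/andP: tT; lra.
(* Starting the primitive at [-1] makes every [t] of [[0, T]], including 0, an interior point. *)
have := @continuous_FTC1_closed R f (-1) t (t + 1).
rewrite ltrDl ltr01 => /(_ isT (continuous_itv_integrable _ _ cf) t1 (cf t)).
move=> /= [dF F']; have := derive1_is_derive dF F'.
set F := (fun x : R => \int[mu]_(u in `[-1, x]) f u).
move=> /(@is_derive_has_deriv T) /has_derivP h; apply/has_derivP => e /h [d d0 hd].
exists d => // s sT st sd; have := hd s sT st sd.
have E x : 0 <= x -> F x = F 0 + \int[mu]_(s in `[0, x]) f s.
  by move=> x0; apply: Rintegral_split; [exact: continuous_itv_integrable|lra|exact: x0].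
case/andP: tT => t0 _; case/andP: sT => s0 _.
by rewrite (E s)// (E t)// !opprD !addrA; congr (`|_ - _ / _| < _); lra.
Qed.

Lemma ftc_segment T f z : continuous z ->
  (forall t, 0 <= t <= T -> has_deriv T f t (z t)) ->
  forall t, 0 <= t <= T -> f t = f 0 + \int[mu]_(s in `[0, t]) z s.
Proof.
move=> cz fz t tT.
have h s : 0 <= s <= T -> has_deriv T (fun x => f x - (f 0 + \int[mu]_(s in `[0, x]) z s)) s 0.
  move=> sT; rewrite -[X in has_deriv _ _ _ X](subrr (z s)); apply: has_derivB; first exact: fz.
  exact: primitive_has_deriv.
have := has_deriv_eq_cst h tT.
rewrite set_itv1 Rintegral_set1 addr0 subrr; lra.
Qed.

(** Composition with this projection extends a function continuous on [[0, T]] to one continuous on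
    the whole line, where the two-sided calculus applies. *)
Definition clamp T t := Num.max 0 (Num.min t T).

Lemma clamp_id T t : 0 <= t <= T -> clamp T t = t.
Proof. by move=> /andP[t0 tT]; rewrite /clamp min_l// max_r. Qed.

Lemma clamp_itv T t : 0 <= T -> 0 <= clamp T t <= T.
Proof. by move=> T0; rewrite /clamp le_max lexx/= ge_max T0 ge_min lexx orbT. Qed.

Lemma clamp_ge0 T t : 0 <= clamp T t.
Proof. by rewrite /clamp le_max lexx. Qed.

Lemma clamp_le_id T t s : 0 <= s <= clamp T t -> clamp T s = s.
Proof.
rewrite /clamp => /andP[s0]; rewrite le_max => /orP[s1|].
  have -> : s = 0 by apply/eqP; rewrite eq_le s0 s1.
  by case: (leP 0 T) => ?; rewrite ?maxxx ?max_l// ltW.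
by rewrite le_min => /andP[_ sT]; rewrite min_l// max_r.
Qed.

Lemma clampK T t : clamp T (clamp T t) = clamp T t.
Proof. by apply: (@clamp_le_id T t); rewrite clamp_ge0 lexx. Qed.

Lemma continuous_clamp T : continuous (clamp T).
Proof.
move=> t; apply/cvgrPdist_lt => e e0; exists e => //= s /=.
apply: le_lt_trans; rewrite /clamp.
have h1 := ler_norm (t - s).
have h2 : s - t <= `|t - s| by rewrite distrC ler_norm.
case: (leP t T) => ?; case: (leP s T) => ?; rewrite /Num.max.
all: do 2?[case: ifPn; rewrite -?leNgt => ?].
all: by rewrite ler_norml; apply/andP; split; lra.
Qed.

Lemma continuous_comp_clamp T f : 0 <= T -> {within `[0, T], continuous f} ->
  continuous (f \o clamp T).
Proof.
move=> T0 /subspace_continuousP h t.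
have cT := clamp_itv t T0.
have hc : f @ within `[0, T] (nbhs (clamp T t)) --> f (clamp T t).
  by apply: h; rewrite /= in_itv.
apply: (cvg_comp (clamp T) f _ hc) => P hP.
have h1 : nbhs t [set s | `[0, T]%classic (clamp T s) -> P (clamp T s)].
  exact: (@continuous_clamp T t _ hP).
change (nbhs t [set s | P (clamp T s)]).
apply: filterS h1 => s /=; apply.
by rewrite in_itv; exact: (clamp_itv s T0).
Qed.

Lemma continuous_bounded f a b : continuous f ->
  exists2 C, 0 <= C & forall t, a <= t <= b -> `|f t| <= C.
Proof.
move=> cf; have cs : {within `[a, b], continuous f} by exact: continuous_subspaceT.
have [M [_ hM]] := compact_bounded (continuous_compact cs (@segment_compact _ a b)).
exists (`|M| + 1); first by rewrite addr_ge0.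
move=> t ht; apply: (hM (`|M| + 1)).
  by apply: le_lt_trans (ler_norm _) _; rewrite ltrDl.
by exists t => //=; rewrite in_itv.
Qed.

Lemma continuous_max_at f T : 0 <= T -> continuous f ->
  exists2 t0, 0 <= t0 <= T & forall t, 0 <= t <= T -> f t <= f t0.
Proof.
move=> T0 cf; have cs : {within `[0, T], continuous f} by exact: continuous_subspaceT.
have [c] := EVT_max T0 cs; rewrite in_itv /= => cT h.
by exists c => // t tT; apply: h; rewrite in_itv.
Qed.

End Calculus.

(** * Continuity of Volterra integrals *)

Section Volterra.
Context {R : realType}.
Local Notation mu := (@lebesgue_measure R).
Variables (K : R -> R -> R) (C : R).
Hypothesis Kl : forall s, continuous (K ^~ s).
Hypothesis Kr : forall t, continuous (K t).
Hypothesis KC : forall t s, `|K t s| <= C.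

Let C0 : 0 <= C. Proof. exact: le_trans (normr_ge0 _) (KC 0 0). Qed.

(** The kernel cut off outside [0 <= s <= t], which makes the domain of integration independent of
    [t]. The price is a jump on the diagonal, a null set for each [t]. *)
Definition causal (t s : R) : R := \1_`[0, t] s * K t s.

Lemma causal_bound t s : `|causal t s| <= C.
Proof.
rewrite /causal indicE; case: (_ \in _); rewrite ?mul1r ?mul0r ?normr0//.
Qed.

Lemma causal_measurable D t : measurable_fun D (causal t).
Proof.
apply: measurable_funM; first exact: measurable_indic.
exact: continuous_measurable.
Qed.

Lemma causal_cvg s t : t != s -> causal ^~ s @ t --> causal t s.
Proof.
move=> ts; have [s0|s0] := leP 0 s; last first.
  have E x : causal x s = 0.
    by rewrite /causal indicE mem_setE in_itv /= leNgt s0 mul0r.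
  by rewrite E (_ : causal^~ s = cst 0); [exact: cvg_cst | exact/funext].
move: ts; rewrite neq_lt => /orP[ts|st].
  have -> : causal t s = 0.
    by rewrite /causal indicE mem_setE in_itv /= s0 leNgt ts mul0r.
  apply: cvg_near_cst; near=> x.
  rewrite /causal indicE mem_setE in_itv /= s0 leNgt.
  have -> : x < s by near: x; exact: (cvgr_lt t cvg_id _ ts).
  by rewrite mul0r.
have -> : causal t s = K t s.
  by rewrite /causal indicE mem_setE in_itv /= s0 (ltW st) mul1r.
apply: cvg_trans (Kl (s := s) (x := t)); apply: near_eq_cvg; near=> x.
rewrite /causal indicE mem_setE in_itv /= s0.
have -> : s <= x by apply: ltW; near: x; exact: (cvgr_gt t cvg_id _ st).
by rewrite mul1r.
Unshelve. all: by end_near. Qed.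

Lemma causal_integrable t b (g : R -> R) : mu.-integrable `[0, b] (EFin \o g) ->
  mu.-integrable `[0, b] (EFin \o (fun s => causal t s * g s)).
Proof.
move=> gi; apply: (integrable_mul_bounded (C := C)) gi => //.
  exact: causal_measurable.
by move=> s _; exact: causal_bound.
Qed.

(** Dominated convergence along sequences, with exceptional set [{t}] and majorant [2 C |g|]. The
    modulus is kept as an integral of absolute values so that it also controls vector-valued
    Volterra integrals. *)
Lemma causal_modulus b t (g : R -> R) : mu.-integrable `[0, b] (EFin \o g) ->
  \int[mu]_(s in `[0, b]) (`|causal x s - causal t s| * `|g s|) @[x --> t] --> 0.
Proof.
move=> gi; have gm : measurable_fun `[0, b] g.
  by apply/measurable_EFinP; exact: measurable_int gi.
apply/(@cvg_nbhsP _ R^o) => w wt.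
have mb : measurable (`[0, b]%classic : set R) by [].
pose f_ n s := (`|causal (w n) s - causal t s| * `|g s|)%:E.
have mf n : measurable_fun `[0, b] (f_ n).
  apply/measurable_EFinP; apply: measurable_funM.
    by apply: measurableT_comp => //; apply: measurable_funB; exact: causal_measurable.
  exact: measurableT_comp.
have [|||_ _] := @dominated_convergence _ _ R mu `[0, b]%classic mb f_ (cst 0%E)
  (EFin \o (fun s => 2 * C * `|g s|)) mf (measurable_cst _).
- exists [set t]; split; [exact: measurable_set1|exact: lebesgue_measure_set1|].
  move=> s /= h; apply: contrapT => st; apply: h => _.
  apply/cvg_EFin; first by exists 0%N.
  have ts : t != s by apply/eqP => e; apply: st.
  rewrite /f_ /comp /= -[X in _ --> X](mul0r `|g s|).
  apply: cvgM; last exact: cvg_cst.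
  rewrite -(normr0 R) -(subrr (causal t s)); apply: cvg_norm; apply: cvgB; last exact: cvg_cst.
  exact: (cvg_comp _ _ wt (causal_cvg ts)).
- by apply: integrable_scale => //; exact: integrable_norm gi.
- apply: aeW => s n _ /=; rewrite lee_fin ger0_norm ?mulr_ge0//.
  rewrite ler_wpM2r//; apply: le_trans (ler_normB _ _) _.
  by have := causal_bound (w n) s; have := causal_bound t s; lra.
rewrite integral0 => h.
by move/fine_cvg: h.
Qed.

Lemma Rintegral_causal b t (g : R -> R) : t <= b ->
  \int[mu]_(s in `[0, t]) (K t s * g s) = \int[mu]_(s in `[0, b]) (causal t s * g s).
Proof.
move=> tb; rewrite Rintegral_mkcond [RHS]Rintegral_mkcond; apply: eq_Rintegral => s _.
rewrite /patch /causal indicE !mem_setE !in_itv /=.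
case: ifPn => [/andP[s0 st]|]; first by rewrite s0 (le_trans st tb) mul1r.
by move=> _; rewrite !mul0r if_same.
Qed.

Lemma continuous_volterra (g : R -> R) :
  (forall b, mu.-integrable `[0, b] (EFin \o g)) ->
  continuous (fun t : R => \int[mu]_(s in `[0, t]) (K t s * g s)).
Proof.
move=> gi t; apply/cvgrPdist_lt => e e0.
have /cvgrPdist_lt/(_ _ e0) := causal_modulus t (gi (t + 1)).
move=> h; near=> x.
have xb : x <= t + 1 by apply: ltW; near: x; apply: (cvgr_lt t cvg_id); rewrite ltrDl.
have tb : t <= t + 1 by rewrite lerDl.
rewrite (Rintegral_causal g xb) (Rintegral_causal g tb).
rewrite -RintegralB//; try exact: causal_integrable.
have := near h x; rewrite sub0r normrN ger0_norm; last first.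
  by apply: Rintegral_ge0 => s _; rewrite mulr_ge0.
move=> hx; apply: le_lt_trans (hx _) => //.
apply: le_trans (le_normr_Rintegral _ _) _ => //.
  by apply: integrable_sub => //; exact: causal_integrable.
rewrite le_eqVlt; apply/orP; left; apply/eqP; apply: eq_Rintegral => s _.
by rewrite -mulrBl normrM distrC.
Unshelve. all: by end_near. Qed.

End Volterra.

(** * Convolution *)

Section Convolution.
Context {R : realType}.
Local Notation mu := (@lebesgue_measure R).
Implicit Types (f g h : R -> R) (T t : R).

Lemma EFin_Rintegral (D : set R) f : measurable D -> mu.-integrable D (EFin \o f) ->
  (\int[mu]_(x in D) f x)%:E = (\int[mu]_(x in D) (f x)%:E)%E.
Proof. by move=> mD fi; rewrite /Rintegral fineK//; exact: integrable_fin_num. Qed.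

(** With [phi] bounded and [A], [g] integrable, [C |A x| |g s|] is an integrable majorant on the
    plane. *)
Lemma Rfubini (A phi g : R -> R) C :
  mu.-integrable setT (EFin \o A) -> mu.-integrable setT (EFin \o g) ->
  measurable_fun setT phi -> (forall u, `|phi u| <= C) ->
  \int[mu]_x (A x * \int[mu]_s (phi (x - s) * g s)) =
  \int[mu]_s (g s * \int[mu]_x (A x * phi (x - s))).
Proof.
move=> iA ig mphi phiC.
have mA := integrable_measurable iA; have mg := integrable_measurable ig.
have mphi1 x : measurable_fun setT (fun s : R => phi (x - s)).
  by apply: measurableT_comp => //; apply: measurable_funB => //; exact: measurable_cst.
have mphi2 s : measurable_fun setT (fun x : R => phi (x - s)).
  by apply: measurableT_comp => //; apply: measurable_funB => //; exact: measurable_cst.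
have i1 x : mu.-integrable setT (EFin \o (fun s : R => phi (x - s) * g s)).
  by apply: (integrable_mul_bounded (C := C)).
have i2 s : mu.-integrable setT (EFin \o (fun x : R => A x * phi (x - s))).
  rewrite (_ : (fun x => _) = (fun x => phi (x - s) * A x)); last first.
    by apply/funext => x; rewrite mulrC.
  by apply: (integrable_mul_bounded (C := C)).
pose F (p : R * R) : \bar R := (A p.1 * (phi (p.1 - p.2) * g p.2))%:E.
have mF : measurable_fun setT F.
  apply/measurable_EFinP; apply: measurable_funM.
    by apply: measurableT_comp => //; exact: measurable_fst.
  apply: measurable_funM; last by apply: measurableT_comp => //; exact: measurable_snd.
  apply: measurableT_comp => //; apply: measurable_funB.
    exact: measurable_fst.
  exact: measurable_snd.
have C0 : 0 <= C by exact: le_trans (normr_ge0 _) (phiC 0).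
have mAA : measurable_fun setT (fun x : R => `|(A x)%:E|%E).
  by apply: measurableT_comp => //; exact/measurable_EFinP.
have mgg : measurable_fun setT (fun x : R => `|(g x)%:E|%E).
  by apply: measurableT_comp => //; exact/measurable_EFinP.
have iF : (mu \x mu)%E.-integrable setT F.
  apply/integrable12ltyP => //.
  pose N := (\int[mu]_y `|(g y)%:E|)%E.
  have Nlt : (N < +oo)%E by case/integrableP: ig.
  apply: (@le_lt_trans _ _ (\int[mu]_x (`|(A x)%:E| * (C%:E * N)))%E).
    apply: ge0_le_integral => //.
    - by move=> x _; exact: integral_ge0.
    - have F0 p : (0 <= (abse \o F) p)%E by exact: abse_ge0.
      have mF' : measurable_fun setT (abse \o F) by exact: measurableT_comp.
      have := measurable_fun_fubini_tonelli_F (m2 := mu) _ mF' F0.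
      exact.
    - exact (emeasurable_funM mAA (measurable_cst (C%:E * N)%E)).
    - move=> x _; have Cg0 s : (0 <= C%:E * `|(g s)%:E|)%E by rewrite mule_ge0// lee_fin.
      have e1 : (\int[mu]_s (C%:E * `|(g s)%:E|) = C%:E * N)%E.
        by rewrite ge0_integralZl// lee_fin.
      rewrite -e1; have e2 : (\int[mu]_s (`|(A x)%:E| * (C%:E * `|(g s)%:E|)) =
          `|(A x)%:E| * \int[mu]_s (C%:E * `|(g s)%:E|))%E.
        rewrite ge0_integralZl//.
        exact (emeasurable_funM (measurable_cst C%:E) mgg).
      rewrite -e2.
      apply: ge0_le_integral => //.
      - apply: measurableT_comp => //; apply/measurable_EFinP; apply: measurable_funM.
          exact (measurable_cst (A x)).
        exact (measurable_funM (mphi1 x) mg).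
      - have := emeasurable_funM (measurable_cst C%:E) mgg.
        exact (emeasurable_funM (measurable_cst `|(A x)%:E|%E)).
      - move=> s _; rewrite /F /= -!EFinM lee_fin !normrM.
        by rewrite ler_wpM2l// ler_wpM2r.
  have Nfin : N \is a fin_num by rewrite ge0_fin_numE// integral_ge0.
  rewrite -(fineK Nfin) -EFinM.
  have -> : (\int[mu]_x (`|(A x)%:E| * (C * fine N)%:E) =
      (\int[mu]_x `|(A x)%:E|) * (C * fine N)%:E)%E.
    rewrite ge0_integralZr//.
    by rewrite lee_fin mulr_ge0// fine_ge0// integral_ge0.
  case/integrableP: iA => _ lA.
  have Afin : (\int[mu]_x `|(EFin \o A) x|)%E \is a fin_num.
    by rewrite ge0_fin_numE// integral_ge0.
  by rewrite -(fineK Afin) -EFinM ltry.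
have := Fubini iF; rewrite /F /= => E.
rewrite /Rintegral; congr fine.
transitivity (\int[mu]_x \int[mu]_y (A x * (phi (x - y) * g y))%:E)%E.
  apply: eq_integral => x _; have i4 := integrable_scale (A x) measurableT (i1 x).
  rewrite -(EFin_Rintegral measurableT i4); congr EFin.
  by rewrite RintegralZl.
rewrite E; apply: eq_integral => s _.
have i3 : mu.-integrable setT (EFin \o (fun x : R => g s * (A x * phi (x - s)))).
  exact: integrable_scale.
rewrite -RintegralZl// EFin_Rintegral//.
by apply: eq_integral => x _; congr EFin; ring.
Qed.

Lemma integrable_patch (D : set R) f : measurable D -> mu.-integrable D (EFin \o f) ->
  mu.-integrable setT (EFin \o (f \_ D)).
Proof.
move=> mD fi; have [+ _] := @integrable_mkcond _ _ R mu D (EFin \o f) mD.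
move=> /(_ fi); rewrite (_ : (EFin \o f) \_ D = EFin \o f \_ D)//.
by apply/funext => x /=; rewrite /patch; case: ifP.
Qed.

Lemma continuous_subr f c : continuous f -> continuous (fun x : R => f (c - x)).
Proof.
move=> cf x; apply: (@continuous_comp _ _ _ (fun x : R => c - x) f); last exact: cf.
by apply: cvgB; [exact: cvg_cst|exact: cvg_id].
Qed.

(** All three functions are cut off to [[0, t]]; the cut-off of [f] at [x - s] then supplies
    [s <= x], so a plain product domain encodes the triangle. *)
Lemma fubini_triangle (a f g : R -> R) t : continuous a -> continuous f ->
  mu.-integrable `[0, t] (EFin \o g) ->
  \int[mu]_(x in `[0, t]) (a x * \int[mu]_(s in `[0, x]) (f (x - s) * g s)) =
  \int[mu]_(s in `[0, t]) (g s * \int[mu]_(x in `[s, t]) (a x * f (x - s))).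
Proof.
move=> ca cf gi; have [C C0 fC] := continuous_bounded 0 t cf.
have mt : measurable (`[0, t]%classic : set R) by [].
have := @Rfubini (a \_ `[0, t]) (f \_ `[0, t]) (g \_ `[0, t]) C.
move=> /(_ (integrable_patch mt (continuous_itv_integrable _ _ ca))).
move=> /(_ (integrable_patch mt gi)).
have mf : measurable_fun setT (f \_ `[0, t]).
  apply/(measurable_restrictT _ mt); exact: continuous_measurable.
move=> /(_ mf) E; transitivity (\int[mu]_x ((a \_ `[0, t]) x *
    \int[mu]_s ((f \_ `[0, t]) (x - s) * (g \_ `[0, t]) s))).
  rewrite Rintegral_mkcond; apply: eq_Rintegral => x _; rewrite /patch.
  rewrite mem_setE in_itv /=; case: ifP => xt; last by rewrite mul0r.
  congr (_ * _); rewrite Rintegral_mkcond; apply: eq_Rintegral => s _; rewrite /patch.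
  rewrite !mem_setE !in_itv /= subr_ge0 andbC; case/andP: xt => x0 xt.
  have [s0|s0] := leP 0 s; last by rewrite /= andbF mulr0.
  have [sx|sx] := leP s x; last by rewrite /= mul0r.
  have -> : x - s <= t by lra.
  by have -> : s <= t by lra.
rewrite E; last first.
  move=> u; rewrite /patch mem_setE in_itv /=; case: ifP => ut; first exact: fC.
  by rewrite normr0.
rewrite [RHS]Rintegral_mkcond; apply: eq_Rintegral => s _; rewrite /patch.
rewrite mem_setE in_itv /=; case: ifP => st; last by rewrite mul0r.
congr (_ * _); rewrite [RHS]Rintegral_mkcond; apply: eq_Rintegral => x _; rewrite /patch.
rewrite !mem_setE !in_itv /= subr_ge0; case/andP: st => s0 st.
have [sx|sx] := leP s x; last by rewrite mulr0.
have [xt|xt] := leP x t; last by rewrite andbF mul0r.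
have -> : x - s <= t by lra.
by have -> : 0 <= x by lra.
Qed.

Lemma antiderivative f (a x : R) : continuous f -> a < x ->
  is_derive x 1 (fun x : R => \int[mu]_(u in `[a, x]) f u) (f x).
Proof.
move=> cf ax; have := @continuous_FTC1_closed R f a x (x + 1).
rewrite ltrDl ltr01 => /(_ isT (continuous_itv_integrable _ _ cf) ax (cf x)).
by move=> /= [dF F']; exact: derive1_is_derive dF F'.
Qed.

(** Both sides are increments of one primitive of [f], read before and after translation. Its base
    point [- s - 1] lies to the left of all the arguments that occur. *)
Lemma Rintegral_shift f s t : continuous f -> 0 <= s -> s <= t ->
  \int[mu]_(x in `[s, t]) f (x - s) = \int[mu]_(x in `[0, t - s]) f x.
Proof.
move=> cf s0 st.
have cfs : continuous (fun x : R => f (x - s)).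
  move=> x; apply: (@continuous_comp _ _ _ (fun x : R => x - s) f); last exact: cf.
  by apply: cvgB; [exact: cvg_id|exact: cvg_cst].
pose G x := \int[mu]_(u in `[- s - 1, x]) f u.
have dG x : 0 <= x <= t -> has_deriv t (fun x => G (x - s)) x (f (x - s)).
  move=> /andP[x0 xt]; apply: is_derive_has_deriv; apply/is_deriveP => e e0.
  have ax : - s - 1 < x - s by lra.
  have /is_deriveP/(_ e e0)[d d0 hd] := antiderivative cf ax.
  exists d => // y yx yd; have := hd (y - s).
  have -> : (y - s != x - s) by apply: contra_neq yx => /addIr.
  have -> : x - s - (y - s) = x - y by ring.
  have -> : y - s - (x - s) = y - x by ring.
  by move=> /(_ isT yd).
have tt : 0 <= t <= t by rewrite lexx (le_trans s0 st).
have ss : 0 <= s <= t by rewrite s0 st.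
have E1 := ftc_segment cfs dG tt; have E2 := ftc_segment cfs dG ss.
have E3 : \int[mu]_(x in `[0, t]) f (x - s) =
    \int[mu]_(x in `[0, s]) f (x - s) + \int[mu]_(x in `[s, t]) f (x - s).
  by apply: Rintegral_split => //; exact: continuous_itv_integrable.
have E4 : G (t - s) = G 0 + \int[mu]_(x in `[0, t - s]) f x.
  apply: Rintegral_split; [exact: continuous_itv_integrable|lra|lra].
by move: E1 E2; rewrite E3 E4 subrr; lra.
Qed.

Lemma Rintegral_reflect f t : continuous f -> 0 <= t ->
  \int[mu]_(x in `[0, t]) f (t - x) = \int[mu]_(x in `[0, t]) f x.
Proof.
move=> cf t0; have cft := continuous_subr (c := t) cf.
pose G x := \int[mu]_(u in `[-1, x]) f u.
have dG x : 0 <= x <= t -> has_deriv t (fun x => - G (t - x)) x (f (t - x)).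
  move=> /andP[x0 xt]; apply: is_derive_has_deriv; apply/is_deriveP => e e0.
  have ax : -1 < t - x by lra.
  have /is_deriveP/(_ e e0)[d d0 hd] := antiderivative cf ax.
  exists d => // y yx yd; have := hd (t - y).
  have -> : (t - y != t - x) by apply: contra_neq yx => /addrI /oppr_inj.
  have -> : t - x - (t - y) = - (x - y) by ring.
  rewrite normrN => /(_ isT yd).
  have -> : t - y - (t - x) = - (y - x) by ring.
  have -> // : (- G (t - y) - - G (t - x)) / (y - x) = (G (t - y) - G (t - x)) / - (y - x).
  by rewrite invrN; ring.
have tt : 0 <= t <= t by rewrite t0 lexx.
have := ftc_segment cft dG tt; rewrite subrr subr0.
have -> : G t = G 0 + \int[mu]_(x in `[0, t]) f x.
  apply: Rintegral_split; [exact: continuous_itv_integrable|lra|lra].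
lra.
Qed.

Definition conv f g t := \int[mu]_(s in `[0, t]) (f (t - s) * g s).

Lemma eq_conv f1 g1 f2 g2 t : (forall s, 0 <= s <= t -> f1 s = f2 s) ->
  (forall s, 0 <= s <= t -> g1 s = g2 s) -> conv f1 g1 t = conv f2 g2 t.
Proof.
move=> ff gg; apply: eq_Rintegral => s; rewrite inE /= in_itv /= => /andP[s0 st].
rewrite ff ?gg ?s0//; apply/andP; split; lra.
Qed.

Lemma conv_integrable f g t b : continuous f -> continuous g ->
  mu.-integrable `[0, b] (EFin \o (fun s : R => f (t - s) * g s)).
Proof.
move=> cf cg; apply: continuous_itv_integrable => s.
by apply: cvgM; [exact: (continuous_subr (c := t) cf)|exact: cg].
Qed.

Lemma convC f g t : continuous f -> continuous g -> 0 <= t ->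
  conv f g t = conv g f t.
Proof.
move=> cf cg t0; rewrite /conv.
have ch : continuous (fun s : R => f (t - s) * g s).
  by move=> s; apply: cvgM; [exact: (continuous_subr (c := t) cf)|exact: cg].
rewrite -(Rintegral_reflect ch t0); apply: eq_Rintegral => s _.
by rewrite subKr mulrC.
Qed.

Lemma convDl f1 f2 g t : continuous f1 -> continuous f2 -> continuous g ->
  conv (fun s => f1 s + f2 s) g t = conv f1 g t + conv f2 g t.
Proof.
move=> c1 c2 cg; rewrite /conv -RintegralD//; try exact: conv_integrable.
by apply: eq_Rintegral => s _; rewrite mulrDl.
Qed.

Lemma convZl c f g t : continuous f -> continuous g ->
  conv (fun s => c * f s) g t = c * conv f g t.
Proof.
move=> cf cg; rewrite /conv -RintegralZl//; last exact: conv_integrable.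
by apply: eq_Rintegral => s _; rewrite mulrA.
Qed.

(** Exchanging the integrals over the triangle leaves an inner integral over [[s, t]], which
    translation by [s] turns into a convolution at [t - s]. *)
Lemma convA f g h t : continuous f -> continuous g -> continuous h -> 0 <= t ->
  conv (conv f g) h t = conv f (conv g h) t.
Proof.
move=> cf cg ch t0; rewrite /conv.
rewrite (fubini_triangle (continuous_subr (c := t) cf) cg (continuous_itv_integrable _ _ ch)).
apply: eq_Rintegral => s; rewrite inE /= in_itv /= => /andP[s0 st].
rewrite mulrC; congr (_ * _).
have ck : continuous (fun x : R => f (t - s - x) * g x).
  by move=> x; apply: cvgM; [exact: (continuous_subr (c := t - s) cf)|exact: cg].
rewrite -(Rintegral_shift ck s0 st); apply: eq_Rintegral => x _.
by congr (f _ * _); ring.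
Qed.

End Convolution.

(** * The convolution ring on [0, T] *)

(* [Kern a f] stands for the distribution [a * delta + f] on [0, T], with product
   the convolution; [f] is extended to the line by [f o clamp T], so that
   equality of elements is equality on [0, T]. *)
Record kern (R : realType) (T : R) := Kern {
  kdelta : R;
  kfun : R -> R;
  kfun_continuous : continuous kfun;
  kfun_clamp : forall t, kfun (clamp T t) = kfun t }.

Section KernRing.
Context {R : realType} {T : R}.
Implicit Types (t s : R).
Local Notation kern := (kern T).
Implicit Types x y z : kern.

Lemma kernP x y : kdelta x = kdelta y ->
  (forall t, kfun x (clamp T t) = kfun y (clamp T t)) -> x = y.
Proof.
case: x => a f cf lf; case: y => b g cg lg /= ab fg.
have E : f = g by apply/funext => t; rewrite -lf -lg.
by subst; congr Kern; exact: Prop_irrelevance.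
Qed.

Lemma kfun_bounded x : exists2 C, 0 <= C & forall t, `|kfun x t| <= C.
Proof.
(* [clamp T T] is the maximum of 0 and [T], so this segment contains the range of [clamp T] whatever
   the sign of [T]. *)
have [C C0 hC] := continuous_bounded 0 (clamp T T) (@kfun_continuous _ _ x).
exists C => // t; rewrite -kfun_clamp; apply: hC.
rewrite clamp_ge0 /=; rewrite /clamp minxx.
by case: (leP t T) => tT; rewrite ?lexx// ge_max !le_max lexx tT orbT.
Qed.

Lemma clamp_subproof (f : R -> R) t : (f \o clamp T) (clamp T t) = (f \o clamp T) t.
Proof. by rewrite /= clampK. Qed.

Lemma continuous_comp_clampT (f : R -> R) : continuous f -> continuous (f \o clamp T).
Proof. by move=> cf t; apply: continuous_comp; [exact: continuous_clamp|exact: cf]. Qed.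

Definition kext a (f : R -> R) (cf : continuous f) : kern :=
  Kern a (continuous_comp_clampT cf) (clamp_subproof f).

Lemma conv_continuous x y : continuous (conv (kfun x) (kfun y)).
Proof.
have [C C0 hC] := kfun_bounded x.
apply: (@continuous_volterra R (fun t s => kfun x (t - s)) C) => //.
- move=> s t; apply: (@continuous_comp _ _ _ (fun t : R => t - s) (kfun x)).
    by apply: cvgB; [exact: cvg_id|exact: cvg_cst].
  exact: kfun_continuous.
- by move=> t; apply: continuous_subr; exact: kfun_continuous.
- by move=> b; apply: continuous_itv_integrable; exact: kfun_continuous.
Qed.

Lemma continuous_lin a b x y : continuous (fun t => a * kfun x t + b * kfun y t).
Proof.
move=> t; apply: cvgD; (apply: cvgM; first exact: cvg_cst); exact: kfun_continuous.
Qed.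

Lemma continuous_add (f g : R -> R) : continuous f -> continuous g ->
  continuous (fun t => f t + g t).
Proof. by move=> cf cg t; apply: cvgD; [exact: cf | exact: cg]. Qed.

Lemma continuous_mulc c (f : R -> R) : continuous f -> continuous (fun t => c * f t).
Proof. by move=> cf t; apply: cvgM; [exact: cvg_cst | exact: cf]. Qed.

Definition kadd x y : kern := kext (kdelta x + kdelta y)
  (continuous_add (@kfun_continuous _ _ x) (@kfun_continuous _ _ y)).
Definition kopp x : kern := kext (- kdelta x) (@continuous_lin (-1) 0 x x).
Definition kzero : kern := kext 0 (@cst_continuous _ _ 0).
Definition kone : kern := kext 1 (@cst_continuous _ _ 0).
Definition kmul x y : kern := kext (kdelta x * kdelta y)
  (continuous_add (@continuous_lin (kdelta x) (kdelta y) y x) (@conv_continuous x y)).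

HB.instance Definition _ := gen_eqMixin kern.
HB.instance Definition _ := gen_choiceMixin kern.

Lemma kaddA : associative kadd.
Proof. by move=> x y z; apply: kernP => [|t] /=; rewrite ?clampK addrA. Qed.

Lemma kaddC : commutative kadd.
Proof. by move=> x y; apply: kernP => [|t] /=; rewrite addrC. Qed.

Lemma kadd0 : left_id kzero kadd.
Proof. by move=> x; apply: kernP => [|t] /=; rewrite ?clampK add0r. Qed.

Lemma kaddN : left_inverse kzero kopp kadd.
Proof. by move=> x; apply: kernP => [|t] /=; rewrite ?clampK; ring. Qed.

HB.instance Definition _ := GRing.isZmodule.Build kern kaddA kaddC kadd0 kaddN.

Lemma kfun_mul x y t : clamp T t = t -> kfun (kmul x y) t =
  kdelta x * kfun y t + kdelta y * kfun x t + conv (kfun x) (kfun y) t.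
Proof. by move=> tt; rewrite /= tt. Qed.

Lemma conv_mull x y z t : clamp T t = t -> conv (kfun (kmul x y)) (kfun z) t =
  kdelta x * conv (kfun y) (kfun z) t + kdelta y * conv (kfun x) (kfun z) t
  + conv (conv (kfun x) (kfun y)) (kfun z) t.
Proof.
move=> tt; have cx := @kfun_continuous _ _ x; have cy := @kfun_continuous _ _ y.
have cz := @kfun_continuous _ _ z.
transitivity (conv (fun s => (kdelta x * kfun y s + kdelta y * kfun x s)
    + conv (kfun x) (kfun y) s) (kfun z) t).
  by apply: eq_conv => // s; rewrite -{1}tt => /clamp_le_id h; exact: kfun_mul.
have c1 := @continuous_lin (kdelta x) (kdelta y) y x.
rewrite (convDl t c1 (@conv_continuous x y) cz); congr (_ + _).
rewrite (convDl t (@continuous_mulc (kdelta x) _ cy) (@continuous_mulc (kdelta y) _ cx) cz).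
by rewrite (convZl (kdelta x) t cy cz) (convZl (kdelta y) t cx cz).
Qed.

Lemma kmulC : commutative kmul.
Proof.
move=> x y; apply: kernP => [|t]; first by rewrite /= mulrC.
rewrite !kfun_mul ?clampK//; rewrite [conv (kfun y) _ _]convC ?clamp_ge0//.
- by rewrite [X in X + _]addrC.
- exact: kfun_continuous.
- exact: kfun_continuous.
Qed.

Lemma kmulA : associative kmul.
Proof.
move=> x y z; apply: kernP => [|t]; first by rewrite /= mulrA.
have tt : clamp T (clamp T t) = clamp T t by exact: clampK.
rewrite [kmul x (kmul y z)]kmulC !kfun_mul// !conv_mull//.
have cx := @kfun_continuous _ _ x; have cy := @kfun_continuous _ _ y.
have cz := @kfun_continuous _ _ z.
have cyz := @conv_continuous y z.
rewrite (convC cyz cx) ?clamp_ge0// convA// ?clamp_ge0//.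
rewrite (convC cy cx) ?clamp_ge0// (convC cz cx) ?clamp_ge0// /=.
ring.
Qed.

Lemma conv0l (g : R -> R) t : conv (fun=> 0) g t = 0.
Proof.
rewrite /conv (_ : (fun s => _) = fun=> 0); last by apply/funext => s; rewrite mul0r.
by rewrite /Rintegral integral0.
Qed.

Lemma kmul1 : left_id kone kmul.
Proof.
move=> x; apply: kernP => [|t] /=; first by rewrite mul1r.
by rewrite ?clampK conv0l; ring.
Qed.

Lemma kmulDl : left_distributive kmul kadd.
Proof.
move=> x y z; apply: kernP => [|t]; first by rewrite /= mulrDl.
have cx := @kfun_continuous _ _ x; have cy := @kfun_continuous _ _ y.
have cz := @kfun_continuous _ _ z.
have E : conv (kfun (kadd x y)) (kfun z) (clamp T t) =
    conv (kfun x) (kfun z) (clamp T t) + conv (kfun y) (kfun z) (clamp T t).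
  rewrite -convDl//; apply: eq_conv => // s /clamp_le_id h /=.
  by rewrite h.
by rewrite kfun_mul ?clampK// E /= !clampK; ring.
Qed.

Lemma kone_neq0 : kone != kzero.
Proof. by apply/eqP => /(congr1 (@kdelta _ _)) /= /eqP; rewrite oner_eq0. Qed.

HB.instance Definition _ := GRing.Zmodule_isComNzRing.Build kern
  kmulA kmulC kmul1 kmulDl kone_neq0.

Lemma kernE x y : kdelta x = kdelta y ->
  (forall t, clamp T t = t -> 0 <= t -> kfun x t = kfun y t) -> x = y.
Proof.
move=> ab h; apply: kernP => // t; apply: h; [exact: clampK | exact: clamp_ge0].
Qed.

Lemma kdeltaD x y : kdelta (x + y) = kdelta x + kdelta y. Proof. by []. Qed.
Lemma kdeltaN x : kdelta (- x) = - kdelta x. Proof. by []. Qed.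
Lemma kdeltaM x y : kdelta (x * y) = kdelta x * kdelta y. Proof. by []. Qed.
Lemma kdelta1 : kdelta (1 : kern) = 1. Proof. by []. Qed.
Lemma kfunD x y t : kfun (x + y) t = kfun x t + kfun y t.
Proof. by rewrite /= !kfun_clamp. Qed.
Lemma kfunN x t : kfun (- x) t = - kfun x t.
Proof. by rewrite /= !kfun_clamp; ring. Qed.
Lemma kfunB x y t : kfun (x - y) t = kfun x t - kfun y t.
Proof. by rewrite kfunD kfunN. Qed.
Lemma kfun0 t : kfun (0 : kern) t = 0. Proof. by []. Qed.
Lemma kfun1 t : kfun (1 : kern) t = 0. Proof. by []. Qed.
Lemma kfunM x y t : clamp T t = t -> kfun (x * y) t =
  kdelta x * kfun y t + kdelta y * kfun x t + conv (kfun x) (kfun y) t.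
Proof. exact: kfun_mul. Qed.

(** The multiple [a delta] of the unit: scalars become ring elements, so that identities mixing both
    are ring identities. *)
Definition kscal a : kern := kext a (@cst_continuous _ _ 0).

Lemma kfun_scal a x t : kfun (kscal a * x) t = a * kfun x t.
Proof.
rewrite -[LHS]kfun_clamp -[in RHS](kfun_clamp x) kfunM ?clampK//= conv0l; ring.
Qed.

Lemma kscalD a b : kscal (a + b) = kscal a + kscal b.
Proof. by apply: kernE => // t tt t0; rewrite kfunD /= addr0. Qed.
Lemma kscalM a b : kscal (a * b) = kscal a * kscal b.
Proof. by apply: kernE => // t tt t0; rewrite kfun_scal /= mulr0. Qed.
Lemma kscal1 : kscal 1 = 1. Proof. exact: kernE. Qed.
Lemma kscal0 : kscal 0 = 0. Proof. exact: kernE. Qed.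
Lemma kscalN a : kscal (- a) = - kscal a.
Proof. by apply: kernE => // t tt t0; rewrite kfunN /= oppr0. Qed.
Lemma kscal_nat n : kscal n%:R = n%:R.
Proof. by elim: n => [|n IH]; rewrite ?kscal0// -natr1 kscalD IH kscal1 natr1. Qed.

Lemma kder_continuous x : continuous (fun t => t * kfun x t).
Proof. by move=> t; apply: cvgM; [exact: cvg_id | exact: kfun_continuous]. Qed.

(** Multiplication by [t], which kills the delta part. In Laplace transforms it is minus the
    derivative, hence a derivation for the convolution product. *)
Definition kder x : kern := kext 0 (@kder_continuous x).

Lemma kder_fun x t : clamp T t = t -> kfun (kder x) t = t * kfun x t.
Proof. by move=> tt; rewrite /= tt. Qed.

Lemma kderD x y : kder (x + y) = kder x + kder y.
Proof.
apply: kernE => [|t tt t0]; first by rewrite /= addr0.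
by rewrite kder_fun// !kfunD !kder_fun// mulrDr.
Qed.

(** Under the convolution integral, [t = (t - s) + s]. *)
Lemma kderM x y : kder (x * y) = kder x * y + x * kder y.
Proof.
apply: kernE => [|t tt t0]; first by rewrite /= !(mul0r, mulr0) addr0.
have d0 z : kdelta (kder z) = 0 by [].
rewrite kfunD kder_fun// !kfunM// !kder_fun// !d0.
have cx := @kfun_continuous _ _ x; have cy := @kfun_continuous _ _ y.
suff E : t * conv (kfun x) (kfun y) t =
    conv (kfun (kder x)) (kfun y) t + conv (kfun x) (kfun (kder y)) t.
  by rewrite [LHS]mulrDr E; ring.
transitivity (conv (fun s => s * kfun x s) (kfun y) t +
              conv (kfun x) (fun s => s * kfun y s) t).
  have i1 := conv_integrable t t cx cy.
  have i2 := conv_integrable t t (@kder_continuous x) cy.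
  have i3 := conv_integrable t t cx (@kder_continuous y).
  rewrite /conv -RintegralZl// -RintegralD//.
  by apply: eq_Rintegral => s _; ring.
by congr (_ + _); apply: eq_conv => // s; rewrite -{1}tt => /clamp_le_id h; rewrite kder_fun.
Qed.

Lemma kder_scal a x : kder (kscal a * x) = kscal a * kder x.
Proof.
by rewrite kderM (_ : kder (kscal a) = 0) ?mul0r ?add0r//; apply: kernE => // t tt t0; rewrite kder_fun//= mulr0.
Qed.

Lemma kderN x : kder (- x) = - kder x.
Proof. by rewrite -mulN1r -kscal1 -kscalN kder_scal kscalN kscal1 mulN1r. Qed.

Lemma kder_eq0 x : 0 < T -> kder x = 0 -> forall t, kfun x t = 0.
Proof.
move=> T0 dx; have h t : 0 < t <= T -> kfun x t = 0.
  move=> /andP[t0 tT]; have tt : clamp T t = t by rewrite clamp_id// ltW.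
  have := congr1 (fun k => kfun k t) dx; rewrite kder_fun// => /eqP.
  by rewrite mulf_eq0 gt_eqF//= => /eqP.
have h0 : kfun x 0 = 0.
  apply: (@cvg_unique R (@Rhausdorff R) (kfun x @ (0 : R)^'+)).
    by apply: cvg_at_right_filter; exact: kfun_continuous.
  apply: cvg_near_cst; near=> t; apply: h; apply/andP; split.
    by near: t; exact: nbhs_right_gt.
  by near: t; exact: nbhs_right_le.
move=> t; rewrite -kfun_clamp; have /andP[c0 cT] := clamp_itv t (ltW T0).
move: c0; rewrite le_eqVlt => /predU1P[<-//|c0].
by apply: h; rewrite c0.
Unshelve. all: by end_near. Qed.

End KernRing.

(** * Series with exponential majorants *)

Section Series.
Context {R : realType}.
Local Notation mu := (@lebesgue_measure R).

Lemma continuous_uniform_limit (u : nat -> R -> R) (f : R -> R) (e : nat -> R) :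
  (forall n, continuous (u n)) -> e @ \oo --> 0 ->
  (forall n t, `|u n t - f t| <= e n) -> continuous f.
Proof.
move=> cu e0 h t; apply/cvgrPdist_lt => d d0.
have d3 : 0 < d / 3 by lra.
have /cvgrPdist_lt/(_ _ d3)[N _ hN] := e0.
have := hN N (leqnn N); rewrite sub0r normrN => eN.
have /cvgrPdist_lt/(_ _ d3) := cu N t; apply: filterS => s hs.
have -> : f t - f s = - (u N t - f t) + (u N t - u N s) + (u N s - f s) by ring.
apply: le_lt_trans (ler_normD _ _) _.
have h1 := ler_normD (- (u N t - f t)) (u N t - u N s).
rewrite normrN in h1; have h2 := h N t; have h3 := h N s; have h4 := ler_norm (e N).
by apply: le_lt_trans (lerD h1 (lexx _)) _; lra.
Qed.

(** The remainder after [n] terms of the series of [C exp c]. *)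
Definition etail (C c : R) (n : nat) : R :=
  limn (series (fun k => C * (c ^+ k / k`!%:R))) - series (fun k => C * (c ^+ k / k`!%:R)) n.

Lemma exp_scaled_cvg (C c : R) : cvgn (series (fun k => C * (c ^+ k / k`!%:R))).
Proof.
have -> : series (fun k => C * (c ^+ k / k`!%:R)) = (fun n => C * series (exp_coeff c) n).
  by apply/funext => n; rewrite /series /= big_distrr.
exact: is_cvgMr (is_cvg_series_exp_coeff c).
Qed.

Lemma etail_cvg (C c : R) : etail C c @ \oo --> 0.
Proof.
rewrite /etail -(subrr (limn (series (fun k => C * (c ^+ k / k`!%:R))))).
by apply: cvgB; [exact: cvg_cst | exact: exp_scaled_cvg].
Qed.

Lemma exp_series_bound (a : nat -> R) C c : 0 <= C -> 0 <= c ->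
  (forall k, `|a k| <= C * (c ^+ k / k`!%:R)) ->
  series a @ \oo --> limn (series a) /\
  forall n, `|series a n - limn (series a)| <= etail C c n.
Proof.
move=> C0 c0 ha; pose b k := C * (c ^+ k / k`!%:R).
have b0 k : 0 <= b k by rewrite mulr_ge0// divr_ge0// exprn_ge0.
have ca : cvgn (series a).
  apply: normed_cvg.
  have h : cvgn (series (fun n => `|a n|)).
    have h1 := @exp_scaled_cvg C c.
    refine (@series_le_cvg R (fun n => `|a n|) b (fun n => normr_ge0 (a n)) b0 ha _).
    exact h1.
  exact: h.
split=> // n.
have sub m : (n <= m)%N -> `|series a n - series a m| <= series b m - series b n.
  move=> nm; rewrite distrC !sub_series_geq//.
  by apply: le_trans (ler_norm_sum _ _ _) _; apply: ler_sum.
have h1 : `|series a n - series a m| @[m --> \oo] --> `|series a n - limn (series a)|.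
  by apply: cvg_norm; apply: cvgB; [exact: cvg_cst|].
have h2 : series b m - series b n @[m --> \oo] --> etail C c n.
  by apply: cvgB; [exact: exp_scaled_cvg|exact: cvg_cst].
apply: (ler_cvg_to h1 h2); exists n => // m /=; exact: sub.
Qed.

Lemma Rintegral_cst_itv (c t : R) : 0 <= t -> \int[mu]_(s in `[0, t]) c = t * c.
Proof.
move=> t0; have hd x : 0 <= x <= t -> has_deriv t (fun x => x * c) x c.
  move=> _; apply/has_derivP => e e0; exists 1 => // s _ sx _.
  by rewrite -mulrBl mulrAC divff ?subr_eq0// mul1r subrr normr0.
have := ftc_segment (@cst_continuous _ _ c) hd (t := t).
by rewrite lexx t0 mul0r add0r => ->.
Qed.

Lemma Rintegral_le_bound (f : R -> R) t B : 0 <= t -> mu.-integrable `[0, t] (EFin \o f) ->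
  (forall s, 0 <= s <= t -> `|f s| <= B) -> `|\int[mu]_(s in `[0, t]) f s| <= t * B.
Proof.
move=> t0 fi fB; apply: le_trans (le_normr_Rintegral _ _) _ => //.
apply: (@le_trans _ _ (\int[mu]_(s in `[0, t]) B)).
  apply: le_Rintegral => //.
  - exact: integrable_norm.
  - by apply: continuous_itv_integrable; exact: cst_continuous.
by rewrite Rintegral_cst_itv.
Qed.

End Series.

(** * Convergence in the convolution ring *)

Section KernSeries.
Context {R : realType} {T : R}.
Hypothesis T0 : 0 < T.
Local Notation mu := (@lebesgue_measure R).
Local Notation kern := (kern T).
Implicit Types (x y z : kern) (t : R) (n : nat).

(** Uniform norm on the elements without delta part. In a convergent sequence the delta parts are
    therefore eventually equal to that of the limit. *)
Definition kbnd x c := kdelta x = 0 /\ forall t, `|kfun x t| <= c.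

Lemma kclamp_itv t : clamp T t = t -> 0 <= t <= T.
Proof. by move=> <-; exact: clamp_itv (ltW T0). Qed.

Lemma kbnd_exists x : kdelta x = 0 -> exists2 c, 0 <= c & kbnd x c.
Proof. by move=> dx; have [C C0 hC] := kfun_bounded x; exists C. Qed.

Lemma kmul_bounded x : exists2 k, 0 <= k & forall y c, kbnd y c -> kbnd (x * y) (k * c).
Proof.
have [B B0 hB] := kfun_bounded x; exists (`|kdelta x| + T * B).
  by rewrite addr_ge0// mulr_ge0// ltW.
move=> y c [dy hy]; split; first by rewrite kdeltaM dy mulr0.
move=> t; rewrite -kfun_clamp; set u := clamp T t; have uu : clamp T u = u by exact: clampK.
have /andP[u0 uT] := kclamp_itv uu.
have c0 : 0 <= c by exact: le_trans (normr_ge0 _) (hy 0).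
rewrite kfunM// dy mul0r addr0 mulrDl; apply: le_trans (ler_normD _ _) _.
apply: lerD; first by rewrite normrM ler_wpM2l.
apply: (@le_trans _ _ (u * (B * c))).
  apply: Rintegral_le_bound => //.
    by apply: conv_integrable; exact: kfun_continuous.
  by move=> s _; rewrite normrM ler_pM.
by rewrite mulrA; do 2!apply: ler_wpM2r => //.
Qed.

Lemma kpow_bounded x : exists2 k, 0 <= k & forall n y c, kbnd y c ->
  kbnd (x ^+ n * y) (k ^+ n * c).
Proof.
have [k k0 hk] := kmul_bounded x; exists k => // n y c hy.
elim: n => [|n IH]; first by rewrite !expr0 !mul1r.
by rewrite !exprS -!mulrA; exact: hk.
Qed.

Definition kcvg (u : nat -> kern) x :=
  forall e, 0 < e -> exists N, forall n, (N <= n)%N -> kbnd (u n - x) e.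

Lemma kbndW x c d : kbnd x c -> c <= d -> kbnd x d.
Proof. by move=> [dx hx] cd; split=> // t; exact: le_trans (hx t) cd. Qed.

Lemma kbndD x y c d : kbnd x c -> kbnd y d -> kbnd (x + y) (c + d).
Proof.
move=> [dx hx] [dy hy]; split; first by rewrite kdeltaD dx dy addr0.
by move=> t; rewrite kfunD; apply: le_trans (ler_normD _ _) _; exact: lerD.
Qed.

Lemma kbndN x c : kbnd x c -> kbnd (- x) c.
Proof.
by move=> [dx hx]; split; [rewrite kdeltaN dx oppr0 | move=> t; rewrite kfunN normrN].
Qed.

Lemma kbnd_small x : (forall e, 0 < e -> kbnd x e) -> x = 0.
Proof.
move=> h; apply: kernE => [|t _ _]; first by have [] := h 1 ltr01.
apply/eqP; rewrite -normr_eq0 eq_le normr_ge0 andbT.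
by apply/ler_addgt0Pr => e e0; rewrite add0r; have [_] := h e e0.
Qed.

Lemma kcvg_uniq u x y : kcvg u x -> kcvg u y -> x = y.
Proof.
move=> hx hy; apply/eqP; rewrite -subr_eq0; apply/eqP; apply: kbnd_small => e e0.
have e2 : 0 < e / 2 by lra.
have [N hN] := hx _ e2; have [M hM] := hy _ e2.
have h1 := hN (maxn N M) (leq_maxl _ _); have h2 := hM (maxn N M) (leq_maxr _ _).
have -> : x - y = (u (maxn N M) - y) - (u (maxn N M) - x) by ring.
by apply: kbndW (kbndD h2 (kbndN h1)) _; lra.
Qed.

Lemma kcvgD u v x y : kcvg u x -> kcvg v y -> kcvg (fun n => u n + v n) (x + y).
Proof.
move=> hx hy e e0; have e2 : 0 < e / 2 by lra.
have [N hN] := hx _ e2; have [M hM] := hy _ e2.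
exists (maxn N M) => n; rewrite geq_max => /andP[n1 n2].
have -> : u n + v n - (x + y) = (u n - x) + (v n - y) by ring.
by apply: kbndW (kbndD (hN _ n1) (hM _ n2)) _; lra.
Qed.

Lemma kcvgM a u x : kcvg u x -> kcvg (fun n => a * u n) (a * x).
Proof.
move=> hx e e0; have [k k0 hk] := kmul_bounded a.
have e2 : 0 < e / (k + 1) by rewrite divr_gt0//; lra.
have [N hN] := hx _ e2; exists N => n /hN /hk h; rewrite -mulrBr.
apply: kbndW h _; rewrite mulrCA ger_pMr// ler_pdivrMr; lra.
Qed.

Lemma kcvg_der u x : kcvg u x -> kcvg (fun n => kder (u n)) (kder x).
Proof.
move=> hx e e0; have e2 : 0 < e / T by rewrite divr_gt0.
have [N hN] := hx _ e2; exists N => n /hN [d h].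
have -> : kder (u n) - kder x = kder (u n - x).
  by rewrite kderD -mulN1r -kscal1 -kscalN -kder_scal kscalN kscal1 mulN1r.
split=> // t; rewrite -kfun_clamp kder_fun ?clampK// normrM.
have /andP[u0 uT] := clamp_itv t (ltW T0).
have := h (clamp T t); rewrite ler_pdivlMr// mulrC => h'.
by apply: le_trans h'; rewrite ler_wpM2r// ger0_norm.
Qed.

Definition ksums (f : nat -> kern) x := kcvg (fun n => \sum_(k < n) f k) x.

Lemma ksums_uniq f x y : ksums f x -> ksums f y -> x = y.
Proof. exact: kcvg_uniq. Qed.

Lemma ksumsD f g x y : ksums f x -> ksums g y -> ksums (fun k => f k + g k) (x + y).
Proof.
move=> hf hg; have := kcvgD hf hg; rewrite /ksums.
by under [X in _ -> kcvg X _]eq_fun do rewrite big_split.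
Qed.

Lemma ksumsM a f x : ksums f x -> ksums (fun k => a * f k) (a * x).
Proof.
by move=> hf; have := kcvgM a hf; rewrite /ksums; under [X in _ -> kcvg X _]eq_fun do rewrite -mulr_sumr.
Qed.

Lemma kder0 : kder (0 : kern) = 0.
Proof. by apply: kernE => // t tt _; rewrite kder_fun// kfun0 mulr0. Qed.

Lemma ksums_der f x : ksums f x -> ksums (fun k => kder (f k)) (kder x).
Proof.
move=> /kcvg_der; rewrite /ksums /=.
under [X in kcvg X _ -> _]eq_fun do rewrite (big_morph (@kder R T) (@kderD R T) kder0).
by [].
Qed.

Lemma ksums_shift f x : ksums f x -> ksums (fun k => f k.+1) (x - f 0%N).
Proof.
move=> h e e0; have [N hN] := h e e0; exists N => n nN.
have := hN n.+1 (leqW nN); rewrite big_ord_recl /=.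
by rewrite opprB addrCA addrA.
Qed.

Lemma eq_ksums f g x : (forall k, f k = g k) -> ksums f x -> ksums g x.
Proof. by move=> fg; rewrite (_ : f = g)//; apply/funext. Qed.

Lemma kfun_sum (f : nat -> kern) n t :
  kfun (\sum_(k < n) f k) t = series (fun k => kfun (f k) t) n.
Proof.
rewrite /series /= big_mkord.
by elim/big_rec2: _ => [|i a b _ <-]; rewrite ?kfun0 ?kfunD.
Qed.

Lemma kdelta_sum (f : nat -> kern) n : (forall k, kdelta (f k) = 0) ->
  kdelta (\sum_(k < n) f k) = 0.
Proof. by move=> f0; elim/big_rec: _ => // i x _ h; rewrite kdeltaD f0 h addr0. Qed.

Lemma ksums_exists f C c : 0 <= C -> 0 <= c ->
  (forall k, kbnd (f k) (C * (c ^+ k / k`!%:R))) ->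
  exists2 x, ksums f x & kdelta x = 0 /\
   forall n t, `|series (fun k => kfun (f k) t) n - kfun x t| <= etail C c n.
Proof.
move=> C0 c0 hf; have fd k : kdelta (f k) = 0 by have [] := hf k.
pose g t := limn (series (fun k => kfun (f k) t)).
have gP t n : `|series (fun k => kfun (f k) t) n - g t| <= etail C c n.
  by have [_] := exp_series_bound C0 c0 (fun k => (hf k).2 t).
have cg : continuous g.
  apply: (@continuous_uniform_limit _ (fun n t => series (fun k => kfun (f k) t) n) _ (etail C c)).
  - move=> n; have := @kfun_continuous _ _ (\sum_(k < n) f k).
    by rewrite (_ : kfun _ = fun t => series (fun k => kfun (f k) t) n)//; apply/funext => t; exact: kfun_sum.
  - exact: etail_cvg.
  - by move=> n t; exact: gP.
have gc t : g (clamp T t) = g t.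
  by rewrite /g; under [in LHS]eq_fun do rewrite kfun_clamp.
exists (Kern 0 cg gc) => // e e0.
have /cvgrPdist_lt/(_ _ e0)[N _ hN] := @etail_cvg R C c.
exists N => n /hN; rewrite sub0r normrN => h; split.
  by rewrite kdeltaD kdelta_sum//= oppr0 addr0.
move=> t; rewrite kfunB kfun_sum; apply: le_trans (gP t n) _.
by apply: le_trans (ler_norm _) (ltW h).
Qed.

Definition kint : kern := kext 0 (@cst_continuous _ _ (1 : R)).

Lemma kint_delta : kdelta kint = 0. Proof. by []. Qed.

Lemma kint_fun t : kfun kint t = 1.
Proof. by []. Qed.

Lemma kintM_fun x t : clamp T t = t ->
  kfun (kint * x) t = kdelta x + \int[mu]_(s in `[0, t]) kfun x s.
Proof.
move=> tt; rewrite kfunM// kint_delta kint_fun mul0r add0r mulr1; congr (_ + _).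
by apply: eq_Rintegral => s _; rewrite kint_fun mul1r.
Qed.

Lemma kintM_delta x : kdelta (kint * x) = 0.
Proof. by rewrite kdeltaM kint_delta mul0r. Qed.

Lemma kder_kint : kder kint = kint * kint.
Proof.
apply: kernE => [|t tt t0]; first by rewrite kintM_delta.
rewrite kder_fun// kint_fun mulr1 kintM_fun// kint_delta add0r.
under eq_Rintegral do rewrite kint_fun.
by rewrite Rintegral_cst_itv// mulr1.
Qed.

Lemma kder_exp x n : kder (x ^+ n.+1) = n.+1%:R * x ^+ n * kder x.
Proof.
elim: n => [|n IH]; first by rewrite expr1 expr0 !mul1r.
by rewrite exprS kderM IH -natr1 (exprS x n); ring.
Qed.

(** [I^(n+1)] is the function [t^n / n!]: applying the derivation to it and using [kder I = I^2]
    gives the recursion [(n + 1) I^(n+2) = t I^(n+1)]. *)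
Lemma kint_exp_bnd n : kbnd (kint ^+ n.+1) (T ^+ n / n`!%:R).
Proof.
elim: n => [|n [IHd IH]].
  by split; [rewrite expr1 kint_delta | move=> t; rewrite expr1 kint_fun normr1 expr0 fact0 divr1].
split; first by rewrite exprS kintM_delta.
move=> t; rewrite -kfun_clamp; set u := clamp T t.
have uu : clamp T u = u by exact: clampK.
have /andP[u0 uT] := kclamp_itv uu.
have E : n.+1%:R * kfun (kint ^+ n.+2) u = u * kfun (kint ^+ n.+1) u.
  rewrite -kder_fun// (_ : kder _ = kscal n.+1%:R * kint ^+ n.+2) ?kfun_scal//.
  by rewrite kder_exp kder_kint kscal_nat !exprS; ring.
have n0 : 0 < n.+1%:R :> R by [].
rewrite -(ler_pM2l n0) -[n.+1%:R in X in X <= _]ger0_norm// -normrM E normrM.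
have -> : n.+1%:R * (T ^+ n.+1 / (n.+1)`!%:R) = T * (T ^+ n / n`!%:R) :> R.
  rewrite factS natrM exprS; field.
  by rewrite pnatr_eq0 -lt0n fact_gt0 /= addrC natr1 pnatr_eq0.
by apply: ler_pM => //; rewrite ger0_norm.
Qed.

(** Multiplication by [X^k] costs at most a geometric factor, which the factorial in the bound on
    [f k] absorbs; hence no smallness of [X]. *)
Lemma kgeom_exists X a (f : nat -> kern) C c : 0 <= C -> 0 <= c ->
  (forall k, kbnd (f k) (C * (c ^+ k / k`!%:R))) ->
  exists2 x, ksums (fun k => X ^+ k * a * f k) x & kdelta x = 0.
Proof.
move=> C0 c0 hf; have [k1 k10 h1] := kpow_bounded X; have [k2 k20 h2] := kmul_bounded a.
have [||k|x hx [dx _]] := @ksums_exists (fun k => X ^+ k * a * f k) (k2 * C) (k1 * c).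
- by rewrite mulr_ge0.
- by rewrite mulr_ge0.
- have := h1 k _ _ (h2 _ _ (hf k)); rewrite mulrA exprMn => h.
  by apply: kbndW h _; rewrite le_eqVlt; apply/orP; left; apply/eqP; ring.
by exists x.
Qed.

(** Iteration gives [y = X^n (y I^n)], and the factorial decay of [I^n] beats the geometric growth
    of [X^n]. This is the uniqueness principle for Volterra equations in the ring. *)
Lemma knilpotent X y : kdelta y = 0 -> y = X * (kint * y) -> y = 0.
Proof.
move=> dy E; have [k k0 hk] := kpow_bounded (X * y).
have [B B0 hB] := kbnd_exists dy.
have [k1 k10 h1] := kpow_bounded X; have [k2 k20 h2] := kmul_bounded y.
have Ek n : y = X ^+ n * (y * kint ^+ n).
  elim: n => [|n IH]; first by rewrite !expr0 mulr1 mul1r.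
  by rewrite {1}E {1}IH !exprS; ring.
apply: kbnd_small => e e0.
have /cvgrPdist_lt/(_ _ e0)[N _ hN] : k1 * k2 * exp_coeff (k1 * T) n @[n --> \oo] --> 0.
  by rewrite -(mulr0 (k1 * k2)); apply: cvgMr; exact: cvg_exp_coeff.
have := hN N (leqnn N); rewrite sub0r normrN => h.
rewrite (Ek N.+1); apply: kbndW (h1 _ _ _ (h2 _ _ (kint_exp_bnd N))) _.
apply: le_trans (ltW h); apply: le_trans (ler_norm _).
by rewrite /exp_coeff /= exprMn exprS le_eqVlt; apply/orP; left; apply/eqP; ring.
Qed.

End KernSeries.

(** * Transmutation of the wave kernel into the memory kernel *)

Section Root.
Context {R : realType} {T : R}.
Hypothesis T0 : 0 < T.
Local Notation kern := (kern T).
Local Notation I := (@kint R T).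

(* The coefficients of (1 - z)^(-1/2). *)
Fixpoint root_coef (k : nat) : R :=
  if k is k'.+1 then root_coef k' * ((2 * k' + 1)%:R / (2 * k' + 2)%:R) else 1.

Lemma root_coef_itv k : 0 <= root_coef k <= 1.
Proof.
elim: k => [|k /andP[h0 h1]]; first by rewrite /= ler01 lexx.
have p : 0 < (2 * k + 2)%:R :> R by rewrite ltr0n addn2.
have q : (2 * k + 1)%:R / (2 * k + 2)%:R <= 1 :> R.
  by rewrite ler_pdivrMr// mul1r ler_nat leq_add2l.
by rewrite /= mulr_ge0 ?divr_ge0//= mulr_ile1// divr_ge0.
Qed.

Lemma root_coefS k : 2 * k.+1%:R * root_coef k.+1 = (2 * k%:R + 1) * root_coef k.
Proof.
have p : 2 * k.+1%:R = (2 * k + 2)%:R :> R by rewrite -natr1 natrD natrM; ring.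
have n0 : (2 * k + 2)%:R != 0 :> R by rewrite pnatr_eq0 addn2.
by rewrite p /= mulrC -mulrA divfK// natrD natrM mulrC.
Qed.

(** [(I Md)^(k+1)] inherits factorial decay from [I^(k+1)], so a power series in [M] with
    coefficients of linear growth converges for any [M = I Md]. Linear growth leaves room for the
    term by term derivative; [k + 2 <= 2 * 2^k] turns it into a geometric factor. *)
Lemma kpow_series_exists (Md : kern) (al : nat -> R) :
  (forall k, `|al k| <= k.+2%:R) ->
  exists x : kern, ksums (fun k => kscal (al k) * (I * Md) ^+ k.+1) x /\ kdelta x = 0.
Proof.
move=> hal.
have [||k|x hx dx] := @kgeom_exists R T T0 Md Md (fun k => kscal (al k) * I ^+ k.+1) 2 (2 * T).
- by [].
- by rewrite mulr_ge0// ltW.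
- have [d h] := kint_exp_bnd T0 k; split; first by rewrite kdeltaM d mulr0.
  move=> t; rewrite kfun_scal normrM.
  have k2 : k.+2%:R <= 2 * 2 ^+ k :> R.
    by rewrite -exprS -natrX ler_nat; exact: ltn_expl.
  have -> : 2 * ((2 * T) ^+ k / k`!%:R) = (2 * 2 ^+ k) * (T ^+ k / k`!%:R).
    by rewrite exprMn; ring.
  apply: ler_pM => //; exact: le_trans (hal k) k2.
exists x; split=> //; apply: eq_ksums hx => k.
by rewrite exprMn !exprS; ring.
Qed.

(* With M = I Md and L = sum_(k >= 1) c_k M^k, the recursion for c_k says that
   2 (1 - M) L' = M' (1 + L) for the derivation ', so (1 - M) (1 + L)^2 is
   constant. *)
Lemma kern_inverse_sqrt (Md : kern) : exists D : kern,
  (1 - I * Md) * (1 + I * D) ^+ 2 = 1.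
Proof.
set M := I * Md; pose c := root_coef.
have cle k : `|c k| <= 1.
  by have /andP[h0 h1] := root_coef_itv k; rewrite ger0_norm.
have b1 k : `|c k.+1| <= k.+2%:R.
  by apply: le_trans (cle _) _; rewrite ler1n.
have b2 k : `|c k.+2| <= k.+2%:R.
  by apply: le_trans (cle _) _; rewrite ler1n.
have b3 k : `|k.+1%:R * c k.+1| <= k.+2%:R.
  rewrite normrM normr_nat; apply: (@le_trans _ _ (k.+1%:R * 1)).
    by rewrite ler_wpM2l.
  by rewrite mulr1 ler_nat.
have b4 k : `|k.+2%:R * c k.+2| <= k.+2%:R.
  by rewrite normrM normr_nat -[leRHS]mulr1 ler_wpM2l.
(* [x1] is [L] and [z1] is [M] times its formal derivative in [M]; [x2] and [z2] have the same
   coefficients shifted by one, which replaces a division by [M]. *)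
have [x1 [h1 d1]] := kpow_series_exists Md b1.
have [x2 [h2 d2]] := kpow_series_exists Md b2.
have [z1 [g1 _]] := kpow_series_exists Md b3.
have [z2 [g2 _]] := kpow_series_exists Md b4.
rewrite -/M in h1 h2 g1 g2.
have c1 : c 1%N = 2^-1 by rewrite /c /= mul1r muln0 add0n add0n mul1r.
have shiftM (al : nat -> R) x y : ksums (fun k => kscal (al k) * M ^+ k.+1) x ->
    ksums (fun k => kscal (al k.+1) * M ^+ k.+1) y -> x = kscal (al 0%N) * M + M * y.
  move=> hx hy; have := ksums_shift hx; rewrite expr1 => hx'.
  have hy' := ksumsM T0 M hy.
  have : x - kscal (al 0%N) * M = M * y.
    apply: ksums_uniq hx' _; apply: eq_ksums hy' => k.
    by rewrite [in RHS]exprS; ring.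
  by move=> <-; ring.
have e1 : x1 = kscal (c 1%N) * M + M * x2 := shiftM _ _ _ h1 h2.
have e2 : z1 = kscal (c 1%N) * M + M * z2.
  by rewrite -[c 1%N]mul1r; exact: shiftM _ _ _ g1 g2.
(* The recursion [2 (k+2) c_(k+2) = (2 (k+1) + 1) c_(k+1)], summed against [M^(k+1)]. *)
have e3 : 2 * (z2 - z1) = x1.
  have hh := ksumsM T0 2 (ksumsD g2 (ksumsM T0 (-1) g1)).
  rewrite -[z2 - z1]/(z2 + - z1) -[- z1]mulN1r.
  apply: ksums_uniq hh _; apply: eq_ksums h1 => k.
  have := root_coefS k.+1; rewrite -/c => E.
  have -> : kscal (c k.+1) = 2 * (kscal (k.+2%:R * c k.+2) - kscal (k.+1%:R * c k.+1)) :> kern.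
    rewrite -kscalN -kscalD -(kscal_nat 2) -kscalM; congr kscal.
    rewrite mulrBr mulrA E; ring.
  ring.
have e4 : kder x1 = kder M * (kscal (c 1%N) + z2).
  have hx' := ksums_shift (ksums_der T0 h1); rewrite expr1 kder_scal in hx'.
  have hy' := ksumsM T0 (kder M) g2.
  have : kder x1 - kscal (c 1%N) * kder M = kder M * z2.
    apply: ksums_uniq hx' _; apply: eq_ksums hy' => k.
    by rewrite kder_scal kder_exp kscalM kscal_nat; ring.
  by move=> E; rewrite -[LHS](subrK (kscal (c 1%N) * kder M)) E; ring.
have c2 : 2 * kscal (c 1%N) = 1 :> kern.
  by rewrite -(kscal_nat 2) -kscalM c1 divff ?kscal1.
have e5 : 2 * (1 - M) * kder x1 = kder M * (1 + x1).
  rewrite e4.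
  have -> : 2 * (1 - M) * (kder M * (kscal (c 1%N) + z2)) =
     kder M * (2 * kscal (c 1%N) + 2 * (z2 - (kscal (c 1%N) * M + M * z2))) by ring.
  by rewrite c2 -e2 e3.
(* Every term of [L] contains a factor [M = I Md], so one [I] can be taken out. The delta part of
   this [D] is half that of [Md]. *)
exists (Md * (kscal (c 1%N) + x2)).
have -> : I * (Md * (kscal (c 1%N) + x2)) = x1 by rewrite e1 /M; ring.
pose X := (1 - M) * (1 + x1) ^+ 2 - 1; rewrite -[LHS](subrK 1) -/X.
have k1 : kder (1 : kern) = 0.
  by apply: kernE => // t tt _; rewrite kder_fun// kfun1 mulr0.
have dX : kder X = 0.
  rewrite /X kderD kderN k1 oppr0 addr0 kderM kderD kderN k1 kder_exp kderD k1.
  have -> : (0 - kder M) * (1 + x1) ^+ 2 + (1 - M) * (2 * (1 + x1) ^+ 1 * (0 + kder x1))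
     = (1 + x1) * (2 * (1 - M) * kder x1 - kder M * (1 + x1)) by ring.
  by rewrite e5 subrr mulr0.
(* A vanishing [kder] determines the function part only; the delta part is computed directly, [M]
   and [x1] having none. *)
have -> : X = 0; last by rewrite add0r.
apply: kernE => [|t _ _]; last by rewrite (kder_eq0 T0 dX) kfun0.
rewrite /X kdeltaD kdeltaM !kdeltaN expr2 kdeltaM !kdeltaD kdeltaN kdelta1 d1 kintM_delta.
by rewrite oppr0 !addr0 !mul1r subrr.
Qed.

End Root.

(** * Moments of the wave kernel and the transmutation series *)

Section Transmutation.
Context {R : realType} {T : R}.
Hypothesis T0 : 0 < T.
Local Notation mu := (@lebesgue_measure R).
Local Notation kern := (kern T).
Local Notation I := (@kint R T).

(* The solution of s'' + m s = 0, s 0 = 0, s' 0 = 1 in convolution form. *)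
Lemma wave_kern_exists (m : R) : exists s : kern,
  kdelta s = 0 /\ s = I * (I - kscal m * (I * s)).
Proof.
have [||k|s hs ds] := @kgeom_exists R T T0 (- kscal m * I) 1 (fun k => I ^+ k.+2) T T.
- exact: ltW.
- exact: ltW.
- have h := kint_exp_bnd T0 k.+1; apply: kbndW h _.
  have -> : T ^+ k.+1 / (k.+1)`!%:R = k.+1%:R^-1 * (T * (T ^+ k / k`!%:R)).
    by rewrite factS natrM exprS invfM; ring.
  rewrite -[leRHS]mul1r ler_wpM2r//; last by rewrite invf_le1 ?ler1n.
  by rewrite mulr_ge0 ?(ltW T0)// divr_ge0// exprn_ge0// ltW.
exists s; split=> //; have := ksums_shift hs; rewrite expr0 !mul1r => h1.
have h2 := ksumsM T0 (- kscal m * I * I) hs.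
have : s - I ^+ 2 = - kscal m * I * I * s.
  apply: ksums_uniq h1 _; apply: eq_ksums h2 => k.
  by rewrite !mulr1 !exprS; ring.
by move=> E; rewrite -{1}(subrK (I ^+ 2) s) E; ring.
Qed.

Section Fixed.
Variables (s : kern) (m : R).
Hypothesis ds : kdelta s = 0.
Let c := I - kscal m * (I * s).
Hypothesis sE : s = I * c.

(** [(-t)^k / k!] times [x], that is, the [k]-th Taylor coefficient of its Laplace transform.
    Building it from [kder] makes the Leibniz rule available. *)
Fixpoint kmom (x : kern) (k : nat) : kern :=
  if k is k'.+1 then kscal (- k'.+1%:R^-1) * kder (kmom x k') else x.

Lemma kmomS x k : k.+1%:R * kmom x k.+1 = - kder (kmom x k).
Proof.
rewrite /= mulrA -kscal_nat -kscalM mulrN divff ?pnatr_eq0// kscalN kscal1.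
by rewrite mulN1r.
Qed.

Lemma kmom_fun x k t : clamp T t = t ->
  kfun (kmom x k) t = (- t) ^+ k / k`!%:R * kfun x t.
Proof.
move=> tt; elim: k => [|k IH]; first by rewrite expr0 fact0 divr1 mul1r.
have -> : kmom x k.+1 = kscal (- k.+1%:R^-1) * kder (kmom x k) by [].
rewrite kfun_scal kder_fun// IH factS natrM exprS invfM; ring.
Qed.

Lemma kmom_bnd x B : 0 <= B -> kbnd x B -> forall k, kbnd (kmom x k) (B * (T ^+ k / k`!%:R)).
Proof.
move=> B0 [dx hx] k; split.
  case: k => [//|k].
  have -> : kmom x k.+1 = kscal (- k.+1%:R^-1) * kder (kmom x k) by [].
  by rewrite kdeltaM (_ : kdelta (kder _) = 0) ?mulr0.
move=> t; rewrite -kfun_clamp kmom_fun ?clampK// normrM mulrC.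
have /andP[u0 uT] := clamp_itv t (ltW T0).
apply: ler_pM => //; rewrite normrM normrX normrN normfV normr_nat ger0_norm//.
by rewrite ler_wpM2r// ?invr_ge0// lerXn2r// nnegrE// ltW.
Qed.

Lemma natr_kern_inj n (x y : kern) : n.+1%:R * x = n.+1%:R * y -> x = y.
Proof.
move=> /(congr1 (fun z => kscal n.+1%:R^-1 * z)).
by rewrite -!kscal_nat !mulrA -kscalM mulVf ?pnatr_eq0// kscal1 !mul1r.
Qed.

Let sk := kmom s.
Let ck := kmom c.
Let s0 : sk 0%N = s. Proof. by []. Qed.
Let c0 : ck 0%N = c. Proof. by []. Qed.

(** Since [I] is [1 / z], [s = I c] says [z s(z) = c(z)]; the identity is its Taylor coefficient of
    order [k + 1], multiplied by [I]. Here [c] is the derivative of [s]. *)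
Lemma kmom_s k : sk k.+1 + I * sk k = I * ck k.+1.
Proof.
suff E : sk k.+1 = I * (ck k.+1 - sk k) by rewrite E; ring.
elim: k => [|k IH].
  have Es : sk 1%N = - kder s by rewrite -[LHS]mul1r; exact: kmomS s 0.
  have Ec : ck 1%N = - kder c by rewrite -[LHS]mul1r; exact: kmomS c 0.
  have h : kder s = I * s + I * kder c by rewrite {1}sE kderM kder_kint -mulrA -sE.
  rewrite Es Ec h s0; ring.
apply: (@natr_kern_inj k.+1).
rewrite kmomS -/sk IH kderM kder_kint -mulN1r kderD kderN.
rewrite -kmomS -/sk -[kder (ck k.+1)]opprK -kmomS -/ck.
have -> : I * I * (ck k.+1 - sk k) = I * (I * (ck k.+1 - sk k)) by ring.
rewrite -IH -!natr1; ring.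
Qed.

(** The Taylor coefficient of order [k + 1] of [z c(z) = 1 - m s(z)], to which the constant 1 does
    not contribute. *)
Lemma kmom_c k : ck k.+1 + I * ck k = - kscal m * (I * sk k.+1).
Proof.
suff E : ck k.+1 = - (I * (ck k + kscal m * sk k.+1)) by rewrite E; ring.
elim: k => [|k IH].
  have Es : sk 1%N = - kder s by rewrite -[LHS]mul1r; exact: kmomS s 0.
  have Ec : ck 1%N = - kder c by rewrite -[LHS]mul1r; exact: kmomS c 0.
  have h : kder c = I * I - kscal m * (I * I * s + I * kder s).
    by rewrite /c kderD kderN kder_scal kderM kder_kint.
  rewrite Ec h Es c0 /c; ring.
apply: (@natr_kern_inj k.+1).
rewrite kmomS -/ck IH kderN opprK kderM kder_kint kderD kder_scal.
have -> : kder (ck k) = - (k.+1%:R * ck k.+1) by rewrite kmomS opprK.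
have -> : kder (sk k.+1) = - (k.+2%:R * sk k.+2) by rewrite kmomS opprK.
have -> : I * I * (ck k + kscal m * sk k.+1) = - (I * - (I * (ck k + kscal m * sk k.+1))) by ring.
have e2 : k.+2%:R = k.+1%:R + 1 :> kern by rewrite natr1.
move: IH e2; move: (ck k.+1) (ck k) (sk k.+1) (sk k.+2) (kscal m) (k.+2%:R : kern) (k.+1%:R : kern) I.
by move=> b a u v e n2 n i -> ->; ring.
Qed.

(** Let [y = I y'] and let [x] be the companion series with the moments of [c] in place of those of
    [s]. Summing the two moment relations gives [Lam y = I x] and [Lam x = rho I - m I y]: the
    system [s = I c], [c = I - m I s] with [I] divided by [Lam] and a source [rho]. Eliminating [x]
    leaves [Lam^2 y], and [(1 - M) Lam^2 = 1] turns this into the memory equation in integrated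
    form. *)
Lemma transmute (D Md sigd y' : kern) :
  (1 - I * Md) * (1 + I * D) ^+ 2 = 1 ->
  ksums (fun k => D ^+ k * ((1 + I * D) ^+ 2 * sigd) * sk k) y' ->
  I * y' = I * (I * (I * sigd - kscal m * ((1 - I * Md) * (I * y')))).
Proof.
move=> root hy'; set Lam := 1 + I * D; set rho := I * (Lam ^+ 2 * sigd).
have [B B0 hB] : exists2 B, 0 <= B & kbnd c B.
  apply: kbnd_exists; rewrite /c kdeltaD kint_delta kdeltaN kdeltaM kintM_delta.
  by rewrite mulr0 oppr0 addr0.
have [x hx _] := kgeom_exists T0 D rho B0 (ltW T0) (kmom_bnd B0 hB).
rewrite -/ck in hx.
set y := I * y'.
have hy : ksums (fun k => D ^+ k * rho * sk k) y.
  by apply: eq_ksums (ksumsM T0 I hy') => k; rewrite /rho /Lam; ring.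
have y1 := ksums_shift hy; have x1 := ksums_shift hx.
rewrite expr0 mul1r in y1; rewrite expr0 mul1r in x1.
have E1 : Lam * y = I * x.
  have a1 := ksumsD y1 (ksumsM T0 (I * D) hy).
  have a2 := ksumsM T0 I x1.
  have : y - rho * sk 0%N + I * D * y = I * (x - rho * ck 0%N).
    apply: ksums_uniq a1 _; apply: eq_ksums a2 => k.
    have -> : I * (D ^+ k.+1 * rho * ck k.+1) = D ^+ k.+1 * rho * (I * ck k.+1) by ring.
    by rewrite -kmom_s exprS; ring.
  rewrite [sk 0%N]sE c0 => E; rewrite /Lam mulrDl mul1r.
  have -> : y + I * D * y = (y - rho * (I * c) + I * D * y) + rho * (I * c) by ring.
  by rewrite E; ring.
have E2 : Lam * x = rho * I - kscal m * (I * y).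
  have a1 := ksumsD x1 (ksumsM T0 (I * D) hx).
  have a2 := ksumsM T0 (- kscal m * I) y1.
  have : x - rho * ck 0%N + I * D * x = - kscal m * I * (y - rho * sk 0%N).
    apply: ksums_uniq a1 _; apply: eq_ksums a2 => k.
    have -> : - kscal m * I * (D ^+ k.+1 * rho * sk k.+1) =
      D ^+ k.+1 * rho * (- kscal m * (I * sk k.+1)) by ring.
    by rewrite -kmom_c exprS; ring.
  rewrite c0 s0 => E; rewrite /Lam mulrDl mul1r.
  have -> : x + I * D * x = (x - rho * c + I * D * x) + rho * c by ring.
  by rewrite E /c; ring.
have root' : (1 - I * Md) * Lam ^+ 2 = 1 by [].
have Ey : y = (1 - I * Md) * (I * (Lam * x)).
  rewrite -[LHS]mul1r -{1}root'.
  have -> : (1 - I * Md) * Lam ^+ 2 * y = (1 - I * Md) * (Lam * (Lam * y)) by ring.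
  by rewrite E1; ring.
rewrite {1}Ey E2 /rho.
have -> : (1 - I * Md) * (I * (I * (Lam ^+ 2 * sigd) * I - kscal m * (I * y))) =
  I * (I * (I * ((1 - I * Md) * Lam ^+ 2 * sigd) - kscal m * ((1 - I * Md) * y))) by ring.
by rewrite root' [1 * sigd]mul1r.
Qed.

End Fixed.

Lemma memory_kern_uniq (Md y : kern) (m : R) : kdelta y = 0 ->
  y = - (I * (I * (kscal m * ((1 - I * Md) * y)))) -> y = 0.
Proof.
move=> dy E; apply: (@knilpotent R T T0 (- (kscal m * (I * (1 - I * Md)))) y dy).
by rewrite {1}E; ring.
Qed.

End Transmutation.

(** * Weak derivatives *)

Section Weak.
Context {R : realType}.
Local Notation mu := (@lebesgue_measure R).
Implicit Types (f g phi psi : R -> R) (T : R).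

Lemma aeS (P Q : R -> Prop) : (forall x, P x -> Q x) ->
  {ae mu, forall x, P x} -> {ae mu, forall x, Q x}.
Proof. move=> PQ; exact: (@filterS _ _ (ae_filter_ringOfSetsType mu)). Qed.

Lemma aeI (P Q : R -> Prop) : {ae mu, forall x, P x} -> {ae mu, forall x, Q x} ->
  {ae mu, forall x, P x /\ Q x}.
Proof. exact: (@filterI _ _ (ae_filter_ringOfSetsType mu)). Qed.

Lemma ae_eq_Rintegral (D : set R) f g : measurable D ->
  measurable_fun D f -> measurable_fun D g ->
  {ae mu, forall x, D x -> f x = g x} ->
  \int[mu]_(x in D) f x = \int[mu]_(x in D) g x.
Proof.
move=> mD mf mg fg; rewrite /Rintegral; congr fine.
apply: ae_eq_integral => //; try exact/measurable_EFinP.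
by apply: aeS fg => x h Dx; rewrite h.
Qed.

Lemma ae_not_in (N : set R) : measurable N -> mu N = 0%E -> {ae mu, forall x, ~ N x}.
Proof. by move=> mN N0; exists N; split=> // x /= /contrapT. Qed.

Lemma ae_neq (a : R) : {ae mu, forall x, x <> a}.
Proof. exact: (ae_not_in (measurable_set1 a) (lebesgue_measure_set1 a)). Qed.

Lemma measurable_reflect t : measurable_fun setT (fun s : R => t - s).
Proof. by apply: measurable_funB => //; exact: measurable_cst. Qed.

Lemma lebesgue_reflect t (A : set R) : measurable A ->
  mu ((fun s : R => t - s) @^-1` A) = mu A.
Proof.
move=> mA; have mt := @measurable_reflect t.
pose nu := pushforward mu (fun s : measurableTypeR R => t - s : measurableTypeR R).
rewrite [RHS](@lebesgue_measure_unique R nu)//.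
move=> X [[a b] _ <-] /=; rewrite /nu /pushforward.
have -> : (fun s : R => t - s) @^-1` `]a, b]%classic = `[t - b, t - a[%classic.
  by apply/seteqP; split=> s /=; rewrite !in_itv /= => /andP[h1 h2]; apply/andP; split; lra.
rewrite !lebesgue_measure_itv /= !lte_fin.
have -> : (t - b < t - a) = (a < b) by apply/idP/idP; lra.
by case: ifP => // _; rewrite -!EFinB; congr EFin; lra.
Qed.

(** A function known almost everywhere may be replaced by a representative also when evaluated at
    [t - s], as happens to [M] in the memory integral. *)
Lemma ae_reflect t (P : R -> Prop) : {ae mu, forall s, P s} -> {ae mu, forall s, P (t - s)}.
Proof.
move=> [N [mN N0 hN]]; exists ((fun s : R => t - s) @^-1` N); split.
- by rewrite -[X in measurable X]setTI; exact: (@measurable_reflect t).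
- by rewrite lebesgue_reflect.
- by move=> s /= h; apply: hN.
Qed.

Lemma sq_integrable T f : measurable_fun `[0, T] f ->
  (\int[mu]_(t in `[0%R, T]) (f t ^+ 2)%:E < +oo)%E ->
  mu.-integrable `[0, T] (EFin \o (fun t => f t ^+ 2)) /\ mu.-integrable `[0, T] (EFin \o f).
Proof.
move=> mf f2; have mf2 : measurable_fun `[0, T] (fun t => f t ^+ 2).
  exact: measurable_funX.
have i2 : mu.-integrable `[0, T] (EFin \o (fun t => f t ^+ 2)).
  apply/integrableP; split; first exact/measurable_EFinP.
  under eq_integral => x _ do rewrite /= ger0_norm ?sqr_ge0//.
  exact: f2.
split=> //; have i1 : mu.-integrable `[0, T] (EFin \o (fun t => 1 + f t ^+ 2)).
  by apply: integrable_add => //; apply: continuous_itv_integrable; exact: cst_continuous.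
apply: (@le_integrable _ _ _ mu _ _ _ (EFin \o (fun t => 1 + f t ^+ 2))) => //.
  exact/measurable_EFinP.
move=> t _ /=; rewrite lee_fin [leRHS]ger0_norm ?addr_ge0 ?sqr_ge0//.
have := sqr_ge0 (`|f t| - 1); rewrite sqrrB -[f t ^+ 2]real_normK ?num_real//.
have := normr_ge0 (f t); lra.
Qed.

Lemma simple_vfun_measurable (s : R -> R) : simple_vfun (s : R -> R^o) -> measurable_fun setT s.
Proof.
move=> [n [E [c [mE ->]]]]; apply: measurable_sum => i.
apply: measurable_funM; last exact: measurable_cst.
exact: measurable_indic.
Qed.

Lemma strongly_measurable_real (D : set R) f : measurable D ->
  strongly_measurable D (f : R -> R^o) -> measurable_fun D f.
Proof.
move=> mD [s [ss sf]]; apply: (measurable_fun_cvg (h := s)) => //.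
by move=> k; apply: measurable_funTS; exact: simple_vfun_measurable.
Qed.

Lemma L2_real_integrable T f : L2 T (f : R -> R^o) -> mu.-integrable `[0, T] (EFin \o f).
Proof.
move=> [sf f2]; apply: (sq_integrable _ _).2.
  exact: strongly_measurable_real.
by under eq_integral => x _ do rewrite -[f x ^+ 2]real_normK ?num_real//.
Qed.

Lemma test_function_continuous T phi : test_function T phi ->
  continuous phi /\ continuous (derive1 phi).
Proof.
move=> [dphi cphi _]; split=> // t; apply: differentiable_continuous.
exact/derivable1_diffP.
Qed.

Lemma test_function_ftc T phi s : test_function T phi -> 0 <= s <= T ->
  \int[mu]_(t in `[s, T]) derive1 phi t = - phi s.
Proof.
move=> tphi sT; have [cp cp'] := test_function_continuous tphi.
case: tphi => dphi _ [a [b [a0 bT h0]]].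
have hd t : 0 <= t <= T -> has_deriv T phi t (derive1 phi t).
  move=> _; apply: is_derive_has_deriv; exact: derive1_is_derive.
have TT : 0 <= T <= T by case/andP: sT => s0 sT; rewrite lexx (le_trans s0 sT).
have E1 := ftc_segment cp' hd TT; have E2 := ftc_segment cp' hd sT.
have pT : phi T = 0.
  by apply: h0; rewrite in_itv /= negb_and -!ltNge bT orbT.
case/andP: sT => s0 sT; have E3 := Rintegral_split (continuous_itv_integrable 0 T cp') s0 sT.
move: E1 E2; rewrite E3 pT; lra.
Qed.

(** Fubini on the triangle, the inner integral of [derive1 phi] over [[s, T]] being [- phi s]. *)
Lemma primitive_weak T f phi : mu.-integrable `[0, T] (EFin \o f) -> test_function T phi ->
  \int[mu]_(t in `[0, T]) ((\int[mu]_(s in `[0, t]) f s) * derive1 phi t) =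
  - \int[mu]_(t in `[0, T]) (f t * phi t).
Proof.
move=> fi tphi; have [cp cp'] := test_function_continuous tphi.
have := fubini_triangle cp' (@cst_continuous _ _ (1 : R)) fi.
under [in LHS]eq_Rintegral => x _ do under eq_Rintegral => s _ do rewrite mul1r.
under [in LHS]eq_Rintegral => x _ do rewrite mulrC.
move=> ->; rewrite -mulN1r -RintegralZl//; last first.
  have [C C0 hC] := continuous_bounded 0 T cp.
  rewrite (_ : (fun t => _) = (fun t => phi t * f t)); last by apply/funext => t; rewrite mulrC.
  apply: (integrable_mul_bounded (C := C)) => //.
  exact: continuous_measurable.
apply: eq_Rintegral => s; rewrite inE /= in_itv /= => sT.
under eq_Rintegral do rewrite mulr1.
by rewrite (test_function_ftc tphi sT); ring.
Qed.

(** The zero mean makes the primitive of [psi] vanish beyond [b] as it does before [a], so the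
    primitive is a test function. *)
Lemma bump_test T psi a b : continuous psi -> 0 < a -> a <= b -> b < T ->
  (forall t, t \notin `[a, b] -> psi t = 0) ->
  \int[mu]_(t in `[0, T]) psi t = 0 ->
  exists2 phi, test_function T phi & derive1 phi = psi.
Proof.
move=> cpsi a0 ab bT h0 int0.
have psi0 t : t < a -> psi t = 0.
  by move=> ta; apply: h0; rewrite in_itv /= negb_and -ltNge ta.
have psib t : b < t -> psi t = 0.
  by move=> ta; apply: h0; rewrite in_itv /= negb_and -!ltNge ta orbT.
have ipsi : mu.-integrable setT (EFin \o psi).
  have -> : psi = psi \_ `[a, b].
    apply/funext => t; rewrite /patch mem_setE; case: ifPn => // /h0 ->//.
  by apply: integrable_patch => //; exact: continuous_itv_integrable.
pose phi t := \int[mu]_(s in [set` `]-oo, t]]) psi s.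
have iNy t : mu.-integrable [set` `]-oo, t]] (EFin \o psi).
  by apply: integrableS ipsi.
have dphi t : derivable phi t 1 /\ derive1 phi t = psi t.
  have := @continuous_FTC1 R psi -oo%O t (t + 1).
  by rewrite ltrDl ltr01 => /(_ isT (iNy _) (ltNyr _) (cpsi t)).
have E : derive1 phi = psi by apply/funext => t; case: (dphi t).
exists phi => //; split; first by move=> t; case: (dphi t).
  by rewrite E.
exists a, b; split=> // t; rewrite in_itv /= negb_and -!ltNge => /orP[ta|bt].
  rewrite /phi (_ : (fun s => _) = psi)// (@eq_Rintegral _ _ _ mu _ (cst 0)); last first.
    by move=> s; rewrite inE /= in_itv /= => st; apply: psi0; exact: le_lt_trans ta.
  by rewrite /Rintegral integral0.
rewrite -int0 /phi Rintegral_mkcond [RHS]Rintegral_mkcond; apply: eq_Rintegral => s _.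
rewrite /patch !mem_setE !in_itv /=.
have [sa|sa] := ltP s a; first by rewrite psi0// !if_same.
have [bs|bs] := ltP b s; first by rewrite psib// !if_same.
by rewrite (le_trans bs (ltW bt)) (le_trans (ltW a0) sa) (le_trans bs (ltW bT)).
Qed.

(** A continuous approximation of the indicator of [[x, y]] from inside, with slopes [n] and [- n]:
    its support never leaves [[x, y]]. *)
Definition trapezoid (x y : R) (n : nat) (t : R) : R :=
  Num.max 0 (Num.min 1 (Num.min (n%:R * (t - x)) (n%:R * (y - t)))).

Lemma continuous_minmax (f g : R -> R) : continuous f -> continuous g ->
  continuous (fun t => Num.min (f t) (g t)) /\ continuous (fun t => Num.max (f t) (g t)).
Proof.
move=> cf cg.
have e1 : (fun t => Num.min (f t) (g t)) = (fun t => (f t + g t - `|f t - g t|) / 2).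
  by apply/funext => t; rewrite minr_absE.
have e2 : (fun t => Num.max (f t) (g t)) = (fun t => (f t + g t + `|f t - g t|) / 2).
  by apply/funext => t; rewrite maxr_absE.
have cn t : `|f s - g s| @[s --> t] --> `|f t - g t|.
  by apply: cvg_norm; apply: cvgB; [exact: cf|exact: cg].
split; [rewrite e1|rewrite e2] => t; (apply: cvgM; last exact: cvg_cst).
  by apply: cvgB; [apply: cvgD; [exact: cf|exact: cg]|exact: cn].
by apply: cvgD; [apply: cvgD; [exact: cf|exact: cg]|exact: cn].
Qed.

Lemma trapezoid_continuous x y n : continuous (trapezoid x y n).
Proof.
have c0 (c : R) : continuous (fun _ : R => c) by exact: cst_continuous.
have c1 : continuous (fun t : R => n%:R * (t - x)).
  by move=> t; apply: cvgM; [exact: cvg_cst|apply: cvgB; [exact: cvg_id|exact: cvg_cst]].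
have c2 : continuous (fun t : R => n%:R * (y - t)).
  by move=> t; apply: cvgM; [exact: cvg_cst|apply: cvgB; [exact: cvg_cst|exact: cvg_id]].
have c3 := (continuous_minmax c1 c2).1.
have c4 := (continuous_minmax (c0 1) c3).1.
exact: (continuous_minmax (c0 0) c4).2.
Qed.

Lemma trapezoid_itv x y n t : 0 <= trapezoid x y n t <= 1.
Proof. by rewrite /trapezoid le_max lexx /= ge_max ler01 ge_min lexx. Qed.

Lemma trapezoid_out x y n t : t \notin `[x, y] -> trapezoid x y n t = 0.
Proof.
rewrite in_itv /= negb_and -!ltNge /trapezoid => h; apply: max_l.
rewrite ge_min; apply/orP; right; rewrite ge_min.
case/orP: h => h; [apply/orP; left|apply/orP; right].
  by rewrite mulr_ge0_le0// subr_le0 ltW.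
by rewrite mulr_ge0_le0// subr_le0 ltW.
Qed.

Lemma trapezoid_cvg x y t : x < t < y -> trapezoid x y n t @[n --> \oo] --> (1 : R).
Proof.
move=> /andP[xt ty]; apply: cvg_near_cst.
pose d := Num.min (t - x) (y - t); have d0 : 0 < d by rewrite lt_min !subr_gt0 xt.
exists (Num.truncn d^-1).+1 => // n /= hn.
have nd : 1 <= n%:R * d.
  rewrite -ler_pdivrMr// mul1r ltW//; apply: lt_le_trans (truncnS_gt _) _.
  by rewrite ler_nat.
have n1 : 1 <= n%:R * (t - x).
  by apply: le_trans nd _; rewrite ler_wpM2l// /d ge_min lexx.
have n2 : 1 <= n%:R * (y - t).
  by apply: le_trans nd _; rewrite ler_wpM2l// /d ge_min lexx orbT.
by rewrite /trapezoid min_l ?le_min ?n1// max_r.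
Qed.

Lemma trapezoid_integral T x y (f : R -> R) : 0 < x -> x < y -> y < T ->
  mu.-integrable `[0, T] (EFin \o f) ->
  \int[mu]_(t in `[0, T]) (trapezoid x y n t * f t) @[n --> \oo] -->
  \int[mu]_(t in `[x, y]) f t.
Proof.
move=> x0 xy yT fi; have mT : measurable (`[0, T]%classic : set R) by [].
have mf := integrable_measurable fi.
have -> : \int[mu]_(t in `[x, y]) f t = \int[mu]_(t in `[0, T]) (\1_`[x, y] t * f t).
  rewrite Rintegral_mkcond [RHS]Rintegral_mkcond; apply: eq_Rintegral => t _.
  rewrite /patch indicE !mem_setE !in_itv /=; case: ifP => [/andP[xt ty]|].
    by rewrite (le_trans (ltW x0) xt) (le_trans ty (ltW yT)) mul1r.
  by rewrite mul0r if_same.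
pose f_ n t := (trapezoid x y n t * f t)%:E.
have mf_ n : measurable_fun `[0, T] (f_ n).
  apply/measurable_EFinP; apply: measurable_funM => //.
  by apply: continuous_measurable; exact: trapezoid_continuous.
have mg : measurable_fun `[0, T] (fun t => (\1_`[x, y] t * f t)%:E).
  by apply/measurable_EFinP; apply: measurable_funM => //; exact: measurable_indic.
have [|||_ _ h] := @dominated_convergence _ _ R mu `[0, T]%classic mT f_
  (fun t => (\1_`[x, y] t * f t)%:E) (EFin \o (fun t => `|f t|)) mf_ mg.
- apply: aeS (aeI (ae_neq x) (ae_neq y)) => t [tx ty] _; apply/cvg_EFin; first by exists 0%N.
  rewrite /comp /f_ /=; apply: cvgM; last exact: cvg_cst.
  rewrite indicE mem_setE in_itv /=; case: (boolP (x <= t <= y)) => [/andP[xt yt]|h].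
    apply: trapezoid_cvg; rewrite !lt_neqAle xt yt !andbT eq_sym.
    by apply/andP; split; apply/eqP.
  rewrite (_ : (fun n => _) = cst 0); first exact: cvg_cst.
  by apply/funext => n; apply: trapezoid_out; rewrite in_itv.
- exact: integrable_norm.
- apply: aeW => t n _; rewrite /f_ lee_fin normrM -[leRHS]mul1r ler_wpM2r//.
  by have /andP[h0 h1] := trapezoid_itv x y n t; rewrite ger0_norm.
have ig : mu.-integrable `[0, T] (EFin \o (fun t => \1_`[x, y] t * f t)).
  have := @integrable_mul_bounded R `[0, T]%classic 1 (\1_`[x, y] : R -> R) f mT _ _ fi.
  apply; first exact: measurable_indic.
  by move=> t _; rewrite indicE; case: (_ \in _); rewrite ?normr1 ?normr0.
apply: fine_cvg; rewrite (EFin_Rintegral mT ig); exact: h.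
Qed.

(** A combination of two trapezoids with zero mean is the derivative of a test function. In the
    limit this says that [f] has the same average over all intervals inside [(0, T)], and Lebesgue
    differentiation identifies [f] with that average almost everywhere. *)
Lemma du_bois_reymond T f : 0 < T -> mu.-integrable `[0, T] (EFin \o f) ->
  (forall phi, test_function T phi ->
     \int[mu]_(t in `[0, T]) (f t * derive1 phi t) = 0) ->
  exists c, {ae mu, forall t, t \in `[0, T] -> f t = c}.
Proof.
move=> T0 fi h0; have mT : measurable (`[0, T]%classic : set R) by [].
have i1 (g : R -> R) x y n : mu.-integrable `[0, T] (EFin \o g) ->
    mu.-integrable `[0, T] (EFin \o (fun t => trapezoid x y n t * g t)).
  move=> gi; apply: (integrable_mul_bounded (C := 1)) => //.
    apply: continuous_measurable; exact: trapezoid_continuous.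
  by move=> t _; have /andP[? ?] := trapezoid_itv x y n t; rewrite ger0_norm.
have ic (c : R) : mu.-integrable `[0, T] (EFin \o (fun=> c)).
  by apply: continuous_itv_integrable; exact: cst_continuous.
have key x y x' y' : 0 < x -> x < y -> y < T -> 0 < x' -> x' < y' -> y' < T ->
    (y' - x') * \int[mu]_(t in `[x, y]) f t = (y - x) * \int[mu]_(t in `[x', y']) f t.
  move=> x0 xy yT x'0 x'y' y'T.
  pose tau := trapezoid x y; pose tau' := trapezoid x' y'.
  pose I n := \int[mu]_(t in `[0, T]) (tau n t * 1).
  pose I' n := \int[mu]_(t in `[0, T]) (tau' n t * 1).
  pose J n := \int[mu]_(t in `[0, T]) (tau n t * f t).
  pose J' n := \int[mu]_(t in `[0, T]) (tau' n t * f t).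
  have eqn n : I' n * J n - I n * J' n = 0.
    pose psi t := I' n * tau n t - I n * tau' n t.
    have cpsi : continuous psi.
      move=> t; apply: cvgB; (apply: cvgM; first exact: cvg_cst); exact: trapezoid_continuous.
    have [|||||phi tphi phiE] := @bump_test T psi (Num.min x x') (Num.max y y') cpsi.
    - by rewrite lt_min x0.
    - by rewrite le_max ge_min ltW.
    - by rewrite gt_max yT.
    - move=> t ht; rewrite /psi /tau /tau' !trapezoid_out ?mulr0 ?subrr//.
        apply: contra ht; rewrite !in_itv /= => /andP[h1 h2].
        by rewrite ge_min h1 orbT le_max h2 orbT.
      apply: contra ht; rewrite !in_itv /= => /andP[h1 h2].
      by rewrite ge_min h1 le_max h2.
    - have i3 x1 y1 : mu.-integrable `[0, T] (EFin \o trapezoid x1 y1 n).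
        by apply: continuous_itv_integrable; exact: trapezoid_continuous.
      rewrite /psi RintegralB//.
      - have i3' := i3 x y; have i3'' := i3 x' y'.
        rewrite RintegralZl// RintegralZl// /I /I' /tau /tau'.
        under [X in _ * X - _]eq_Rintegral do rewrite -[trapezoid _ _ _ _]mulr1.
        under [X in _ - _ * X]eq_Rintegral do rewrite -[trapezoid _ _ _ _]mulr1.
        by rewrite mulrC subrr.
      - exact: (integrable_scale (I' n) mT (i3 x y)).
      - exact: (integrable_scale (I n) mT (i3 x' y')).
    have := h0 _ tphi; rewrite phiE /psi => <-.
    rewrite /J /J' -RintegralZl//; last exact: i1.
    rewrite -RintegralZl//; last exact: i1.
    rewrite -RintegralB//.
    - by apply: eq_Rintegral => t _; rewrite /tau /tau'; ring.
    - exact: (integrable_scale (I' n) mT (i1 f x y n fi)).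
    - exact: (integrable_scale (I n) mT (i1 f x' y' n fi)).
  have cint u v : 0 < u -> u < v -> v < T ->
      \int[mu]_(t in `[0, T]) (trapezoid u v n t * 1) @[n --> \oo] --> v - u.
    move=> u0 uv vT; have := @trapezoid_integral T u v (fun=> 1) u0 uv vT (ic 1).
    have := @Rintegral_shift R (fun=> 1) u v (@cst_continuous _ _ _) (ltW u0) (ltW uv).
    by move=> ->; rewrite Rintegral_cst_itv ?mulr1// subr_ge0 ltW.
  have c1 : I n @[n --> \oo] --> y - x by exact: cint.
  have c1' : I' n @[n --> \oo] --> y' - x' by exact: cint.
  have c2 : J n @[n --> \oo] --> \int[mu]_(t in `[x, y]) f t by exact: trapezoid_integral.
  have c2' : J' n @[n --> \oo] --> \int[mu]_(t in `[x', y']) f t by exact: trapezoid_integral.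
  have h : (fun n => I' n * J n - I n * J' n) @ \oo -->
      (y' - x') * \int[mu]_(t in `[x, y]) f t - (y - x) * \int[mu]_(t in `[x', y']) f t.
    by apply: cvgB; apply: cvgM.
  move: h; under eq_fun do rewrite eqn.
  move=> h; apply/eqP; rewrite -subr_eq0; apply/eqP.
  exact: (cvg_unique (@Rhausdorff R) h (cvg_cst _)).
(* The common average, read on an arbitrary reference interval, whose length is [T / 4]. *)
pose c := (\int[mu]_(t in `[T / 4, T / 2]) f t) / (T / 4).
have lin x y : 0 < x -> x < y -> y < T -> \int[mu]_(t in `[x, y]) f t = c * (y - x).
  move=> x0 xy yT; have h1 : 0 < T / 4 by lra.
  have h2 : T / 4 < T / 2 by lra.
  have h3 : T / 2 < T by lra.
  have := key _ _ _ _ x0 xy yT h1 h2 h3.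
  have -> : T / 2 - T / 4 = T / 4 by field.
  by move=> E; rewrite /c mulrAC [_ * (y - x)]mulrC -E mulrAC divff ?mul1r// gt_eqF.
exists c; pose f0 := f \_ `[0, T].
have if0 : mu.-integrable setT (EFin \o f0) by exact: integrable_patch.
pose F (x : R) := \int[mu]_(t in `[0, x]) f0 t.
have if1 y : mu.-integrable [set` Interval (BLeft 0) (BRight y)] (EFin \o f0).
  exact: integrableS if0.
(* At almost every [t] the primitive of [f0] has derivative [f0 t], while [lin] gives its increments
   slope [c]. Increments to the right of [t] suffice, and the points [s] chosen below remain under
   [T]. *)
have h1 := @FTC1 R f0 (BLeft 0) if1 (open_integrable_locally openT if0).
 apply: aeS (aeI h1 (aeI (ae_neq 0) (ae_neq T))) => t /= [h2 [t0 tT]].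
rewrite in_itv /= => /andP[t0' tT'].
have tp : 0 < t by rewrite lt_neqAle t0' andbT eq_sym; apply/eqP.
have tl : t < T by rewrite lt_neqAle tT' andbT; apply/eqP.
have [|dF F'] := h2; first by rewrite lte_fin.
have /is_deriveP dd := derive1_is_derive dF F'.
have -> : f t = f0 t by rewrite /f0 /patch mem_setE in_itv /= t0' tT'.
apply/eqP; rewrite -subr_eq0 -normr_eq0 eq_le normr_ge0 andbT.
apply/ler_addgt0Pr => e e0; rewrite add0r.
have [d d0 hd] := dd e e0.
pose s := t + Num.min (d / 2) ((T - t) / 2).
have m0 : 0 < Num.min (d / 2) ((T - t) / 2) by rewrite lt_min; apply/andP; split; lra.
have m1 : Num.min (d / 2) ((T - t) / 2) <= d / 2 by rewrite ge_min lexx.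
have m2 : Num.min (d / 2) ((T - t) / 2) <= (T - t) / 2 by rewrite ge_min lexx orbT.
have ts : t < s by rewrite /s ltrDl.
have sT : s < T by rewrite /s; lra.
have sd : `|t - s| < d by rewrite distrC ger0_norm /s; lra.
have st : s != t by rewrite gt_eqF.
have := hd s st sd.
have E1 : \int[mu]_(x in `[0, s]) f0 x - \int[mu]_(x in `[0, t]) f0 x = c * (s - t).
  rewrite (Rintegral_split (x := t) _ t0' (ltW ts)); last by apply: integrableS if0.
  rewrite addrAC subrr add0r -(lin _ _ tp ts sT); apply: eq_Rintegral => x.
  rewrite inE /= in_itv /= => /andP[x1 x2].
  by rewrite /f0 /patch mem_setE in_itv /= (le_trans t0' x1) (le_trans x2 (ltW sT)).
by rewrite E1 mulfK ?subr_eq0// => /ltW.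
Qed.

Lemma primitive_continuous f : (forall b, mu.-integrable `[0, b] (EFin \o f)) ->
  continuous (fun t : R => \int[mu]_(s in `[0, t]) f s).
Proof.
move=> fi; have := @continuous_volterra R (fun _ _ => 1) 1 _ _ _ f fi.
rewrite (_ : (fun t : R => \int[mu]_(s in `[0, t]) (1 * f s)) =
  (fun t : R => \int[mu]_(s in `[0, t]) f s)); last first.
  by apply/funext => t; apply: eq_Rintegral => s _; rewrite mul1r.
apply=> [s|t|t s]; [exact: cst_continuous|exact: cst_continuous|by rewrite normr1].
Qed.

Lemma integrable_patch_itv T f b : mu.-integrable `[0, T] (EFin \o f) ->
  mu.-integrable `[0, b] (EFin \o (f \_ `[0, T])).
Proof.
move=> fi; have h : mu.-integrable setT (EFin \o (f \_ `[0, T])) by exact: integrable_patch.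
exact: integrableS h.
Qed.

Lemma Rintegral_patch_itv T f t : t <= T ->
  \int[mu]_(s in `[0, t]) (f \_ `[0, T]) s = \int[mu]_(s in `[0, t]) f s.
Proof.
move=> tT; apply: eq_Rintegral => s; rewrite inE /= in_itv /= => /andP[s0 st].
by rewrite /patch mem_setE in_itv /= s0 (le_trans st tT).
Qed.

(** By [primitive_weak], [f] minus the primitive of [g] has zero weak derivative, so du Bois-Reymond
    applies. *)
Lemma weak_derivative_primitive T f g : 0 < T ->
  mu.-integrable `[0, T] (EFin \o f) -> mu.-integrable `[0, T] (EFin \o g) ->
  weak_derivative T f g ->
  exists c, {ae mu, forall t, t \in `[0, T] -> f t = c + \int[mu]_(s in `[0, t]) g s}.
Proof.
move=> T0 fi gi wd; pose P t := \int[mu]_(s in `[0, t]) (g \_ `[0, T]) s.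
have cP : continuous P.
  by apply: primitive_continuous => b; exact: integrable_patch_itv.
have iP : mu.-integrable `[0, T] (EFin \o P) by exact: continuous_itv_integrable.
have PE t : t \in `[0, T] -> P t = \int[mu]_(s in `[0, t]) g s.
  by rewrite in_itv /= => /andP[t0 tT]; exact: Rintegral_patch_itv.
have [|phi tphi|c hc] := @du_bois_reymond T (fun t => f t - P t) T0.
- exact: integrable_sub.
- have [cp cp'] := test_function_continuous tphi.
  have ib (h : R -> R) : mu.-integrable `[0, T] (EFin \o h) ->
     mu.-integrable `[0, T] (EFin \o (fun t => h t * derive1 phi t)).
    move=> hi; have [C C0 hC] := continuous_bounded 0 T cp'.
    rewrite (_ : (fun t => _) = (fun t => derive1 phi t * h t)); last by apply/funext => t; rewrite mulrC.
    apply: (integrable_mul_bounded (C := C)) => //.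
    exact: continuous_measurable.
  under eq_Rintegral do rewrite mulrBl.
  rewrite RintegralB//; try exact: ib.
  rewrite (wd _ tphi).
  have -> : \int[mu]_(t in `[0, T]) (P t * derive1 phi t) =
     \int[mu]_(t in `[0, T]) ((\int[mu]_(s in `[0, t]) g s) * derive1 phi t).
    by apply: eq_Rintegral => t; rewrite inE /= => tT; rewrite PE.
  by rewrite (primitive_weak gi tphi) subrr.
exists c; apply: aeS hc => t h tT.
by have := h tT; rewrite -PE// => <-; rewrite subrK.
Qed.

Lemma ae_trans_primitive T g h c :
  mu.-integrable `[0, T] (EFin \o g) -> continuous h ->
  {ae mu, forall t, t \in `[0, T] -> g t = h t} ->
  forall t, 0 <= t <= T -> c + \int[mu]_(s in `[0, t]) g s = c + \int[mu]_(s in `[0, t]) h s.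
Proof.
move=> gi ch gh t /andP[t0 tT]; congr (_ + _); apply: ae_eq_Rintegral => //.
- apply: (@measurable_funS _ _ _ _ `[0, T]) => //.
    by move=> s /=; rewrite !in_itv /= => /andP[-> st]; exact: le_trans st tT.
  exact: integrable_measurable.
- exact: continuous_measurable.
- apply: aeS gh => s hs; rewrite /= in_itv /= => /andP[s0 st].
  by apply: hs; rewrite in_itv /= s0 (le_trans st tT).
Qed.

(** An integrable second derivative gives the first one a continuous representative [m1], as the
    ring demands; the integration constant [c] of [M] becomes the delta part of [Md]. *)
Lemma H2_kern T M : 0 < T -> in_H2 T M -> exists Md : kern T,
  {ae mu, forall t, t \in `[0, T] -> M t = kfun (kint * Md) t}.
Proof.
move=> T0 [M1 [M2 [lM lM1 lM2 w1 w2]]].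
have iM := L2_real_integrable lM; have iM1 := L2_real_integrable lM1.
have iM2 := L2_real_integrable lM2.
have [c1 h1] := weak_derivative_primitive T0 iM1 iM2 w2.
have [c hM] := weak_derivative_primitive T0 iM iM1 w1.
pose m1 t := c1 + \int[mu]_(s in `[0, t]) (M2 \_ `[0, T]) s.
have cm1 : continuous m1.
  move=> t; apply: cvgD; first exact: cvg_cst.
  by apply: primitive_continuous => b; exact: integrable_patch_itv.
have h2 : {ae mu, forall t, t \in `[0, T] -> M1 t = m1 t}.
  apply: aeS h1 => t h tT; rewrite h// /m1; congr (_ + _).
  by rewrite Rintegral_patch_itv//; move: tT; rewrite in_itv => /andP[].
clearbody m1; exists (kext c cm1); apply: aeS hM => t h tT; rewrite h//.
have tT' : 0 <= t <= T by move: tT; rewrite in_itv.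
rewrite (ae_trans_primitive c iM1 cm1 h2 tT').
rewrite (@kintM_fun R T (kext c cm1) t (clamp_id tT')).
rewrite [kdelta _]/=; congr GRing.add; apply: eq_Rintegral => s.
rewrite inE /= in_itv /= => /andP[s0 st].
by rewrite /= clamp_id// s0 (le_trans st)//; case/andP: tT'.
Qed.

(** [sd] is the distributional derivative of [sigma] extended by zero to negative times:
    [sigma(0) delta] plus the classical derivative. *)
Lemma C1_kern T sigma : 0 < T -> in_C1 T sigma -> exists sd : kern T,
  kdelta sd = sigma 0 /\ forall t, 0 <= t <= T -> sigma t = kfun (kint * sd) t.
Proof.
move=> T0 [s' cs' hs']; have cs := continuous_comp_clamp (ltW T0) cs'.
exists (kext (sigma 0) cs); split=> // t tT; rewrite kintM_fun ?clamp_id//.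
have hd x : 0 <= x <= T -> has_deriv T sigma x ((s' \o clamp T) x).
  by move=> xT; rewrite /= clamp_id//; apply: hs'; rewrite in_itv.
rewrite (ftc_segment cs hd tT); congr (_ + _); apply: eq_Rintegral => s _.
by rewrite /= clampK.
Qed.

End Weak.

(** * Scalar initial value problems *)

Arguments kfun {R T} _ _ : simpl never.
Arguments kdelta {R T} _ : simpl never.

Section ScalarIVP.
Context {R : realType} {T : R}.
Hypothesis T0 : 0 < T.
Local Notation mu := (@lebesgue_measure R).
Local Notation kern := (kern T).
Local Notation I := (@kint R T).

Lemma kint_has_deriv (F : kern) t : 0 <= t <= T ->
  has_deriv T (kfun (I * F)) t (kfun F t).
Proof.
move=> tT; have := primitive_has_deriv (kdelta F) (@kfun_continuous _ _ F) tT.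
by apply: eq_has_deriv => // s sT; rewrite kintM_fun ?clamp_id.
Qed.

Lemma kint_at0 (F : kern) : kfun (I * F) 0 = kdelta F.
Proof.
by rewrite kintM_fun ?clamp_id ?lexx ?(ltW T0)// set_itv1 Rintegral_set1 addr0.
Qed.

(** A delta part under [I *] is the value at 0 after integration, so [kscal a] and [kscal b] carry
    the initial data. *)
Lemma kern_ivp (y F : kern) (Y Fn : R -> R) (a b : R) :
  y = I * (kscal a + I * (kscal b + F)) ->
  (forall t, 0 <= t <= T -> Y t = kfun y t) ->
  (forall t, 0 <= t <= T -> Fn t = kfun F t) -> kdelta F = 0 ->
  second_order_ivp T Y Fn a b.
Proof.
move=> yE Yy FF dF; have T00 : (0:R) <= 0 <= T by rewrite lexx ltW.
pose z := kscal a + I * (kscal b + F).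
exists (fun t => kfun z t); split.
- move=> t; rewrite in_itv /= => tT.
  apply: (@eq_has_deriv _ _ (kfun y)) => //; first by move=> s /Yy.
  by rewrite yE; exact: kint_has_deriv.
- move=> t; rewrite in_itv /= => tT; rewrite FF//.
  have E s : kfun z s = kfun (I * (kscal b + F)) s by rewrite kfunD /= add0r.
  have FE : kfun F t = kfun (kscal b + F) t by rewrite kfunD /= add0r.
  have h := @kint_has_deriv (kscal b + F) t tT; rewrite FE.
  have e s : 0 <= s <= T -> kfun (I * (kscal b + F)) s = kfun z s by rewrite E.
  exact: (eq_has_deriv tT e h).
- by rewrite Yy// yE kint_at0 kdeltaD kintM_delta addr0.
- by rewrite kfunD kint_at0 kdeltaD dF /= add0r addr0.
Qed.

Lemma ivp_kern (ky FF : kern) (Y Fn : R -> R) : second_order_ivp T Y Fn 0 0 ->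
  kdelta ky = 0 -> kdelta FF = 0 ->
  (forall t, 0 <= t <= T -> Y t = kfun ky t) ->
  (forall t, 0 <= t <= T -> Fn t = kfun FF t) -> ky = I * (I * FF).
Proof.
move=> [z [hY hz Y0 z0]] dk dF Yk FnF.
have zE t : 0 <= t <= T -> z t = kfun (I * FF) t.
  move=> tT; rewrite kintM_fun ?clamp_id// dF.
  have hd s : 0 <= s <= T -> has_deriv T z s (kfun FF s).
    by move=> sT; rewrite -FnF//; apply: hz; rewrite in_itv.
  by rewrite (ftc_segment (@kfun_continuous _ _ FF) hd tT) z0.
apply: kernE; first by rewrite dk kintM_delta.
move=> t ct t0; have tT := kclamp_itv T0 ct.
have hd s : 0 <= s <= T -> has_deriv T Y s (kfun (I * FF) s).
  by move=> sT; rewrite -zE//; apply: hY; rewrite in_itv.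
rewrite -Yk// kintM_fun// kintM_delta.
by rewrite (ftc_segment (@kfun_continuous _ _ (I * FF)) hd tT) Y0.
Qed.

Lemma ivp_kern_exists (Y Fn : R -> R) a b : second_order_ivp T Y Fn a b ->
  exists2 ky : kern, kdelta ky = 0 & forall t, 0 <= t <= T -> Y t = kfun ky t.
Proof.
move=> [z [hY _ _ _]].
have hd t : 0 <= t <= T -> has_deriv T Y t (z t).
  by move=> tT; apply: hY; rewrite in_itv.
have cY := continuous_comp_clamp (ltW T0) (has_deriv_continuous hd).
exists (kext 0 cY) => // t tT.
by rewrite /kfun /= !clamp_id// clamp_itv// ltW.
Qed.

Lemma memory_integral (M Y : R -> R) (Md y : kern) t :
  measurable_fun `[0, T] M ->
  {ae mu, forall t, t \in `[0, T] -> M t = kfun (I * Md) t} ->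
  kdelta y = 0 -> (forall s, 0 <= s <= T -> Y s = kfun y s) -> 0 <= t <= T ->
  \int[mu]_(s in `[0, t]) (M (t - s) * Y s) = kfun (I * Md * y) t.
Proof.
move=> mM hM dy Yy tT; have /andP[t0 tT'] := tT.
rewrite kfunM ?clamp_id// kintM_delta dy !mul0r !add0r /conv.
have sub s : 0 <= s <= t -> 0 <= t - s <= T by move=> /andP[? ?]; apply/andP; split; lra.
have subs s : 0 <= s <= t -> 0 <= s <= T by move=> /andP[? ?]; apply/andP; split; lra.
transitivity (\int[mu]_(s in `[0, t]) (M (t - s) * kfun y s)).
  by apply: eq_Rintegral => s; rewrite inE /= in_itv /= => /subs/Yy ->.
have my : measurable_fun `[0, t] (kfun y).
  by apply: continuous_measurable; exact: kfun_continuous.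
apply: ae_eq_Rintegral => //.
- apply: measurable_funM => //; apply: (@measurable_comp _ _ _ _ _ _ `[0, T]%classic) => //.
    by move=> _ [s /= + <-]; rewrite !in_itv /= => /sub.
  by apply: measurable_funTS; exact: measurable_reflect.
- apply: measurable_funM => //; apply: continuous_measurable; apply: continuous_subr; exact: kfun_continuous.
- apply: aeS (ae_reflect t hM) => s h; rewrite /= in_itv /= => st.
  by rewrite h// in_itv /=; exact: sub.
Qed.

(** The second derivative prescribed by the equation: [p sigma - m y + m M y], with products read as
    convolutions and [M = I Md]. *)
Definition memory_kern (Md sd : kern) (p m : R) (y : kern) :=
  kscal p * (I * sd) - kscal m * ((1 - I * Md) * y).

Lemma memory_kern_delta Md sd p m y : kdelta y = 0 -> kdelta (memory_kern Md sd p m y) = 0.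
Proof.
move=> dy; rewrite /memory_kern kdeltaD kdeltaN !kdeltaM kint_delta dy.
by rewrite !(mul0r, mulr0) subr0.
Qed.

Section Memory.
Variables (M sigma : R -> R) (Md sd : kern) (p m : R).
Hypothesis mM : measurable_fun `[0, T] M.
Hypothesis hM : {ae mu, forall t, t \in `[0, T] -> M t = kfun (I * Md) t}.
Hypothesis hs : forall t, 0 <= t <= T -> sigma t = kfun (I * sd) t.

Let rhs (Y : R -> R) t :=
  - m * Y t + m * (\int[mu]_(s in `[0, t]) (M (t - s) * Y s)) + sigma t * p.

Lemma memory_rhs (y : kern) (Y : R -> R) t : kdelta y = 0 ->
  (forall s, 0 <= s <= T -> Y s = kfun y s) -> 0 <= t <= T ->
  rhs Y t = kfun (memory_kern Md sd p m y) t.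
Proof.
move=> dy Yy tT; rewrite /rhs (memory_integral mM hM dy Yy tT) Yy// hs//.
rewrite /memory_kern mulrBl mul1r kfunB !kfun_scal kfunB; ring.
Qed.

Lemma memory_ivp_exists (y : kern) (Y : R -> R) : kdelta y = 0 ->
  y = I * (I * memory_kern Md sd p m y) ->
  (forall s, 0 <= s <= T -> Y s = kfun y s) -> second_order_ivp T Y (rhs Y) 0 0.
Proof.
move=> dy yE Yy; apply: (@kern_ivp y (memory_kern Md sd p m y)) => //.
- by rewrite !kscal0 !add0r.
- by move=> t tT; exact: memory_rhs.
- exact: memory_kern_delta.
Qed.

(** Any solution is continuous, hence an element of the ring; its difference with [y] solves the
    homogeneous Volterra equation, which [memory_kern_uniq] excludes unless it vanishes. *)
Lemma memory_ivp_unique (y : kern) (Y : R -> R) : kdelta y = 0 ->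
  y = I * (I * memory_kern Md sd p m y) ->
  second_order_ivp T Y (rhs Y) 0 0 -> forall t, 0 <= t <= T -> Y t = kfun y t.
Proof.
move=> dy yE ivp; have [x dx Yx] := ivp_kern_exists ivp.
have xE : x = I * (I * memory_kern Md sd p m x).
  apply: (ivp_kern ivp) => //; first exact: memory_kern_delta.
  by move=> t tT; exact: memory_rhs.
have xy : x - y = 0.
  apply: (@memory_kern_uniq _ _ T0 Md (x - y) m).
    by rewrite kdeltaD kdeltaN dx dy subrr.
  rewrite {1}xE {1}yE /memory_kern; ring.
by move=> t tT; rewrite Yx// (subr0_eq xy).
Qed.

End Memory.

Lemma has_derivM (f g : R -> R) t k l : has_deriv T f t k -> has_deriv T g t l ->
  has_deriv T (fun s => f s * g s) t (k * g t + f t * l).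
Proof.
move=> hf hg; have cg := has_deriv_cvg hg.
have cg' : g s @[s --> within `[0, T] t^'] --> g t.
  apply: cvg_trans cg => A h.
  exact: (@filterS _ (nbhs t) _ _ _ (fun s hs _ => hs) h).
rewrite /has_deriv (_ : (fun s => _) =
    (fun s => (f s - f t) / (s - t) * g s + f t * ((g s - g t) / (s - t)))); last first.
  by apply/funext => s; ring.
by apply: cvgD; [exact: cvgM|apply: cvgM; first exact: cvg_cst].
Qed.

(** Let [P] be the maximum of [phi t exp (- l t)]. Inserting [phi t <= P exp (l t)] in the
    hypothesis at the maximum point gives [P <= a + c P / l]. With [l = 2 c + 1], positive even for
    [c = 0], the last term is at most [P / 2]: hence the factor 2. *)
Lemma gronwall (phi : R -> R) (a c : R) : 0 <= a -> 0 <= c -> continuous phi ->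
  (forall t, 0 <= t <= T -> phi t <= a + c * \int[mu]_(s in `[0, t]) phi s) ->
  forall t, 0 <= t <= T -> phi t <= 2 * a * expR ((2 * c + 1) * T).
Proof.
move=> a0 c0 cphi hphi; set l := 2 * c + 1.
have l0 : 0 < l by rewrite /l; lra.
have ce k : continuous (fun t : R => expR (k * t)).
  by move=> t; apply: (@continuous_comp _ _ _ (fun t => k * t) expR);
    [apply: cvgM; [exact: cvg_cst|exact: cvg_id]|exact: continuous_expR].
have cpsi : continuous (fun t => phi t * expR (- l * t)).
  by move=> t; apply: cvgM; [exact: cphi|exact: ce].
have [t0 t0T hmax] := continuous_max_at (ltW T0) cpsi.
set P := phi t0 * expR (- l * t0) in hmax.
have hP t : 0 <= t <= T -> phi t <= P * expR (l * t).
  by move=> /hmax; rewrite mulNr expRN ler_pdivrMr ?expR_gt0.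
have P2 : P <= 2 * a.
  have [P0|P0] := leP P 0; first by apply: le_trans P0 _; rewrite mulr_ge0.
  have /andP[t00 t0T'] := t0T.
  have ie : mu.-integrable `[0, t0] (EFin \o (fun s => expR (l * s))).
    exact: continuous_itv_integrable.
  have h1 : \int[mu]_(s in `[0, t0]) phi s <= P * \int[mu]_(s in `[0, t0]) expR (l * s).
    rewrite -RintegralZl//; apply: le_Rintegral => //.
    - exact: continuous_itv_integrable.
    - exact: integrable_scale.
    - move=> s; rewrite /= in_itv /= => /andP[s0 st]; apply: hP.
      by rewrite s0 (le_trans st).
  have h2 : \int[mu]_(s in `[0, t0]) expR (l * s) <= expR (l * t0) / l.
    have := @ftc_segment R t0 (fun s => l^-1 * expR (l * s)) _ (ce l) _ t0.
    rewrite t00 lexx => /(_ _ isT) h.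
    have hd t : 0 <= t <= t0 -> has_deriv t0 (fun s => l^-1 * expR (l * s)) t (expR (l * t)).
      move=> _; apply: is_derive_has_deriv.
      have d1 : is_derive t 1 (fun s : R => l * s) (l * 1).
        exact: (@is_deriveZ _ _ _ id l t 1 1).
      have d2 := is_derive1_comp (is_derive_expR (l * t)) d1.
      have := @is_deriveZ _ _ _ _ l^-1 t 1 _ d2.
      by rewrite /GRing.scale /= mulr1 mulrCA mulVf ?lt0r_neq0// mulr1.
    have := h hd; rewrite mulr0 expR0 mulr1 => e.
    rewrite [leRHS]mulrC e lerDr invr_ge0; exact: ltW.
  have h3 := hphi _ t0T.
  have h4 : P <= a * expR (- l * t0) + c * P / l.
    rewrite /P -/P; apply: (@le_trans _ _ ((a + c * (P * (expR (l * t0) / l))) * expR (- l * t0))).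
      rewrite ler_wpM2r ?expR_ge0//; apply: le_trans h3 _; rewrite lerD2l.
      rewrite ler_wpM2l//; apply: le_trans h1 _; rewrite ler_wpM2l// ltW//.
    rewrite mulNr expRN mulrDl lerD2l.
    rewrite (_ : c * _ * _ = c * P / l)//; field.
    by rewrite !lt0r_neq0 ?expR_gt0.
  have h5 : a * expR (- l * t0) <= a.
    rewrite ler_piMr// -expR0 ler_expR mulNr oppr_le0 mulr_ge0// ltW//.
  have h6 : c * P / l <= P / 2.
    rewrite ler_pdivrMr// /l.
    have -> : P / 2 * (2 * c + 1) = c * P + P / 2 by field.
    lra.
  lra.
move=> t tT; apply: le_trans (hP _ tT) _; case/andP: tT => t0' tT.
apply: (@le_trans _ _ (2 * a * expR (l * t))); first by rewrite ler_wpM2r ?expR_ge0.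
by rewrite ler_wpM2l ?mulr_ge0// ler_expR ler_wpM2l// ltW.
Qed.

(* Energy [c^2 + m s^2] for [m >= 0], Gronwall for [m < 0]. *)
Lemma wave_kern_bound c0 : 0 <= c0 -> exists2 S, 0 <= S & forall (m : R) (s : kern),
  - c0 <= m -> kdelta s = 0 -> s = I * (I - kscal m * (I * s)) ->
  forall t, `|kfun s t| <= S.
Proof.
move=> c00.
(* For [m >= 0], [|c| <= 1] integrates to [T]. For [- c0 <= m < 0], Gronwall is applied to
   [|s| <= T + T c0 \int |s|]. Neither bound depends on [m]. *)
exists (Num.max T (2 * T * expR ((2 * (T * c0) + 1) * T))); first by rewrite le_max ltW.
move=> m s cm ds sE t; rewrite -kfun_clamp.
have := clamp_itv t (ltW T0); move: (clamp T t) => {}t tT.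
set c := I - kscal m * (I * s) in sE.
have dc : kdelta c = 0 by rewrite kdeltaD kdeltaN !kdeltaM kint_delta !(mul0r, mulr0) subrr.
have intS x : mu.-integrable `[0, x] (EFin \o kfun s).
  by apply: continuous_itv_integrable; exact: kfun_continuous.
have sI x : 0 <= x <= T -> kfun s x = \int[mu]_(r in `[0, x]) kfun c r.
  by move=> xT; rewrite {1}sE kintM_fun ?clamp_id// dc add0r.
have cE x : 0 <= x <= T -> kfun c x = 1 - m * \int[mu]_(r in `[0, x]) kfun s r.
  by move=> xT; rewrite kfunB kint_fun kfun_scal kintM_fun ?clamp_id// ds add0r.
have intC x : mu.-integrable `[0, x] (EFin \o kfun c).
  by apply: continuous_itv_integrable; exact: kfun_continuous.
have [m0|m0] := leP 0 m; rewrite le_max.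
  apply/orP; left.
  pose E r := kfun c r * kfun c r + m * (kfun s r * kfun s r).
  have hE r : 0 <= r <= T -> has_deriv T E r 0.
    move=> rT; have hs : has_deriv T (kfun s) r (kfun c r).
      by rewrite {1}sE; exact: kint_has_deriv.
    have hc : has_deriv T (kfun c) r (- m * kfun s r).
      have h1 := @primitive_has_deriv R T (fun x => - m * kfun s x) 1 r _ rT.
      apply: eq_has_deriv rT _ (h1 _) => [x xT|].
        by rewrite cE// RintegralZl// mulNr.
      by apply: continuous_mulc; exact: kfun_continuous.
    have := has_derivD (has_derivM hc hc) (has_derivZ (k := m) (has_derivM hs hs)).
    rewrite (_ : - m * kfun s r * kfun c r + _ + _ = 0)//; ring.
  have EE r : 0 <= r <= T -> E r = 1.
    move=> rT; rewrite (has_deriv_eq_cst hE rT) /E cE ?lexx ?(ltW T0)//.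
    rewrite sI ?lexx ?(ltW T0)// !set_itv1 !Rintegral_set1; ring.
  have c1 r : 0 <= r <= T -> `|kfun c r| <= 1.
    move=> rT; rewrite -(@ler_pXn2r _ 2)// ?nnegrE// expr1n real_normK ?num_real//.
    rewrite -(EE r rT) /E expr2 lerDl mulr_ge0// -expr2 sqr_ge0//.
  case/andP: tT => t0 tT; rewrite sI ?t0//; apply: le_trans (_ : t * 1 <= _).
    apply: Rintegral_le_bound => // r /andP[r0 rt]; apply: c1.
    by rewrite r0 (le_trans rt).
  by rewrite mulr1.
apply/orP; right.
have cabs : continuous (fun r => `|kfun s r|).
  by move=> r; apply: cvg_norm; exact: kfun_continuous.
apply: (@gronwall (fun r => `|kfun s r|)) => //; first exact: ltW.
  by rewrite mulr_ge0// ltW.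
move=> {tT}t /andP[t0 tT].
have J r : 0 <= r <= t -> `|\int[mu]_(x in `[0, r]) kfun s x| <= \int[mu]_(x in `[0, t]) `|kfun s x|.
  move=> /andP[r0 rt]; apply: le_trans (le_normr_Rintegral _ _) _ => //.
  rewrite (Rintegral_split (a := 0) (b := t) (x := r))//; last exact: continuous_itv_integrable.
  by rewrite lerDl; apply: Rintegral_ge0.
set P := \int[mu]_(x in `[0, t]) `|kfun s x| in J *.
rewrite sI ?t0//; apply: (@le_trans _ _ (t * (1 + c0 * P))); last first.
  have P0 : 0 <= P by apply: Rintegral_ge0.
  rewrite mulrDr mulr1; apply: lerD => //; rewrite -mulrA ler_wpM2r// mulr_ge0//.
apply: Rintegral_le_bound => // r rt; have /andP[r0 rt'] := rt.
rewrite cE; last by rewrite r0 (le_trans rt').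
apply: le_trans (ler_normB _ _) _; rewrite normr1 lerD2l normrM.
apply: ler_pM => //; last exact: J.
by rewrite ltr0_norm// lerNl.
Qed.

End ScalarIVP.

(** * A Volterra kernel common to all eigenvalues *)

Section ObservationKernel.
Context {R : realType} {T : R}.
Hypothesis T0 : 0 < T.
Local Notation mu := (@lebesgue_measure R).
Local Notation kern := (kern T).
Local Notation I := (@kint R T).

(** In [D (D^k x)] the delta part of [D] costs [|a|], convolution with its function costs [T d], and
    the delta part of [D^k x] acting on that function costs [d]; [c] is their sum. Including
    [|kdelta x|] in [C] makes [C c^k] dominate the delta part as well. *)
Lemma kpow_mul_bounded (D x : kern) : exists C c, [/\ 0 <= C, 0 <= c &
  forall k, kdelta (D ^+ k * x) = kdelta D ^+ k * kdelta x /\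
    forall t, `|kfun (D ^+ k * x) t| <= C * c ^+ k].
Proof.
have [d d0 hd] := kfun_bounded D; have [b b0 hb] := kfun_bounded x.
set a := kdelta D; pose C := b + `|kdelta x|; pose c := `|a| + T * d + d.
have C0 : 0 <= C by rewrite addr_ge0.
have Td : 0 <= T * d by rewrite mulr_ge0// ltW.
have c0 : 0 <= c by rewrite !addr_ge0.
exists C, c; split=> //; elim=> [|k [IHd IHf]].
  rewrite expr0 mul1r expr0 mul1r; split=> // t; rewrite expr0 mulr1.
  by apply: le_trans (hb t) _; rewrite lerDl.
have dE : kdelta (D ^+ k.+1 * x) = a ^+ k.+1 * kdelta x.
  by rewrite exprS -mulrA kdeltaM IHd exprS mulrA.
split=> // t; rewrite -kfun_clamp; have := clamp_itv t (ltW T0).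
move: (clamp T t) => {}t tT; have /andP[t0 tT'] := tT.
rewrite exprS -mulrA kfunM ?clamp_id// -/a IHd.
have Ck : 0 <= C * c ^+ k by rewrite mulr_ge0// exprn_ge0.
have h1 : `|a * kfun (D ^+ k * x) t| <= `|a| * (C * c ^+ k).
  by rewrite normrM ler_wpM2l.
have h2 : `|a ^+ k * kdelta x * kfun D t| <= (C * c ^+ k) * d.
  rewrite normrM ler_pM//; rewrite normrM normrX [leRHS]mulrC ler_pM ?exprn_ge0//.
    by rewrite lerXn2r ?nnegrE// /c -addrA lerDl addr_ge0.
  by rewrite /C lerDr.
have h3 : `|conv (kfun D) (kfun (D ^+ k * x)) t| <= T * (d * (C * c ^+ k)).
  apply: (@le_trans _ _ (t * (d * (C * c ^+ k)))); last first.
    by rewrite ler_wpM2r// mulr_ge0.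
  apply: Rintegral_le_bound => //.
    by apply: conv_integrable; exact: kfun_continuous.
  by move=> s _; rewrite normrM ler_pM.
apply: le_trans (ler_normD _ _) _; apply: le_trans (lerD (ler_normD _ _) h3) _.
have E : C * c ^+ k.+1 = `|a| * (C * c ^+ k) + (C * c ^+ k) * d + T * (d * (C * c ^+ k)).
  rewrite exprS /c; ring.
by rewrite E lerD2r lerD.
Qed.

(** In the [k]-th term the delta part of [D^k x] contributes [kdelta x (- a t)^k / k!] times [s t],
    which sums to the exponential. Its function part contributes the integral of
    [(D^k x)(t - u) (-u)^k / k!] against [s u]; as [s] is a mere factor, summing under the integral
    gives a [K] chosen before [s]. *)
Lemma transmutation_kernel (D x : kern) : exists (K : R -> R -> R) (C : R),
  [/\ 0 <= C, forall s, continuous (K ^~ s), forall t, continuous (K t),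
    forall t s, `|K t s| <= C &
    forall s, kdelta s = 0 -> exists y : kern, [/\ kdelta y = 0,
      ksums (fun k => D ^+ k * x * kmom s k) y &
      forall t, 0 <= t <= T -> kfun y t =
        kdelta x * expR (- kdelta D * t) * kfun s t +
        \int[mu]_(u in `[0, t]) (K t u * kfun s u)]].
Proof.
have [C [c [C0 c0 hx]]] := kpow_mul_bounded D x.
(* The clamp keeps the powers of [u] bounded on the whole line, so that [K] is globally bounded; on
   [[0, T]] it is the identity. *)
pose f k t u := (- clamp T u) ^+ k / k`!%:R * kfun (D ^+ k * x) (t - u).
have fb t u k : `|f k t u| <= C * ((c * T) ^+ k / k`!%:R).
  rewrite normrM normrM normrX normrN (ger0_norm (clamp_ge0 _ _)).
  rewrite ger0_norm ?invr_ge0//; have [_ h] := hx k.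
  rewrite exprMn (_ : C * _ = T ^+ k / k`!%:R * (C * c ^+ k)); last by ring.
  rewrite ler_pM ?mulr_ge0 ?invr_ge0 ?exprn_ge0 ?clamp_ge0//.
  rewrite ler_wpM2r ?invr_ge0// lerXn2r ?nnegrE ?clamp_ge0 ?(ltW T0)//.
  by have /andP[] := clamp_itv u (ltW T0).
have cT : 0 <= c * T by rewrite mulr_ge0// ltW.
pose K t u := limn (series (fun k => f k t u)).
have hK t u := exp_series_bound C0 cT (fb t u).
have Kc t u n : `|series (fun k => f k t u) n - K t u| <= etail C (c * T) n.
  exact: (hK t u).2.
have cpow k : continuous (fun u : R => (- clamp T u) ^+ k / k`!%:R).
  move=> u; apply: cvgM; last exact: cvg_cst.
  apply: (@continuous_comp _ _ _ (fun u : R => - clamp T u) (fun v : R => v ^+ k)).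
    by apply: cvgN; exact: continuous_clamp.
  exact: exprn_continuous.
have cseries (F : nat -> R -> R) n : (forall k, continuous (F k)) ->
    continuous (fun t => series (fun k => F k t) n).
  move=> cF t; rewrite /series /=.
  elim: n => [|n IHn].
    under eq_fun do rewrite big_geq//.
    by rewrite ?big_geq//; exact: cvg_cst.
  under eq_fun do rewrite big_nat_recr//=.
  by rewrite ?big_nat_recr//=; apply: cvgD; [exact: IHn|exact: cF].
have Kl s : continuous (K ^~ s).
  apply: (@continuous_uniform_limit _ (fun n t => series (fun k => f k t s) n) _ (etail C (c * T))).
  - move=> n; apply: cseries => k t; apply: cvgM; first exact: cvg_cst.
    apply: (@continuous_comp _ _ _ (fun t : R => t - s) (kfun (D ^+ k * x))).
      by apply: cvgB; [exact: cvg_id|exact: cvg_cst].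
    exact: kfun_continuous.
  - exact: etail_cvg.
  - by move=> n t; exact: Kc.
have Kr t : continuous (K t).
  apply: (@continuous_uniform_limit _ (fun n u => series (fun k => f k t u) n) _ (etail C (c * T))).
  - move=> n; apply: cseries => k u; apply: cvgM; first exact: cpow.
    by apply: continuous_subr; exact: kfun_continuous.
  - exact: etail_cvg.
  - by move=> n u; exact: Kc.
have KC t u : `|K t u| <= etail C (c * T) 0.
  by have := Kc t u 0%N; rewrite /series /= big_geq// sub0r normrN.
clear hK; clearbody K.
exists K, (etail C (c * T) 0); split;
  [exact: le_trans (normr_ge0 _) (KC 0 0)|exact: Kl|exact: Kr|exact: KC|].
move=> s ds; have [B B0 hB] := kfun_bounded s.
have sB : kbnd s B by split.
have [y ys dy] := @kgeom_exists _ _ T0 D x (kmom s) B T B0 (ltW T0) (kmom_bnd T0 B0 sB).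
exists y; split; [exact: dy|exact: ys|] => t tT; have /andP[t0 tT'] := tT.
have km k : kdelta (kmom s k) = 0.
  by have [] := kmom_bnd T0 B0 sB k.
have yt : series (fun k => kfun (D ^+ k * x * kmom s k) t) n @[n --> \oo] --> kfun y t.
  apply/cvgrPdist_le => e e0; have [N hN] := ys e e0.
  exists N => // n /= Nn; have [_ h] := hN n Nn.
  by have := h t; rewrite kfunB (kfun_sum (fun k => D ^+ k * x * kmom s k)) distrC.
have termE k : kfun (D ^+ k * x * kmom s k) t =
    kdelta x * (- kdelta D * t) ^+ k / k`!%:R * kfun s t +
    \int[mu]_(u in `[0, t]) (f k t u * kfun s u).
  rewrite kfunM ?clamp_id// km mul0r addr0 (hx k).1 kmom_fun ?clamp_id//.
  congr (_ + _).
    by rewrite mulNr -mulrN exprMn; ring.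
  rewrite /conv; apply: eq_Rintegral => u; rewrite inE /= in_itv /= => /andP[u0 ut].
  have uT : clamp T u = u by apply: clamp_id; rewrite u0 (le_trans ut).
  by rewrite /f kmom_fun// uT; ring.
have is1 n : mu.-integrable `[0, t] (EFin \o (fun u => series (fun k => f k t u) n * kfun s u)).
  apply: continuous_itv_integrable => u; apply: cvgM; last exact: kfun_continuous.
  apply: cseries => k v; apply: cvgM; first exact: cpow.
  by apply: continuous_subr; exact: kfun_continuous.
have is2 k : mu.-integrable `[0, t] (EFin \o (fun u => f k t u * kfun s u)).
  apply: continuous_itv_integrable => u; apply: cvgM; last exact: kfun_continuous.
  apply: cvgM; first exact: cpow.
  by apply: continuous_subr; exact: kfun_continuous.
have serE n : series (fun k => kfun (D ^+ k * x * kmom s k) t) n =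
   kdelta x * series (exp_coeff (- kdelta D * t)) n * kfun s t +
   \int[mu]_(u in `[0, t]) (series (fun k => f k t u) n * kfun s u).
  rewrite /series /=; elim: n => [|n IHn].
    rewrite !big_geq// mulr0 mul0r add0r; under eq_Rintegral do rewrite big_geq// mul0r.
    by rewrite /Rintegral integral0.
  rewrite !big_nat_recr//= IHn termE.
  under [in RHS]eq_Rintegral do rewrite big_nat_recr//= mulrDl.
  rewrite RintegralD//; last exact: (is1 n).
  have -> : exp_coeff (- kdelta D * t) n = (- kdelta D * t) ^+ n / n`!%:R by [].
  ring.
have c1 : kdelta x * series (exp_coeff (- kdelta D * t)) n * kfun s t @[n --> \oo] -->
    kdelta x * expR (- kdelta D * t) * kfun s t.
  apply: cvgM; last exact: cvg_cst.
  by apply: cvgM; [exact: cvg_cst|exact: is_cvg_series_exp_coeff].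
have is3 : mu.-integrable `[0, t] (EFin \o (fun u => K t u * kfun s u)).
  apply: continuous_itv_integrable => u.
  by apply: cvgM; [exact: Kr|exact: kfun_continuous].
have c2 : \int[mu]_(u in `[0, t]) (series (fun k => f k t u) n * kfun s u) @[n --> \oo] -->
    \int[mu]_(u in `[0, t]) (K t u * kfun s u).
  (* Sum and integral are exchanged by the uniform tail estimate, [B] being a bound for [s]. *)
  have lim0 : t * (etail C (c * T) n * B) @[n --> \oo] --> 0.
    rewrite -(mulr0 t) -(mul0r B); apply: cvgM; first exact: cvg_cst.
    by apply: cvgM; [exact: etail_cvg|exact: cvg_cst].
  apply/cvgrPdist_le => e e0; have /cvgrPdist_le/(_ e e0) := lim0.
  apply: filterS => n; rewrite sub0r normrN => h; apply: le_trans h.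
  rewrite distrC -(RintegralB _ (is1 n) is3)//.
  apply: le_trans (ler_norm _).
  apply: Rintegral_le_bound => //; first exact: (integrable_sub _ (is1 n) is3).
  by move=> u _; rewrite -mulrBl normrM ler_pM.
have h : (fun n => series (fun k => kfun (D ^+ k * x * kmom s k) t) n) @ \oo -->
    kdelta x * expR (- kdelta D * t) * kfun s t +
    \int[mu]_(u in `[0, t]) (K t u * kfun s u).
  by rewrite (funext serE); exact: cvgD c1 c2.
exact: (cvg_unique (@Rhausdorff R) yt h).
Qed.

End ObservationKernel.

(** * Strong measurability and weak integrals *)

Section StronglyMeasurable.
Context {R : realType}.
Local Notation mu := (@lebesgue_measure R).

Lemma simple_vfun_fin (V : normedModType R) (J : finType) (E : J -> set R) (c : J -> V) :
  (forall j, measurable (E j)) ->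
  simple_vfun (fun t => \sum_j (\1_(E j) t : R) *: c j).
Proof.
move=> mE; exists #|J|, (E \o enum_val), (c \o enum_val); split; first by move=> i; exact: mE.
apply/funext => t; rewrite (reindex (@enum_val J xpredT))//=.
  by apply: onW_bij; exact: enum_val_bij.
Qed.

Lemma strongly_measurableD (V : normedModType R) (D : set R) (f g : R -> V) :
  strongly_measurable D f -> strongly_measurable D g ->
  strongly_measurable D (fun t => f t + g t).
Proof.
move=> [s [hs sf]] [s' [hs' sg]]; exists (fun k t => s k t + s' k t); split.
  move=> k; have [n [E [c [mE ->]]]] := hs k; have [n' [E' [c' [mE' ->]]]] := hs' k.
  pose EE (j : 'I_n + 'I_n') := match j with inl i => E i | inr i => E' i end.
  pose cc (j : 'I_n + 'I_n') := match j with inl i => c i | inr i => c' i end.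
  have := @simple_vfun_fin V _ EE cc; rewrite /EE /cc.
  under eq_fun do rewrite big_sumType /=.
  by apply; case.
by move=> t Dt; apply: cvgD; [exact: sf|exact: sg].
Qed.

Lemma strongly_measurableZ (V : normedModType R) (D : set R) (k : R -> R) (g : R -> V) :
  strongly_measurable D (k : R -> R^o) -> strongly_measurable D g ->
  strongly_measurable D (fun t => k t *: g t).
Proof.
move=> [s [hs sf]] [s' [hs' sg]]; exists (fun k t => s k t *: s' k t); split.
  move=> i; have [n [E [c [mE ->]]]] := hs i; have [n' [E' [c' [mE' ->]]]] := hs' i.
  have := @simple_vfun_fin V ('I_n * 'I_n')%type (fun j => E j.1 `&` E' j.2) (fun j => c j.1 *: c' j.2).
  rewrite (_ : (fun t => _) = (fun t => (\sum_(i < n) (\1_(E i) t : R) *: (c i : R^o)) *: \sum_(i < n') (\1_(E' i) t : R) *: c' i)).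
    by apply=> j; exact: measurableI.
  apply/funext => t; rewrite scaler_suml.
  under [RHS]eq_bigr do rewrite scaler_sumr.
  rewrite pair_big /=; apply: eq_bigr => j _.
  by rewrite indicI /= !scalerA /GRing.scale /=; congr (_ *: _); ring.
by move=> t Dt; apply: cvgZ; [exact: sf|exact: sg].
Qed.

(* The k-th approximation takes the value of f at the left end point of each
   interval of length 1/(k+1). *)
Lemma continuous_strongly_measurable (V : normedModType R) (T : R) (f : R -> V) :
  (forall t, 0 <= t <= T -> f s @[s --> within `[0, T] (nbhs t)] --> f t) ->
  strongly_measurable `[0, T] f.
Proof.
move=> cf; pose N k := (Num.truncn (k.+1%:R * T)).+1.
pose x (k i : nat) : R := i%:R / k.+1%:R.
exists (fun k t => \sum_(i < N k) (\1_(`[x k i, x k i.+1[%classic) t : R) *: f (x k i)); split.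
  by move=> k; exact: simple_vfun_fin.
move=> t /=; rewrite in_itv /= => tT; have /andP[t0 tT'] := tT.
pose j k := Num.truncn (k.+1%:R * t).
have kt k : 0 <= k.+1%:R * t by rewrite mulr_ge0.
have jt k : x k (j k) <= t < x k (j k).+1.
  have /andP[h1 h2] := truncn_itv (kt k).
  by rewrite /x ler_pdivrMr// ltr_pdivlMr// mulrC h1.
have jN k : (j k < N k)%N.
  rewrite ltnS; apply: le_truncn; rewrite ler_wpM2l//.
have sumE k : \sum_(i < N k) (\1_(`[x k i, x k i.+1[%classic) t : R) *: f (x k i) = f (x k (j k)).
  rewrite (bigD1 (Ordinal (jN k)))//= indicE mem_set ?scale1r; last by rewrite /= in_itv /= jt.
  rewrite big1 ?addr0// => i ij; rewrite indicE memNset ?scale0r// => /=.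
  rewrite in_itv /= => /andP[h1 h2]; move/eqP: ij; apply; apply/val_inj => /=.
  have k0 : (0 : R) < k.+1%:R by [].
  rewrite /x ler_pdivrMr// in h1; rewrite /x ltr_pdivlMr// in h2.
  apply/esym; rewrite /j; apply/eqP; rewrite truncn_eq//.
  by rewrite mulrC h1 h2.
under eq_fun do rewrite sumE.
have cx : x k (j k) @[k --> \oo] --> within `[0, T] (nbhs t).
  have h : x k (j k) @[k --> \oo] --> t.
    apply/cvgrPdist_le => e e0.
    have := @cvg_inv_succ R 1 => /cvgrPdist_le/(_ e e0).
    apply: filterS => k; rewrite sub0r normrN ger0_norm ?divr_ge0// => ke.
    have /andP[h1 h2] := jt k; rewrite ger0_norm ?subr_ge0//.
    apply: le_trans ke; rewrite lerBlDr; apply: le_trans (ltW h2) _.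
    by rewrite /x -[(j k).+1%:R]natr1 mulrDl addrC.
  move=> A; rewrite /within /= => /h /=; rewrite !nbhs_simpl /=.
  apply: filterS => k; apply; rewrite /= in_itv /=.
  have /andP[h1 _] := jt k; rewrite (le_trans h1 tT') andbT.
  by rewrite /x divr_ge0.
exact: cvg_comp cx (cf t tT).
Qed.

Section Hilbert.
Variables (G : hilbertType R) (D : set R).

Lemma simple_vfun_dot (s : R -> G) b : simple_vfun s -> measurable_fun setT (fun t => '[s t, b]).
Proof.
move=> [n [E [c [mE ->]]]].
under eq_fun do rewrite dot_suml.
apply: measurable_sum => i; under eq_fun do rewrite dotZl.
apply: measurable_funM; last exact: measurable_cst.
exact: measurable_indic.
Qed.

Lemma strongly_measurable_dot (g : R -> G) b : strongly_measurable D g ->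
  measurable_fun D (fun t => '[g t, b]).
Proof.
move=> [s [hs sg]]; apply: (measurable_fun_cvg (h := fun k t => '[s k t, b])) => //.
  by move=> k; apply: measurable_funTS; exact: simple_vfun_dot.
by move=> t Dt; apply: cvg_dotl; exact: sg.
Qed.

Lemma strongly_measurable_norm (g : R -> G) : strongly_measurable D g ->
  measurable_fun D (fun t => `|g t|).
Proof.
move=> [s [hs sg]].
have m2 k : measurable_fun D (fun t => `|s k t| ^+ 2).
  apply: measurable_funTS; have := hs k => -[n [E [c [mE ->]]]].
  under eq_fun do rewrite -dotxx dot_suml.
  apply: measurable_sum => i; under eq_fun do rewrite dotZl dotC dot_suml.
  apply: measurable_funM; first exact: measurable_indic.
  apply: measurable_sum => j; under eq_fun do rewrite dotZl.
  apply: measurable_funM; last exact: measurable_cst.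
  exact: measurable_indic.
have m1 : measurable_fun D (fun t => `|g t| ^+ 2).
  apply: (measurable_fun_cvg (h := fun k t => `|s k t| ^+ 2)) => // t Dt.
  by apply: cvgM; apply: cvg_norm; exact: sg.
under eq_fun do rewrite -[`|g _|]ger0_norm// -sqrtr_sqr.
apply: (measurableT_comp _ m1).
by apply: continuous_measurable_fun; exact: sqrt_continuous.
Qed.

End Hilbert.
End StronglyMeasurable.

Section Pettis.
Context {R : realType}.
Local Notation mu := (@lebesgue_measure R).

Lemma weakly_integrable (G : hilbertType R) (D : set R) (F : R -> G) (be : R -> R) :
  measurable D -> (forall b, measurable_fun D (fun s => '[F s, b])) ->
  mu.-integrable D (EFin \o be) -> (forall s, D s -> `|F s| <= be s) ->
  forall b, mu.-integrable D (EFin \o (fun s => '[F s, b])).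
Proof.
move=> mD mF ibe Fbe b.
apply: (@le_integrable _ _ _ mu _ _ _ (EFin \o (fun s => `|b| * be s))) => //.
- by apply/measurable_EFinP; exact: mF.
- move=> s Ds /=; rewrite lee_fin normrM normr_id mulrC.
  apply: le_trans (dot_le _ _) _; rewrite ler_wpM2r//.
  exact: le_trans (Fbe s Ds) (ler_norm _).
- exact: integrable_scale.
Qed.

(** The integral is the Riesz representative of [b |-> \int k <F, b>]. Weak measurability and a
    scalar majorant [be] suffice, which is all that is known of the wave built by spectral sums. *)
Lemma pettis (G : hilbertType R) (D : set R) (F : R -> G) (k be : R -> R) (C : R) :
  measurable D -> (forall b, measurable_fun D (fun s => '[F s, b])) ->
  mu.-integrable D (EFin \o be) -> (forall s, D s -> `|F s| <= be s) ->
  measurable_fun D k -> (forall s, D s -> `|k s| <= C) ->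
  exists x : G, (forall b, '[x, b] = \int[mu]_(s in D) (k s * '[F s, b])) /\
    `|x| <= \int[mu]_(s in D) (`|k s| * be s).
Proof.
move=> mD mF ibe Fbe mk kC.
have iF := weakly_integrable mD mF ibe Fbe.
have ikF b : mu.-integrable D (EFin \o (fun s => k s * '[F s, b])).
  exact: (integrable_mul_bounded mD mk kC).
have ikb : mu.-integrable D (EFin \o (fun s => `|k s| * be s)).
  apply: (@integrable_mul_bounded _ _ C (fun s => `|k s|)) => //.
    exact: measurableT_comp.
  by move=> s Ds; rewrite normr_id; exact: kC.
set N := \int[mu]_(s in D) (`|k s| * be s).
have N0 : 0 <= N.
  apply: Rintegral_ge0 => s Ds; rewrite mulr_ge0//.
  exact: le_trans (normr_ge0 _) (Fbe s Ds).
pose l b := \int[mu]_(s in D) (k s * '[F s, b]).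
have lb b : `|l b| <= N * `|b|.
  apply: le_trans (le_normr_Rintegral _ _) _ => //.
  rewrite mulrC -RintegralZl//; apply: le_Rintegral => //.
  - exact: integrable_norm.
  - exact: integrable_scale.
  - move=> s Ds; rewrite normrM mulrCA ler_wpM2l// mulrC.
    apply: le_trans (dot_le _ _) _; rewrite ler_wpM2r//; exact: Fbe.
have [||x xN hx] := @riesz R G l N N0 => //.
  move=> a y z; rewrite /l -RintegralZl// -RintegralD//; last exact: integrable_scale.
  by apply: eq_Rintegral => s _; rewrite dotDr dotZr; ring.
by exists x.
Qed.

End Pettis.

(** * Spectral decomposition *)

Section EigenBasis.
Context {R : realType} {H : hilbertType R}.
Implicit Types A : operator H H.

Lemma opfun0 (V W : lmodType R) (A : operator V W) : A 0 = 0.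
Proof.
by have := opfun_lin 1 (opdom0 A) (opdom0 A); rewrite !scale1r addr0 -[LHS]addr0 => /addrI.
Qed.

Lemma opfun_scale A a x : opdom A x -> A (a *: x) = a *: A x /\ opdom A (a *: x).
Proof.
move=> Ax; have := opfun_lin a Ax (opdom0 A); have := opdom_lin a Ax (opdom0 A).
by rewrite !addr0 opfun0 addr0.
Qed.

Lemma self_adjoint_sym A : self_adjoint A ->
  forall u v, opdom A u -> opdom A v -> '[A u, v] = '[u, A v].
Proof.
move=> [_ gA] u v Au Av; have : graph A (v, A v) by split.
by rewrite gA => /(_ u Au).
Qed.

(* The zero vectors of the sequence carry no information; they are assigned the
   eigenvalue 0. *)
Lemma eigenbasis A : condition_A A -> exists (e : nat -> H) (m : nat -> R) (c : R),
  [/\ 0 <= c, forall n, [/\ opdom A (e n), A (e n) = m n *: e n & - c <= m n],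
   forall i j, i != j -> '[e i, e j] = 0,
   forall n, `|e n| = 1 \/ e n = 0 &
   forall x, (forall n, '[x, e n] = 0) -> x = 0].
Proof.
move=> [sA _ _ [l [Q [[hQ hQ'] Qc]]] [c c0 hc]]; have symA := self_adjoint_sym sA.
have Qlin a x y : Q (a *: x + y) = a *: Q x + Q y.
  have [dx ex] := hQ x; have [dy ey] := hQ y.
  rewrite -[RHS]hQ'; last exact: opdom_lin.
  rewrite opfun_lin//; congr Q.
  transitivity (a *: (A (Q x) - l *: Q x) + (A (Q y) - l *: Q y)); first by rewrite ex ey.
  by rewrite !scalerDr scalerN !scalerA opprD [a * l]mulrC addrACA.
have Qsym x y : '[Q x, y] = '[x, Q y].
  have [dx ex] := hQ x; have [dy ey] := hQ y.
  transitivity '[Q x, A (Q y) - l *: Q y]; first by rewrite ey.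
  transitivity '[A (Q x) - l *: Q x, Q y]; last by rewrite ex.
  by rewrite dotBr dotBl dotZr dotZl symA.
have Qinj x : Q x = 0 -> x = 0.
  by have [dx ex] := hQ x => Q0; rewrite -ex Q0 opfun0 scaler0 subr0.
have [e [la [Qe orth e1 tot]]] := spectral_sequence Qlin Qsym Qc.
(* As [Q] inverts [A - l], [Q e = la e] reads [A e = (l + 1 / la) e]; injectivity of [Q] excludes
   [la = 0] on a nonzero vector. *)
pose m n := if e n == 0 then 0 else l + (la n)^-1.
have he n : [/\ opdom A (e n), A (e n) = m n *: e n & - c <= m n].
  rewrite /m; have [en0|en0] := eqVneq (e n) 0.
    by rewrite en0 opfun0 scaler0; split; [exact: opdom0| |rewrite oppr_le0 ltW].
  have la0 : la n != 0.
    by apply: contra en0 => /eqP l0; apply/eqP/Qinj; rewrite Qe l0 scale0r.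
  have [dx ex] := hQ (e n).
  have [E1 E2] := opfun_scale (la n)^-1 dx.
  rewrite Qe scalerA mulVf// scale1r in E1 E2.
  have AE : A (e n) = (l + (la n)^-1) *: e n.
    have /eqP := ex; rewrite subr_eq => /eqP h.
    rewrite E1 -[la n *: e n]Qe h Qe scalerDr !scalerA mulrCA mulVf// mulr1 addrC scalerDl//.
  split=> //; have := hc _ E2; rewrite AE dotZl dotxx.
  have [->|h] := e1 n; last by rewrite h eqxx in en0.
  by rewrite expr1n !mulr1.
exists e, m, c; split=> //; first exact: ltW.
by move=> x /tot/Qinj.
Qed.

End EigenBasis.

(** * Spectral multipliers *)

Section Diagonal.
Context {R : realType} {H : hilbertType R}.
Variables (e : nat -> H).
Hypothesis orth : forall i j, i != j -> '[e i, e j] = 0.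
Hypothesis e1 : forall n, `|e n| = 1 \/ e n = 0.

Lemma bessel x n : \sum_(k < n) '[x, e k] ^+ 2 <= `|x| ^+ 2.
Proof.
pose r n := x - \sum_(k < n) '[x, e k] *: e k.
have re i j : (j <= i)%N -> '[r j, e i] = '[x, e i].
  move=> ji; rewrite /r dotBl dot_suml big1 ?subr0// => k _.
  by rewrite dotZl orth ?mulr0// neq_ltn (leq_trans (ltn_ord k) ji).
suff E : \sum_(k < n) '[x, e k] ^+ 2 + `|r n| ^+ 2 = `|x| ^+ 2.
  by rewrite -E lerDl sqr_ge0.
elim: n => [|n IHn]; first by rewrite big_ord0 add0r /r big_ord0 subr0.
have rS : r n.+1 = r n - '[x, e n] *: e n by rewrite /r big_ord_recr /= opprD addrA.
rewrite big_ord_recr /= -IHn -addrA; congr (_ + _).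
rewrite rS sqr_normB dotZr re//.
rewrite normrZ exprMn real_normK ?num_real//.
by have [->|->] := e1 n; rewrite ?normr0 ?dot0r; ring.
Qed.

(** [2 p q <= l p^2 + q^2 / l] and Bessel bound the sum for every weight [l > 0]; the weight
    [|a| / |x|] balances the two terms. *)
Lemma diagonal_bound (b : nat -> R) C x a n : 0 <= C -> (forall k, `|b k| <= C) ->
  \sum_(k < n) `|b k * '[x, e k] * '[a, e k]| <= C * `|x| * `|a|.
Proof.
move=> C0 bC.
have key (l : R) : 0 < l ->
    \sum_(k < n) `|b k * '[x, e k] * '[a, e k]| <= C * (l * `|x| ^+ 2 + l^-1 * `|a| ^+ 2) / 2.
  move=> l0; apply: (@le_trans _ _ (\sum_(k < n) C * (l * '[x, e k] ^+ 2 + l^-1 * '[a, e k] ^+ 2) / 2)).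
    apply: ler_sum => k _; rewrite -mulrA normrM -mulrA ler_pM//.
    rewrite ler_pdivlMr// normrM.
    rewrite -[_ ^+ 2]real_normK ?num_real// -['[a, e k] ^+ 2]real_normK ?num_real//.
    set p := `|_|; set q := `|_|.
    have : 0 <= l^-1 * (l * p - q) ^+ 2 by rewrite mulr_ge0 ?sqr_ge0// invr_ge0 ltW.
    rewrite (_ : l^-1 * _ = l * p ^+ 2 + l^-1 * q ^+ 2 - p * q * 2) ?subr_ge0//.
    by field; exact: lt0r_neq0.
  rewrite -mulr_suml -mulr_sumr big_split /= -!mulr_sumr ler_wpM2r ?invr_ge0//.
  rewrite ler_wpM2l// lerD// ler_wpM2l ?bessel ?invr_ge0 ?(ltW l0)//.
have [->|x0] := eqVneq x 0.
  by rewrite big1 ?normr0 ?mulr0 ?mul0r// => k _; rewrite dot0l mulr0 mul0r normr0.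
have [->|a0] := eqVneq a 0.
  by rewrite big1 ?normr0 ?mulr0// => k _; rewrite dot0l mulr0 normr0.
have nx : 0 < `|x| by rewrite normr_gt0.
have na : 0 < `|a| by rewrite normr_gt0.
have := key (`|a| / `|x|) (divr_gt0 na nx).
rewrite (_ : C * _ / 2 = C * `|x| * `|a|)//.
by field; rewrite !lt0r_neq0.
Qed.

Definition diagonal_sum (b : nat -> R) (x a : H) (n : nat) : R :=
  \sum_(k < n) b k * '[x, e k] * '[a, e k].

(** The multiplier with symbol [b] applied to [x], built weakly: the absolutely convergent sums
    define a bounded functional of [a], represented by Riesz. *)
Lemma diagonal_exists (b : nat -> R) C x : 0 <= C -> (forall k, `|b k| <= C) ->
  exists2 w : H, `|w| <= C * `|x| &
    forall a, diagonal_sum b x a @ \oo --> '[w, a].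
Proof.
move=> C0 bC.
have scvg a : cvgn (diagonal_sum b x a).
  have -> : diagonal_sum b x a = series (fun k => b k * '[x, e k] * '[a, e k]).
    by apply/funext => n; rewrite /series /= big_mkord.
  apply: normed_cvg; apply: nondecreasing_is_cvgn.
    by apply/nondecreasing_seqP => n; rewrite -subr_ge0 seriesSB normr_ge0.
  exists (C * `|x| * `|a|) => _ [n _ <-]; rewrite /normed_series_of seriesEord.
  exact: diagonal_bound.
pose l a := limn (diagonal_sum b x a).
have hl a : diagonal_sum b x a @ \oo --> l a by exact: scvg.
have lb a : `|l a| <= C * `|x| * `|a|.
  have h : `|diagonal_sum b x a n| @[n --> \oo] --> `|l a| by apply: cvg_norm; exact: hl.
  rewrite -(cvg_lim (@Rhausdorff R) h); apply: limr_le; first exact: cvgP h.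
  apply: nearW => n.
  by apply: le_trans (ler_norm_sum _ _ _) _; exact: diagonal_bound.
have C1 : 0 <= C * `|x| by rewrite mulr_ge0.
have [||w wC hw] := @riesz R H l _ C1 => //.
  move=> c y z; apply: (cvg_unique (@Rhausdorff R) (hl _)).
  have -> : diagonal_sum b x (c *: y + z) = (fun n => c * diagonal_sum b x y n + diagonal_sum b x z n).
    apply/funext => n; rewrite /diagonal_sum mulr_sumr -big_split /=.
    by apply: eq_bigr => k _; rewrite dotDl dotZl; ring.
  by apply: cvgD; [apply: cvgM; [exact: cvg_cst|exact: hl]|exact: hl].
by exists w => // a; rewrite hw; exact: hl.
Qed.

Hypothesis total : forall x, (forall n, '[x, e n] = 0) -> x = 0.
Variables (A : operator H H) (m : nat -> R).
Hypothesis symA : forall u v, opdom A u -> opdom A v -> '[A u, v] = '[u, A v].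
Hypothesis eA : forall n, opdom A (e n) /\ A (e n) = m n *: e n.

(** Solutions are tested on every eigenvector, not only on the basis. By symmetry, [e k] can fail to
    be orthogonal to [phi] only when [m k = p], so a symbol depending on the eigenvalue alone acts
    on [phi] as [be p]. *)
Lemma diagonal_eigen (be : R -> R) C x w phi p : 0 <= C ->
  (forall k, `|be (m k)| <= C) ->
  (forall a, diagonal_sum (be \o m) x a @ \oo --> '[w, a]) ->
  opdom A phi -> A phi = p *: phi -> '[w, phi] = be p * '[x, phi].
Proof.
move=> C0 bC hw dphi Aphi.
have [w' _ hw'] := @diagonal_exists (be \o m) C phi C0 bC.
have w'E : w' = be p *: phi.
  apply/eqP; rewrite -subr_eq0; apply/eqP; apply: total => k.
  rewrite dotBl dotZl; apply/eqP; rewrite subr_eq0; apply/eqP.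
  apply: (cvg_unique (@Rhausdorff R) (hw' (e k))).
  apply: cvg_near_cst; exists k.+1 => // n /= kn.
  rewrite /diagonal_sum (bigD1 (Ordinal kn))//= big1 ?addr0; last first.
    by move=> i ik; rewrite [X in _ * X]orth ?mulr0// eq_sym.
  have [dk Ak] := eA k; have := symA dk dphi.
  rewrite Ak Aphi dotZl dotZr [in '[phi, _]]dotC [LHS]mulrC [RHS]mulrC => /eqP.
  rewrite -subr_eq0 -mulrBr mulf_eq0 subr_eq0 => /orP[/eqP h|/eqP ->].
    by rewrite h mulr0 mul0r mulr0.
  rewrite dotxx; have [->|h] := e1 k; first by rewrite expr1n mulr1.
  by rewrite h !dot0l !(mulr0, mul0r).
have -> : be p * '[x, phi] = '[w', x] by rewrite w'E dotZl dotC.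
apply: (cvg_unique (@Rhausdorff R) (hw phi)).
have -> : diagonal_sum (be \o m) x phi = diagonal_sum (be \o m) phi x.
  by apply/funext => n; apply: eq_bigr => k _; ring.
exact: hw'.
Qed.

End Diagonal.

(** * Transfer of observations *)

Section L2Compare.
Context {R : realType} {T : R}.
Hypothesis T0 : 0 < T.
Local Notation mu := (@lebesgue_measure R).
Let mT : measurable (`[0, T]%classic : set R). Proof. by []. Qed.

(** The integral of the squared deviation of [y] from its mean is nonnegative. *)
Lemma sqr_Rintegral_le (y : R -> R) : mu.-integrable `[0, T] (EFin \o y) ->
  mu.-integrable `[0, T] (EFin \o (fun t => y t ^+ 2)) ->
  (\int[mu]_(t in `[0, T]) y t) ^+ 2 <= T * \int[mu]_(t in `[0, T]) (y t ^+ 2).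
Proof.
move=> iy iy2; set a := \int[mu]_(t in `[0, T]) y t; pose c := a / T.
have ic : mu.-integrable `[0, T] (EFin \o (fun=> c ^+ 2)).
  by apply: continuous_itv_integrable; exact: cst_continuous.
have : 0 <= \int[mu]_(t in `[0, T]) (y t ^+ 2 - (2 * c) * y t + c ^+ 2).
  by apply: Rintegral_ge0 => t _; rewrite (_ : _ + _ = (y t - c) ^+ 2) ?sqr_ge0//; ring.
have i1 := integrable_scale (2 * c) mT iy.
have i2 := integrable_sub mT iy2 i1.
rewrite RintegralD// RintegralB// RintegralZl// Rintegral_cst_itv ?(ltW T0)// -/a.
set b := \int[mu]_(t in _) _ => h.
have E : b - 2 * c * a + T * c ^+ 2 = b - a ^+ 2 / T.
  by rewrite /c; field; exact: lt0r_neq0.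
by move: h; rewrite E subr_ge0 ler_pdivrMr// mulrC.
Qed.

(** [(u + v)^2 <= 2 u^2 + 2 v^2]; the constant term integrates to a factor [T], and
    [sqr_Rintegral_le] brings the second one. *)
Lemma L2_compare (x y : R -> R) (a b : R) : 0 <= a -> 0 <= b ->
  measurable_fun `[0, T] x -> mu.-integrable `[0, T] (EFin \o y) ->
  mu.-integrable `[0, T] (EFin \o (fun t => y t ^+ 2)) ->
  (forall t, 0 <= t <= T -> 0 <= x t <= a * y t + b * \int[mu]_(s in `[0, T]) y s) ->
  (\int[mu]_(t in `[0%R, T]) (x t ^+ 2)%:E < +oo)%E /\
  \int[mu]_(t in `[0, T]) (x t ^+ 2) <=
    (2 * a ^+ 2 + 2 * b ^+ 2 * T ^+ 2) * \int[mu]_(t in `[0, T]) (y t ^+ 2).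
Proof.
move=> a0 b0 mx iy iy2 hx; set N := \int[mu]_(s in _) y s in hx.
have xle t : 0 <= t <= T -> x t ^+ 2 <= 2 * a ^+ 2 * y t ^+ 2 + 2 * b ^+ 2 * N ^+ 2.
  move=> /hx/andP[x0 xt].
  apply: (@le_trans _ _ ((a * y t + b * N) ^+ 2)).
    by rewrite lerXn2r ?nnegrE// (le_trans x0 xt).
  rewrite -subr_ge0 (_ : _ - _ = (a * y t - b * N) ^+ 2) ?sqr_ge0//; ring.
have iz : mu.-integrable `[0, T] (EFin \o (fun t => 2 * a ^+ 2 * y t ^+ 2 + 2 * b ^+ 2 * N ^+ 2)).
  apply: integrable_add => //; first exact: integrable_scale.
  by apply: continuous_itv_integrable; exact: cst_continuous.
have ix : mu.-integrable `[0, T] (EFin \o (fun t => x t ^+ 2)).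
  apply: le_integrable iz => //.
    by apply/measurable_EFinP; exact: measurable_funX.
  move=> t; rewrite /= in_itv /= => tT; rewrite lee_fin ger0_norm ?sqr_ge0//.
  by apply: le_trans (xle t tT) (ler_norm _).
split.
  have /integrableP[_] := ix; apply: le_lt_trans; apply: ge0_le_integral => //.
  - by move=> t _; rewrite lee_fin sqr_ge0.
  - by apply/measurable_EFinP; exact: measurable_funX.
  - by apply: measurableT_comp => //; apply/measurable_EFinP; exact: measurable_funX.
  - by move=> t _; rewrite /= lee_fin ler_norm.
apply: (@le_trans _ _ (\int[mu]_(t in `[0, T]) (2 * a ^+ 2 * y t ^+ 2 + 2 * b ^+ 2 * N ^+ 2))).
  by apply: le_Rintegral => // t; rewrite /= in_itv /=; exact: xle.
rewrite RintegralD//; last 2 first.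
- exact: integrable_scale.
- by apply: continuous_itv_integrable; exact: cst_continuous.
rewrite RintegralZl// Rintegral_cst_itv ?(ltW T0)// [leRHS]mulrDl lerD2l.
have := sqr_Rintegral_le iy iy2; rewrite -/N; set Y := \int[mu]_(t in _) _ => h.
rewrite (_ : T * _ = 2 * b ^+ 2 * T * N ^+ 2); last by ring.
rewrite (_ : _ * T ^+ 2 * _ = 2 * b ^+ 2 * T * (T * Y)); last by ring.
by rewrite ler_wpM2l// !mulr_ge0// ltW.
Qed.

(** As [y] need not be continuous, Gronwall is applied to its primitive [Phi], which satisfies
    [Phi <= N / p + (c / p) \int Phi]; the bound on [Phi] is then put back into the inequality for
    [y]. *)
Lemma gronwall_integral (x y : R -> R) (p c : R) : 0 < p -> 0 <= c ->
  mu.-integrable `[0, T] (EFin \o x) -> mu.-integrable `[0, T] (EFin \o y) ->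
  (forall t, 0 <= t <= T -> 0 <= x t) -> (forall t, 0 <= t <= T -> 0 <= y t) ->
  (forall t, 0 <= t <= T -> p * y t <= x t + c * \int[mu]_(s in `[0, t]) y s) ->
  forall t, 0 <= t <= T -> y t <= p^-1 * x t +
    c / p * (2 / p * expR ((2 * (c / p) + 1) * T)) * \int[mu]_(s in `[0, T]) x s.
Proof.
move=> p0 c0 ix iy x0 y0 h; set E := expR _; set N := \int[mu]_(s in _) x s.
have cp : 0 <= c / p by rewrite divr_ge0// ltW.
have N0 : 0 <= N by apply: Rintegral_ge0 => t; rewrite /= in_itv /=; exact: x0.
pose Phi (t : R) := \int[mu]_(s in `[0, t]) (y \_ `[0, T]) s.
have cPhi : continuous Phi.
  by apply: primitive_continuous => b; exact: integrable_patch_itv.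
have PhiE t : t <= T -> Phi t = \int[mu]_(s in `[0, t]) y s.
  exact: Rintegral_patch_itv.
have h' t : 0 <= t <= T -> y t <= p^-1 * x t + c / p * Phi t.
  move=> tT; have /andP[t0 tT'] := tT; rewrite PhiE//.
  rewrite (_ : _ + _ = p^-1 * (x t + c * \int[mu]_(s in `[0, t]) y s)); last by ring.
  by rewrite ler_pdivlMl//; exact: h.
have PhiB t : 0 <= t <= T -> Phi t <= 2 * (N / p) * E.
  apply: (gronwall T0) => //; first by rewrite divr_ge0// ltW.
  move=> {}t tT; have /andP[t0 tT'] := tT; rewrite {1}PhiE//.
  have ixt : mu.-integrable `[0, t] (EFin \o x) by apply: integrableS ix => //; exact: sub_itv0.
  have iyt : mu.-integrable `[0, t] (EFin \o y) by apply: integrableS iy => //; exact: sub_itv0.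
  have iPt : mu.-integrable `[0, t] (EFin \o Phi) by exact: continuous_itv_integrable.
  have i1 := integrable_scale p^-1 (measurable_itv `[0, t]) ixt.
  have i2 := integrable_scale (c / p) (measurable_itv `[0, t]) iPt.
  apply: (@le_trans _ _ (\int[mu]_(s in `[0, t]) (p^-1 * x s + c / p * Phi s))).
    apply: le_Rintegral => //; first exact: integrable_add.
    move=> s; rewrite /= in_itv /= => /andP[s0 st]; apply: h'.
    by rewrite s0 (le_trans st).
  rewrite RintegralD// !RintegralZl// lerD2r mulrC ler_wpM2r ?invr_ge0 ?(ltW p0)//.
  exact: Rintegral_le_itv0.
move=> t tT; apply: le_trans (h' t tT) _; rewrite lerD2l.
rewrite -[leRHS]mulrA ler_wpM2l//; apply: le_trans (PhiB t tT) _.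
by rewrite (_ : 2 * (N / p) * E = 2 / p * E * N)//; ring.
Qed.

End L2Compare.

(** * Volterra operators on Hilbert-valued functions *)

Section VectorVolterra.
Context {R : realType} {T : R}.
Hypothesis T0 : 0 < T.
Variable V : hilbertType R.
Local Notation mu := (@lebesgue_measure R).
Let mT : measurable (`[0, T]%classic : set R). Proof. by []. Qed.

(** Each value is a weak integral. Testing [x s - x t] against itself bounds its norm by the
    integral in [causal_modulus], so [x] is strongly continuous although [F] is only weakly
    measurable. *)
Lemma vector_volterra (K : R -> R -> R) (C : R) (F : R -> V) (be : R -> R) :
  (forall s, continuous (K ^~ s)) -> (forall t, continuous (K t)) ->
  (forall t s, `|K t s| <= C) ->
  (forall b, measurable_fun `[0, T] (fun s => '[F s, b])) ->
  mu.-integrable `[0, T] (EFin \o be) -> (forall s, 0 <= s <= T -> `|F s| <= be s) ->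
  exists x : R -> V, [/\
    forall t b, 0 <= t <= T -> '[x t, b] = \int[mu]_(s in `[0, t]) (K t s * '[F s, b]),
    forall t, 0 <= t <= T -> `|x t| <= C * \int[mu]_(s in `[0, T]) be s &
    forall t, 0 <= t <= T -> `|x t| <= C * \int[mu]_(s in `[0, t]) be s /\
      x s @[s --> within `[0, T] (nbhs t)] --> x t].
Proof.
move=> Kl Kr KC mF ibe Fbe; have C0 : 0 <= C := le_trans (normr_ge0 _) (KC 0 0).
have be0 s : 0 <= s <= T -> 0 <= be s.
  by move=> sT; exact: le_trans (normr_ge0 _) (Fbe s sT).
have ibt t : t <= T -> mu.-integrable `[0, t] (EFin \o be).
  by move=> tT; apply: integrableS ibe => //; exact: sub_itv0.
have /choice[x hx] : forall t, exists x : V, 0 <= t <= T ->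
    (forall b, '[x, b] = \int[mu]_(s in `[0, t]) (K t s * '[F s, b])) /\
    `|x| <= C * \int[mu]_(s in `[0, t]) be s.
  move=> t; have [tT|] := boolP (0 <= t <= T); last by exists 0.
  have /andP[t0 tT'] := tT.
  have [||||||x [h1 h2]] := @pettis R V `[0, t]%classic F (K t) be C.
  - by [].
  - by move=> b; apply: measurable_funS (mF b) => //; exact: sub_itv0.
  - exact: ibt.
  - by move=> s /(sub_itv0 tT'); rewrite /= in_itv /=; exact: Fbe.
  - by apply: continuous_measurable; exact: Kr.
  - by move=> s _; exact: KC.
  exists x => _; split=> //; apply: le_trans h2 _.
  rewrite -RintegralZl//; last exact: ibt.
  apply: le_Rintegral => //.
  - apply: (@integrable_mul_bounded _ _ C (fun s => `|K t s|)) => //; last exact: ibt.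
      apply: measurableT_comp => //; apply: continuous_measurable; exact: Kr.
    by move=> s _; rewrite normr_id.
  - by apply: integrable_scale => //; exact: ibt.
  - by move=> s /(sub_itv0 tT'); rewrite /= in_itv /= => sT; rewrite ler_wpM2r// be0.
exists x; split.
- by move=> t b tT; have [h _] := hx t tT.
- move=> t tT; have [_ h] := hx t tT; apply: le_trans h _; rewrite ler_wpM2l//.
  exact: Rintegral_le_itv0.
- move=> t tT; have [_ h] := hx t tT; split=> //.
  have iF b : mu.-integrable `[0, T] (EFin \o (fun s => '[F s, b])).
    by apply: weakly_integrable ibe _ b => // s; rewrite /= in_itv /=; exact: Fbe.
  have key s : 0 <= s <= T -> `|x s - x t| <=
      \int[mu]_(u in `[0, T]) (`|causal K s u - causal K t u| * `|be u|).
    move=> sT; set z := x s - x t.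
    have E r : 0 <= r <= T -> '[x r, z] = \int[mu]_(u in `[0, T]) (causal K r u * '[F u, z]).
      move=> rT; have [-> _] := hx r rT; apply: Rintegral_causal.
      by case/andP: rT.
    have i1 r : mu.-integrable `[0, T] (EFin \o (fun u => causal K r u * '[F u, z])).
      exact: (causal_integrable (C := C)).
    have i2 r : mu.-integrable `[0, T] (EFin \o (fun u => causal K r u * `|be u|)).
      apply: (causal_integrable (C := C)) => //; exact: integrable_norm.
    have zz : '[z, z] = \int[mu]_(u in `[0, T]) ((causal K s u - causal K t u) * '[F u, z]).
      rewrite {1}/z dotBl !E// -RintegralB//.
      by apply: eq_Rintegral => u _; rewrite mulrBl.
    have i3 : mu.-integrable `[0, T] (EFin \o (fun u => (causal K s u - causal K t u) * '[F u, z])).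
      have := integrable_sub mT (i1 s) (i1 t).
      by apply: eq_integrable => // u _ /=; rewrite mulrBl.
    have i4 : mu.-integrable `[0, T] (EFin \o (fun u => `|causal K s u - causal K t u| * `|be u|)).
      have := integrable_norm (integrable_sub mT (i2 s) (i2 t)).
      by apply: eq_integrable => // u _ /=; rewrite -mulrBl normrM normr_id.
    have [->|z0] := eqVneq z 0.
      by rewrite normr0; apply: Rintegral_ge0 => u _; rewrite mulr_ge0.
    rewrite -(ler_pM2r (x := `|z|)) ?normr_gt0// -expr2 -dotxx zz.
    apply: le_trans (ler_norm _) _; apply: le_trans (le_normr_Rintegral _ _) _ => //.
    rewrite mulrC -RintegralZl//; apply: le_Rintegral => //.
    + exact: integrable_norm.
    + exact: integrable_scale.
    + move=> u; rewrite /= in_itv /= => uT; rewrite normrM mulrCA ler_wpM2l//.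
      rewrite mulrC; apply: le_trans (dot_le _ _) _; rewrite ler_wpM2r//.
      exact: le_trans (Fbe u uT) (ler_norm _).
  have lim := causal_modulus Kl Kr KC (b := T) t ibe.
  apply/cvgrPdist_le => e e0; have /cvgrPdist_le/(_ e e0) := lim.
  rewrite /prop_near1 /within /=; apply: filterS => s hs; rewrite /= in_itv /= => sT.
  rewrite distrC; apply: le_trans (key s sT) _; apply: le_trans hs.
  by rewrite sub0r normrN ler_norm.
Qed.

Lemma vector_volterra_measurable (x : R -> V) :
  (forall t, 0 <= t <= T -> x s @[s --> within `[0, T] (nbhs t)] --> x t) ->
  forall b, measurable_fun `[0, T] (fun s => '[x s, b]).
Proof.
by move=> cx b; apply: strongly_measurable_dot => //; exact: continuous_strongly_measurable.
Qed.

(** Here [ka F + x] plays the derivative and [h] its primitive; both integrals come from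
    [vector_volterra], the second one with kernel 1. *)
Lemma vector_transfer (ka : R -> R) (K : R -> R -> R) (Ck C : R) (F : R -> V) (be : R -> R) :
  continuous ka -> (forall t, 0 <= t <= T -> `|ka t| <= Ck) ->
  (forall s, continuous (K ^~ s)) -> (forall t, continuous (K t)) ->
  (forall t s, `|K t s| <= C) ->
  (forall b, measurable_fun `[0, T] (fun s => '[F s, b])) ->
  mu.-integrable `[0, T] (EFin \o be) -> (forall s, 0 <= s <= T -> `|F s| <= be s) ->
  exists x h : R -> V, [/\
    forall t b, 0 <= t <= T -> '[x t, b] = \int[mu]_(s in `[0, t]) (K t s * '[F s, b]),
    forall t, 0 <= t <= T -> `|x t| <= C * \int[mu]_(s in `[0, t]) be s /\
      x s @[s --> within `[0, T] (nbhs t)] --> x t,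
    forall b, mu.-integrable `[0, T] (EFin \o (fun t => '[ka t *: F t + x t, b])),
    forall t b, 0 <= t <= T -> '[h t, b] = \int[mu]_(s in `[0, t]) '[ka s *: F s + x s, b] &
    forall t, 0 <= t <= T -> `|h t| <= (Ck + C * T) * \int[mu]_(s in `[0, T]) be s /\
      h s @[s --> within `[0, T] (nbhs t)] --> h t].
Proof.
move=> cka kaC Kl Kr KC mF ibe Fbe; have C0 : 0 <= C := le_trans (normr_ge0 _) (KC 0 0).
have Ck0 : 0 <= Ck by apply: le_trans (normr_ge0 _) (kaC 0 _); rewrite lexx ltW.
have [x [x1 x2 x3]] := vector_volterra Kl Kr KC mF ibe Fbe.
set N := \int[mu]_(s in `[0, T]) be s in x2 *.
pose be' s := Ck * be s + C * N.
have mx : forall b, measurable_fun `[0, T] (fun s => '[x s, b]).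
  by apply: vector_volterra_measurable => t tT; have [] := x3 t tT.
have mG b : measurable_fun `[0, T] (fun s => '[ka s *: F s + x s, b]).
  rewrite (_ : (fun s => _) = (fun s => ka s * '[F s, b] + '[x s, b])); last first.
    by apply/funext => s; rewrite dotDl dotZl.
  apply: measurable_funD => //; apply: measurable_funM => //.
  exact: continuous_measurable.
have ibe' : mu.-integrable `[0, T] (EFin \o be').
  apply: integrable_add => //; first exact: integrable_scale.
  by apply: continuous_itv_integrable; exact: cst_continuous.
have Gbe' s : 0 <= s <= T -> `|ka s *: F s + x s| <= be' s.
  move=> sT; apply: le_trans (ler_normD _ _) _; apply: lerD; last exact: x2.
  by rewrite normrZ ler_pM// ?kaC ?Fbe.
have one_l : forall s : R, continuous ((fun _ _ : R => (1 : R)) ^~ s).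
  by move=> s; exact: cst_continuous.
have one_b : forall t s : R, `|(fun _ _ : R => (1 : R)) t s| <= 1.
  by move=> t s /=; rewrite normr1.
have [h [h1 h2 h3]] := vector_volterra one_l (fun t => one_l t) one_b mG ibe' Gbe'.
exists x, h; split=> //.
- by move=> b; apply: weakly_integrable ibe' _ b => // s; rewrite /= in_itv /=; exact: Gbe'.
- by move=> t b tT; rewrite h1//; apply: eq_Rintegral => s _; rewrite mul1r.
- move=> t tT; split; last by have [] := h3 t tT.
  apply: le_trans (h2 t tT) _; rewrite mul1r /be' RintegralD//.
  + rewrite RintegralZl// Rintegral_cst_itv ?(ltW T0)// -/N.
    by rewrite (_ : Ck * N + T * (C * N) = (Ck + C * T) * N)//; ring.
  + exact: integrable_scale.
  + by apply: continuous_itv_integrable; exact: cst_continuous.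
Qed.

End VectorVolterra.

Section Transfer.
Context {R : realType} {T : R}.
Hypothesis T0 : 0 < T.
Local Notation mu := (@lebesgue_measure R).
Let mT : measurable (`[0, T]%classic : set R). Proof. by []. Qed.

Lemma L2_norm_integrable (G : hilbertType R) (g : R -> G) : L2 T g ->
  mu.-integrable `[0, T] (EFin \o (fun t => `|g t| ^+ 2)) /\
  mu.-integrable `[0, T] (EFin \o (fun t => `|g t|)).
Proof. by move=> [sg g2]; apply: sq_integrable => //; exact: strongly_measurable_norm. Qed.

Lemma normL2_sqr (G : normedModType R) (g : R -> G) :
  normL2 T g ^+ 2 = \int[mu]_(t in `[0, T]) (`|g t| ^+ 2).
Proof. by rewrite sqr_sqrtr//; apply: Rintegral_ge0 => t _; exact: sqr_ge0. Qed.

Lemma normH1_le (G : hilbertType R) (g h h' : R -> G) (k0 k1 : R) : 0 <= k0 -> 0 <= k1 ->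
  normL2 T h ^+ 2 <= k0 * normL2 T g ^+ 2 ->
  normL2 T h' ^+ 2 <= k1 * normL2 T g ^+ 2 ->
  normH1 T h h' <= Num.sqrt (k0 + k1) * normL2 T g.
Proof.
move=> k00 k10 h0 h1; have g0 : 0 <= normL2 T g by exact: sqrtr_ge0.
rewrite /normH1 -[X in _ * X]ger0_norm// -sqrtr_sqr -sqrtrM ?addr_ge0//.
by rewrite ler_sqrt ?mulr_ge0 ?addr_ge0 ?sqr_ge0// mulrDl lerD.
Qed.

Lemma le_normH1 (G : hilbertType R) (g h h' : R -> G) (k : R) : 0 <= k ->
  normL2 T g ^+ 2 <= k * normL2 T h' ^+ 2 -> normL2 T g <= Num.sqrt k * normH1 T h h'.
Proof.
move=> k0 hg; rewrite /normH1 -sqrtrM// -[normL2 T g]ger0_norm ?sqrtr_ge0//.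
rewrite -sqrtr_sqr ler_sqrt ?mulr_ge0 ?addr_ge0 ?sqr_ge0//.
by apply: le_trans hg _; rewrite ler_wpM2l// lerDr sqr_ge0.
Qed.

(** The upper bound integrates the pointwise bounds on [h] and [h']. For the lower one,
    [ka g = h' - x] with [|ka| >= p] gives [p |g t| <= |h' t| + C \int_0^t |g|], which Gronwall
    inverts; no closedness or spectral information enters. *)
Lemma observation_transfer (G : hilbertType R) (ka : R -> R) (K : R -> R -> R) (p Ck C : R) :
  0 < p -> continuous ka -> (forall t, 0 <= t <= T -> p <= `|ka t| <= Ck) ->
  (forall s, continuous (K ^~ s)) -> (forall t, continuous (K t)) ->
  (forall t s, `|K t s| <= C) ->
  exists2 k, 0 <= k & forall g : R -> G, L2 T g -> exists h h' : R -> G,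
    [/\ [/\ L2 T h, L2 T h' & weak_vderivative T h h'],
      forall t b, 0 <= t <= T -> '[h' t, b] = ka t * '[g t, b] +
        \int[mu]_(s in `[0, t]) (K t s * '[g s, b]),
      forall b, mu.-integrable `[0, T] (EFin \o (fun t => '[h' t, b])),
      forall t b, 0 <= t <= T -> '[h t, b] = \int[mu]_(s in `[0, t]) '[h' s, b] &
      normL2 T g <= k * normH1 T h h' /\ normH1 T h h' <= k * normL2 T g].
Proof.
move=> p0 cka kab Kl Kr KC; have C0 : 0 <= C := le_trans (normr_ge0 _) (KC 0 0).
have kaC t : 0 <= t <= T -> `|ka t| <= Ck by move=> /kab/andP[].
have Ck0 : 0 <= Ck by apply: le_trans (normr_ge0 _) (kaC 0 _); rewrite lexx ltW.
pose b1 := C / p * (2 / p * expR ((2 * (C / p) + 1) * T)).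
have b10 : 0 <= b1.
  by rewrite !mulr_ge0 ?invr_ge0 ?expR_ge0 ?(ltW p0).
have CT0 : 0 <= Ck + C * T by rewrite addr_ge0// mulr_ge0// ltW.
pose k1 := 2 * p^-1 ^+ 2 + 2 * b1 ^+ 2 * T ^+ 2.
pose k2 := 2 * Ck ^+ 2 + 2 * C ^+ 2 * T ^+ 2.
(* The value of [L2_compare] at [a = 0], since [h] is controlled by the integral of [|g|] alone. *)
pose k3 := 2 * 0 ^+ 2 + 2 * (Ck + C * T) ^+ 2 * T ^+ 2.
have pos (a b : R) : 0 <= 2 * a ^+ 2 + 2 * b ^+ 2 * T ^+ 2.
  have h1 := sqr_ge0 a; have h2 := sqr_ge0 (b * T).
  rewrite exprMn in h2; lra.
exists (Num.sqrt k1 + Num.sqrt (k3 + k2)); first by rewrite addr_ge0 ?sqrtr_ge0.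
move=> g Lg; have [ig2 ig] := L2_norm_integrable Lg; have [sg _] := Lg.
have mg b : measurable_fun `[0, T] (fun s => '[g s, b]) by exact: strongly_measurable_dot.
have [x [h [x1 x2 ix h1 h2]]] := vector_transfer T0 cka kaC Kl Kr KC mg ig (fun s _ => lexx _).
pose h' t := ka t *: g t + x t.
have sh : strongly_measurable `[0, T] h.
  by apply: continuous_strongly_measurable => t tT; have [] := h2 t tT.
have sh' : strongly_measurable `[0, T] h'.
  apply: strongly_measurableD.
    apply: strongly_measurableZ => //.
    by apply: continuous_strongly_measurable => t _; apply: cvg_within_filter; exact: cka.
  by apply: continuous_strongly_measurable => t tT; have [] := x2 t tT.
set N := \int[mu]_(s in `[0, T]) `|g s| in h2.
have xN t : 0 <= t <= T -> `|x t| <= C * \int[mu]_(s in `[0, t]) `|g s|.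
  by move=> tT; have [] := x2 t tT.
have xN' t : 0 <= t <= T -> `|x t| <= C * N.
  move=> tT; apply: le_trans (xN t tT) _; rewrite ler_wpM2l//.
  exact: Rintegral_le_itv0.
have [h'2 h'g] : (\int[mu]_(t in `[0%R, T]) (`|h' t| ^+ 2)%:E < +oo)%E /\
    \int[mu]_(t in `[0, T]) (`|h' t| ^+ 2) <= k2 * \int[mu]_(t in `[0, T]) (`|g t| ^+ 2).
  apply: L2_compare => //; first exact: strongly_measurable_norm.
  move=> t tT; rewrite normr_ge0; apply: le_trans (ler_normD _ _) _.
  by rewrite lerD ?xN'// normrZ ler_wpM2r ?kaC.
have [hh hg] : (\int[mu]_(t in `[0%R, T]) (`|h t| ^+ 2)%:E < +oo)%E /\
    \int[mu]_(t in `[0, T]) (`|h t| ^+ 2) <= k3 * \int[mu]_(t in `[0, T]) (`|g t| ^+ 2).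
  apply: L2_compare => //; first exact: strongly_measurable_norm.
  by move=> t tT; rewrite normr_ge0 mul0r add0r; have [] := h2 t tT.
have Lh : L2 T h by split.
have Lh' : L2 T h' by split.
have [ih'2 ih'] := L2_norm_integrable Lh'.
have gb t : 0 <= t <= T -> p * `|g t| <= `|h' t| + C * \int[mu]_(s in `[0, t]) `|g s|.
  move=> tT; have /andP[pk _] := kab t tT.
  apply: (@le_trans _ _ `|ka t *: g t|); first by rewrite normrZ ler_wpM2r.
  have -> : ka t *: g t = h' t - x t by rewrite /h' addrK.
  by apply: le_trans (ler_normB _ _) _; rewrite lerD2l; exact: xN.
have gle := gronwall_integral T0 p0 C0 ih' ig (fun t _ => normr_ge0 _) (fun t _ => normr_ge0 _) gb.
have pi0 : 0 <= p^-1 by rewrite invr_ge0 ltW.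
have [_ gh'] : (\int[mu]_(t in `[0%R, T]) (`|g t| ^+ 2)%:E < +oo)%E /\
    \int[mu]_(t in `[0, T]) (`|g t| ^+ 2) <= k1 * \int[mu]_(t in `[0, T]) (`|h' t| ^+ 2).
  apply: L2_compare => //; first exact: strongly_measurable_norm.
  by move=> t tT; rewrite normr_ge0; exact: gle.
exists h, h'; split=> //.
- split=> // b phi tphi; rewrite -(primitive_weak (ix b) tphi).
  by apply: eq_Rintegral => t; rewrite inE /= in_itv /= => tT; rewrite h1.
- by move=> t b tT; rewrite /h' dotDl dotZl x1.
- rewrite -!normL2_sqr in h'g hg gh'; split.
    apply: le_trans (le_normH1 h (pos _ _) gh') _.
    by rewrite ler_wpM2r ?sqrtr_ge0// lerDl sqrtr_ge0.
  apply: le_trans (normH1_le (pos _ _) (pos _ _) hg h'g) _.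
  by rewrite ler_wpM2r ?sqrtr_ge0// lerDr sqrtr_ge0.
Qed.

End Transfer.

(** * The wave with zero initial position *)

Section SpectralWave.
Context {R : realType} {H : hilbertType R}.
Variables (A : operator H H) (T : R).
Hypotheses (T0 : 0 < T) (hA : condition_A A).
Local Notation mu := (@lebesgue_measure R).
Local Notation kern := (kern T).
Local Notation I := (@kint R T).

Lemma eigenvectors_total (x : H) :
  (forall phi m, opdom A phi -> A phi = m *: phi -> '[x, phi] = 0) -> x = 0.
Proof.
have [e [m [c [_ he _ _ tot]]]] := eigenbasis hA.
by move=> h; apply: tot => n; have [d E _] := he n; exact: h E.
Qed.

(** [w t] is the multiplier with symbol [m |-> s_m(t)] applied to [f]. Semiboundedness keeps the
    eigenvalues above [- c], where [wave_kern_bound] is uniform; weak measurability follows from the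
    continuity of the partial sums in [t]. *)
Lemma spectral_wave : exists (s : R -> kern) (C : R), [/\ 0 <= C,
  forall m, kdelta (s m) = 0 /\ s m = I * (I - kscal m * (I * s m)) &
  forall f, exists w : R -> H, [/\ forall t, `|w t| <= C * `|f|,
    forall a, measurable_fun `[0, T] (fun t => '[w t, a]) &
    forall phi m t, opdom A phi -> A phi = m *: phi ->
      '[w t, phi] = kfun (s m) t * '[f, phi]]].
Proof.
have [e [m [c [c0 he orth e1 tot]]]] := eigenbasis hA.
have [s hs] := choice (wave_kern_exists T0).
have [C C0 hC] := wave_kern_bound T0 c0.
have sC t k : `|kfun (s (m k)) t| <= C.
  by have [ds sE] := hs (m k); have [_ _ cm] := he k; exact: (hC _ _ cm ds sE).
exists s, C; split=> // f.
have hw0 t := diagonal_exists orth e1 f C0 (sC t).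
have /choice[w hw] : forall t, exists w : H, `|w| <= C * `|f| /\
    forall a, diagonal_sum e (fun k => kfun (s (m k)) t) f a @ \oo --> '[w, a].
  by move=> t; have [w w1 w2] := hw0 t; exists w.
have symA := self_adjoint_sym (let: And5 h _ _ _ _ := hA in h).
have eA n : opdom A (e n) /\ A (e n) = m n *: e n by have [] := he n.
exists w; split.
- by move=> t; have [] := hw t.
- move=> a; apply: (measurable_fun_cvg
    (h := fun n t => diagonal_sum e (fun k => kfun (s (m k)) t) f a n)) => //.
    move=> n; apply: measurable_sum => k; apply: measurable_funM; last exact: measurable_cst.
    apply: measurable_funM; last exact: measurable_cst.
    by apply: continuous_measurable; exact: kfun_continuous.
  by move=> t _; have [_] := hw t; exact.
- move=> phi p t dphi Aphi; have [_ h] := hw t.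
  exact: (@diagonal_eigen _ _ e orth e1 tot A m symA eA (fun q => kfun (s q) t) C f _ phi p).
Qed.

Lemma spectral_wave_solution (s : R -> kern) (f : H) (w : R -> H) :
  (forall m, kdelta (s m) = 0 /\ s m = I * (I - kscal m * (I * s m))) ->
  (forall phi m t, opdom A phi -> A phi = m *: phi ->
      '[w t, phi] = kfun (s m) t * '[f, phi]) ->
  wave_solution A T 0 f w.
Proof.
move=> hs hw phi m dphi Aphi; have [ds sE] := hs m; rewrite dot0l.
apply: (@kern_ivp _ _ T0 (kscal '[f, phi] * s m) (- kscal m * (kscal '[f, phi] * s m))).
- rewrite kscal0 {1}sE -[X in I * (X - _)]mulr1; ring.
- by move=> t tT; rewrite (hw phi m t dphi Aphi) kfun_scal mulrC.
- move=> t tT; rewrite (hw phi m t dphi Aphi) -kscalN !kfun_scal; ring.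
- by rewrite !kdeltaM ds !mulr0.
Qed.

End SpectralWave.

Section Observes.
Context {R : realType} {T : R}.
Local Notation mu := (@lebesgue_measure R).

Lemma ae_zero_Rintegral (t : R) (f : R -> R) :
  mu.-integrable `[0, t] (EFin \o f) ->
  {ae mu, forall s, s \in `[0, t] -> f s = 0} -> \int[mu]_(s in `[0, t]) f s = 0.
Proof.
move=> /integrable_measurable mf f0; rewrite (@ae_eq_Rintegral _ _ _ (cst 0))//.
by rewrite /Rintegral integral0.
Qed.

(** Stated through inner products, so that one relation covers both the wave in [H] and its
    observation in [G]. *)
Definition transfer (ka : R -> R) (K : R -> R -> R) (V : hilbertType R) (F v u : R -> V) :=
  [/\ forall a, mu.-integrable `[0, T] (EFin \o (fun s => '[F s, a])),
      forall a, mu.-integrable `[0, T] (EFin \o (fun s => '[v s, a])),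
      forall t a, 0 <= t <= T -> '[v t, a] = ka t * '[F t, a] +
        \int[mu]_(s in `[0, t]) (K t s * '[F s, a]) &
      forall t a, 0 <= t <= T -> '[u t, a] = \int[mu]_(s in `[0, t]) '[v s, a]].

(** If [(a, b)] annihilates the graph of [B], then [<w, a> + <g, b>] vanishes almost everywhere. The
    transfer acts on this scalar function with the same [ka] and [K] on both sides, so
    [<u, a> + <h, b>] vanishes at every [t], and [closed_graph_weak] concludes. *)
Lemma transfer_observes (H G : hilbertType R) (B : operator H G) (ka : R -> R)
    (K : R -> R -> R) (C : R) (w v u : R -> H) (g h' h : R -> G) :
  closed_op B -> observes B T w g -> (forall t, continuous (K t)) ->
  (forall t s, `|K t s| <= C) -> transfer ka K w v u -> transfer ka K g h' h ->
  forall t, 0 <= t <= T -> opdom B (u t) /\ h t = B (u t).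
Proof.
move=> cB obs Kr KC [iw iv vE uE] [ig ih' h'E hE] t tT.
have ind s (f : R -> R) : 0 <= s <= T -> mu.-integrable `[0, T] (EFin \o f) ->
    mu.-integrable `[0, s] (EFin \o f).
  by case/andP=> _ sT; apply: integrableS => //; exact: sub_itv0.
have iK s (f : R -> R) : 0 <= s <= T -> mu.-integrable `[0, T] (EFin \o f) ->
    mu.-integrable `[0, s] (EFin \o (fun r => K s r * f r)).
  move=> sT /(ind _ _ sT); apply: (@integrable_mul_bounded _ _ C) => //.
  by apply: continuous_measurable; exact: Kr.
apply: closed_graph_weak => // a b hab; rewrite uE// hE//.
have z0 : {ae mu, forall s, s \in `[0, T] -> '[w s, a] + '[g s, b] = 0}.
  by apply: aeS obs => s hs sT; have [dw ->] := hs sT; exact: hab.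
have zs s : 0 <= s <= T -> \int[mu]_(r in `[0, s]) (K s r * ('[w r, a] + '[g r, b])) = 0.
  move=> sT; apply: ae_zero_Rintegral.
    by apply: iK => //; exact: integrable_add.
  apply: aeS z0 => r hr rs; rewrite hr ?mulr0//.
  by case/andP: sT => _ sT; apply: (sub_itv0 sT); rewrite /= rs.
rewrite -RintegralD//; last 2 first.
- exact: ind.
- exact: ind.
apply: ae_zero_Rintegral; first by apply: integrable_add => //; exact: ind.
apply: aeS z0 => s hs st; have sT : s \in `[0, T].
  by case/andP: tT => _ tT'; apply: (sub_itv0 tT'); rewrite /= st.
have sT' : 0 <= s <= T by move: sT; rewrite in_itv.
rewrite vE// h'E// addrACA -mulrDr hs// mulr0 add0r; apply: etrans (zs s sT').
rewrite -RintegralD//.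
- by apply: eq_Rintegral => r _; rewrite mulrDr.
- exact: iK.
- exact: iK.
Qed.

End Observes.

Lemma exp_itv_bound (R : realType) (a T t : R) : 0 <= t <= T ->
  expR (- (`|a| * T)) <= expR (- a * t) <= expR (`|a| * T).
Proof.
move=> /andP[t0 tT]; rewrite !ler_expR.
have h : `|- a * t| <= `|a| * T by rewrite normrM normrN (ger0_norm t0) ler_wpM2l.
by move: h; rewrite ler_norml.
Qed.

(** * The two-sided estimate for the memory equation *)

Theorem theorem1p2 (R : realType) (H G : hilbertType R)
    (A : operator H H) (B : operator H G) (T0 : R)
    (hT0 : 0 <= T0) (hA : condition_A A) (hB : condition_B A B T0)
    (T : R) (hT : T0 < T) (M sigma : R -> R)
    (hM : in_H2 T M) (hsigma : in_C1 T sigma) (hsigma0 : sigma 0 != 0) :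
  exists2 C : R, 0 < C &
    forall f : H,
      (exists u : R -> H, memory_solution A T M sigma f u) /\
      (forall u : R -> H, memory_solution A T M sigma f u ->
        exists g g' : R -> G,
          [/\ observes B T u g, L2 T g, L2 T g', weak_vderivative T g g' &
              C^-1 * `|f| <= normH1 T g g' /\ normH1 T g g' <= C * `|f|]).
Proof.
have T_gt0 : 0 < T by exact: le_lt_trans hT0 hT.
pose mu := @lebesgue_measure R; pose I := @kint R T.
have [Md hMd] := H2_kern T_gt0 hM.
have mM : measurable_fun `[0, T] M.
  by have [? [? [/L2_real_integrable/integrable_measurable]]] := hM.
have [sd [sd0 hsd]] := C1_kern T_gt0 hsigma.
have [D hD] := kern_inverse_sqrt T_gt0 Md.
(* The coefficient of the transmutation series. As [1 + I D] has delta part 1, that of [rho] is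
   [sigma 0]. *)
set rho := (1 + I * D) ^+ 2 * sd.
have rho0 : kdelta rho = sigma 0.
  by rewrite !kdeltaM kdeltaD kdeltaM kint_delta mul0r kdelta1 addr0 !mul1r.
have [K [CK [CK0 Kl Kr KC hK]]] := transmutation_kernel T_gt0 D rho.
set a := kdelta D in hK; pose ka (t : R) := kdelta rho * expR (- a * t).
have cka : continuous ka.
  move=> t; apply: cvgM; first exact: cvg_cst.
  apply: (@continuous_comp _ _ _ (fun t => - a * t) expR); last exact: continuous_expR.
  by apply: cvgM; [exact: cvg_cst|exact: cvg_id].
(* Bounds of [|ka|] on [[0, T]]; the lower one is positive because [sigma 0] is nonzero. *)
pose p := `|sigma 0| * expR (- (`|a| * T)).
pose Ck := `|sigma 0| * expR (`|a| * T).
have p0 : 0 < p by rewrite mulr_gt0 ?normr_gt0 ?expR_gt0.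
have kab t : 0 <= t <= T -> p <= `|ka t| <= Ck.
  move=> tT; have /andP[e1 e2] := exp_itv_bound a tT.
  by rewrite normrM rho0 (ger0_norm (expR_ge0 _)) !ler_wpM2l.
have kaC t : 0 <= t <= T -> `|ka t| <= Ck by move=> /kab/andP[].
have [k k0 htr] := observation_transfer T_gt0 G p0 cka kab Kl Kr KC.
have [s [Cs [Cs0 hs hw]]] := spectral_wave T_gt0 hA.
have [cB _ [S _ /(_ T hT)[CB CB0 hCB]]] := hB.
(* The summand [CB] keeps the constant positive when [k = 0]. *)
exists (CB * k + CB); first by rewrite ltr_wpDl// mulr_ge0// ltW.
move=> f; have [w [wb wm wE]] := hw f.
(* With zero initial position the energy in condition (B) reduces to the norm of [f]. *)
have [|g [obs Lg lo up]] := hCB 0 f w _ (spectral_wave_solution T_gt0 hs wE).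
  split; first exact: opdom0.
  by apply: subset_closure; exists 0; [exact: opdom0|].
rewrite /norm1 opfun0 !normr0 expr0n addr0 sqrtr0 expr0n add0r sqrtr_sqr normr_id in lo up.
have [h [h' [[Lh Lh' wd] h'E ih' hE [ub lb]]]] := htr g Lg.
have ibe : mu.-integrable `[0, T] (EFin \o (fun=> Cs * `|f|)).
  by apply: continuous_itv_integrable; exact: cst_continuous.
(* The candidate solution [u] is obtained from [w] by the very transfer that produced [h] from
   [g]. *)
have [x [u [x1 _ iv uE _]]] := vector_transfer T_gt0 cka kaC Kl Kr KC wm ibe (fun t _ => wb t).
have tru : transfer (T := T) ka K w (fun t => ka t *: w t + x t) u.
  split=> //; last by move=> t b tT; rewrite dotDl dotZl x1.
  by apply: weakly_integrable ibe _ => // t _; exact: wb.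
have trh : transfer (T := T) ka K g h' h.
  have [_ ig] := L2_norm_integrable Lg; have [sg _] := Lg.
  split=> //; apply: weakly_integrable ig _ => // b; exact: strongly_measurable_dot.
(* Along [phi] the transfer turns [<f, phi> s] into [<f, phi> y'], with [y'] the transmutation
   series; its integral therefore solves the memory equation for the eigenvalue [m]. *)
have kE phi m : opdom A phi -> A phi = m *: phi -> exists y : kern T,
    [/\ kdelta y = 0, y = I * (I * memory_kern Md sd '[f, phi] m y) &
      forall t, 0 <= t <= T -> '[u t, phi] = kfun y t].
  move=> dphi Aphi; have [ds sE] := hs m; have [y' [dy' sy' y'E]] := hK _ ds.
  have yE := transmute T_gt0 sE hD sy'.
  exists (kscal '[f, phi] * (I * y')); split.
  - by rewrite !kdeltaM dy' !mulr0.
  - rewrite {1}yE /memory_kern -/I; ring.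
  - move=> t tT; rewrite kfun_scal kintM_fun ?clamp_id// dy' add0r uE//.
    rewrite -RintegralZl//; last first.
      by apply: continuous_itv_integrable; exact: kfun_continuous.
    apply: eq_Rintegral => r; rewrite inE /= in_itv /= => /andP[r0 rt].
    have rT : 0 <= r <= T by case/andP: tT => _; rewrite r0; exact: le_trans.
    rewrite dotDl dotZl x1// (wE phi m)// y'E//.
    rewrite mulrDr; congr (_ + _); first by rewrite /ka; ring.
    rewrite -RintegralZl//.
      by apply: eq_Rintegral => q _; rewrite (wE phi m)//; ring.
    apply: continuous_itv_integrable => q.
    by apply: cvgM; [exact: Kr|exact: kfun_continuous].
split.
  exists u => phi m dphi Aphi; have [y [dy yE uy]] := kE phi m dphi Aphi.
  exact: (memory_ivp_exists T_gt0 mM hMd hsd dy yE uy).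
(* Scalar uniqueness fixes the coefficient along each eigenvector, and these vectors are total:
   every solution equals [u] on [[0, T]], so one pair [h], [h'] serves them all. *)
move=> u' hu'; have uu' t : 0 <= t <= T -> u' t = u t.
  move=> tT; apply/eqP; rewrite -subr_eq0; apply/eqP.
  apply: (eigenvectors_total hA) => phi m dphi Aphi.
  have [y [dy yE uy]] := kE phi m dphi Aphi.
  rewrite dotBl uy// (memory_ivp_unique T_gt0 mM hMd hsd dy yE (hu' phi m dphi Aphi))//.
  by rewrite subrr.
exists h, h'; split=> //.
  apply: aeW => t; rewrite in_itv /= => tT; rewrite uu'//.
  exact: (transfer_observes cB obs Kr KC tru trh).
have N0 : 0 <= normH1 T h h' by exact: sqrtr_ge0.
split.
  rewrite ler_pdivrMl; last by rewrite ltr_wpDl// mulr_ge0// ltW.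
  rewrite ler_pdivrMl// in lo; apply: le_trans lo _.
  rewrite mulrDl; apply: le_trans (_ : CB * (k * normH1 T h h') <= _).
    by rewrite ler_wpM2l// ltW.
  by rewrite mulrA lerDl mulr_ge0// ltW.
apply: le_trans lb _; apply: (@le_trans _ _ (k * (CB * `|f|))); first by rewrite ler_wpM2l.
by rewrite mulrA [k * CB]mulrC ler_wpM2r// lerDl ltW.
Qed.
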